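(* Let $n\ge 1$ be an integer, let $D\subset\mathbb{R}^d$ be open, and let $F_\varepsilon:D\to\mathbb{R}^d$ be a tangent to identity family of maps such that $(x,\varepsilon)\mapsto F_\varepsilon(x)$ belongs to $C^{n+1}\bigl(D\times[-\varepsilon_0,\varepsilon_0]\bigr)$ for some $\varepsilon_0>0$. Then there is a unique vector field, polynomial in $\varepsilon$, of the form $g_\varepsilon(x)=\sum_{k=0}^{n-1}\varepsilon^k g_k(x)$ such that $$F_\varepsilon=\Phi^1_{\varepsilon g_\varepsilon}+O(\varepsilon^{n+1})$$ uniformly on every compact subset of $D$. Moreover, for all integers $k,m$ with $1\le k\le m\le n$, every interpolating vector field $X_m=X_m(x,\varepsilon)$ of order $m$ of the map $F_\varepsilon$ satisfies $$\frac{1}{k!}\left.\frac{\partial^k X_m}{\partial\varepsilon^k}\right|_{\varepsilon=0}=g_{k-1},$$ and consequently $$F_\varepsilon=\Phi^1_{X_m}+O(\varepsilon^{m+1}).$$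
   Context: A smooth family $F_\varepsilon:D\to\mathbb{R}^d$ is called tangent to identity if $F_\varepsilon(x)=x+\varepsilon f_\varepsilon(x)$, where the Taylor expansion of $f_\varepsilon$ in $\varepsilon$ up to order $n$ is $f_\varepsilon(x)=\sum_{k=0}^{n-1}\varepsilon^k f_k(x)+\varepsilon^n r_n(x,\varepsilon)$ with a bounded remainder $r_n$. $\Phi^t_{X}$ denotes the time-$t$ map of the flow of the autonomous differential equation $\dot x=X(x)$ (for a vector field depending on $\varepsilon$, the flow is taken for each fixed $\varepsilon$). The $O(\cdot)$ estimates are for $\varepsilon\to0$, on compact subsets of $D$, on which the maps and flows involved are defined for all sufficiently small $|\varepsilon|$. Interpolating vector field of order $m$: fix an integer $s$ with $0\le s\le m$ (the choice of starting point of the trajectory segment). For a map $F$ and a point $x$, let $P_m(t,x)$ be the unique polynomial in $t$ of degree at most $m$ with $P_m(k,x)=F^k(x)$ for $k=-s,\ldots,m-s$ (where $F^k$ is the $k$-th iterate, and negative $k$ means iterates of the local inverse $F^{-1}$, close to the identity). Then $$X_m(x)=\frac{\partial P_m}{\partial t}(0,x)=\sum_{k=-s}^{m-s}b_k'(0)F^k(x),\qquad b_k(t)=\prod_{-s\le j\le m-s,\ j\ne k}\frac{t-j}{k-j}.$$ For the family $F_\varepsilon$ one applies this for each fixed $\varepsilon$ to obtain $X_m(x,\varepsilon)$. *)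

(* Defs.v *)
From HB Require Import structures.
From mathcomp Require Import all_boot all_order all_algebra.
From mathcomp Require Import all_classical all_reals all_analysis.
Set Implicit Arguments.
Unset Strict Implicit.
Unset Printing Implicit Defensive.
Import Order.TTheory GRing.Theory Num.Theory.
Import numFieldNormedType.Exports.
Local Open Scope classical_set_scope.
Local Open Scope ring_scope.

(* [Ck k A f]: all derivatives of [f] of order at most [k] exist in the interior
   of [A] and extend continuously to [A].  For open [A] this is the usual C^k;
   for [A] = (open set) * (closed interval) the continuous extensions are the
   one-sided derivatives at the boundary. *)
Fixpoint Ck (R : realType) (U W : normedModType R) (k : nat) (A : set U)
    (f : U -> W) : Prop :=
  {within A, continuous f} /\
  match k with
  | 0 => True
  | k'.+1 =>
      (forall p, interior A p -> differentiable f p) /\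
      (forall v : U, exists h : U -> W,
          Ck k' A h /\ forall p, interior A p -> 'd f p v = h p)
  end.

(* All maps are total; only their values on [D] (and for [|e| <= e0]) are
   relevant.  The remainder is bounded on compact subsets of [D]. *)
Definition tangent_to_identity (R : realType) (d : nat) (D : set 'rV[R]_d)
    (e0 : R) (n : nat) (F : R -> 'rV[R]_d -> 'rV[R]_d) : Prop :=
  exists (f : nat -> 'rV[R]_d -> 'rV[R]_d) (r : 'rV[R]_d -> R -> 'rV[R]_d),
    (forall (x : 'rV[R]_d) (e : R), D x -> `|e| <= e0 ->
       F e x = x + e *: (\sum_(k < n) e ^+ k *: f k x + e ^+ n *: r x e)) /\
    (forall K : set 'rV[R]_d, compact K -> K `<=` D ->
       exists C : R, forall (x : 'rV[R]_d) (e : R),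
         K x -> `|e| <= e0 -> `|r x e| <= C).

Definition poly_field (R : realType) (d n : nat)
    (g : nat -> 'rV[R]_d -> 'rV[R]_d) (e : R) (x : 'rV[R]_d) : 'rV[R]_d :=
  \sum_(k < n) e ^+ k *: g k x.

(* The graph of the flow: [flow D X T x y] means that y = Phi^T_X(x), i.e. a
   solution of u' = X(u) staying in [D] goes from [x] to [y] in time T >= 0. *)
Definition flow (R : realType) (d : nat) (D : set 'rV[R]_d)
    (X : 'rV[R]_d -> 'rV[R]_d) (T : R) (x y : 'rV[R]_d) : Prop :=
  exists u : R -> 'rV[R]_d,
    [/\ u 0 = x, u T = y, {within `[0, T], continuous u},
        forall t : R, 0 <= t <= T -> D (u t) &
        forall t : R, 0 < t < T -> is_derive t 1 u (X (u t))].

(* F_e = Phi^1_{X_e} + O(e^N), uniformly on every compact subset of [D];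
   this includes the existence of the time-one map for small [e]. *)
Definition flow_approx (R : realType) (d : nat) (D : set 'rV[R]_d)
    (F X : R -> 'rV[R]_d -> 'rV[R]_d) (N : nat) : Prop :=
  forall K : set 'rV[R]_d, compact K -> K `<=` D ->
    exists C : R, \forall e \near nbhs (0 : R), forall x : 'rV[R]_d, K x ->
      (exists y : 'rV[R]_d, flow D (X e) 1 x y) /\
      (forall y : 'rV[R]_d, flow D (X e) 1 x y ->
         `|F e x - y| <= C * `|e| ^+ N).

(* [G e] is the local inverse of [F e] close to the identity; on each compact
   subset of [D] this determines [G e] uniquely for small [e]. *)
Definition local_inverse (R : realType) (d : nat) (D : set 'rV[R]_d)
    (F G : R -> 'rV[R]_d -> 'rV[R]_d) : Prop :=
  forall K : set 'rV[R]_d, compact K -> K `<=` D ->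
  forall rho : R, 0 < rho ->
    \forall e \near nbhs (0 : R), forall x : 'rV[R]_d, K x ->
      [/\ D (G e x), F e (G e x) = x & `|G e x - x| < rho].

Definition iterz (T : Type) (F G : T -> T) (k : int) (x : T) : T :=
  match k with
  | Posz j => iter j F x
  | Negz j => iter j.+1 G x
  end.

(* The nodes -s, ..., m - s are indexed by i = 0, ..., m. *)
Definition node (s i : nat) : int := i%:Z - s%:Z.

Definition lagrange_basis (R : realType) (m s : nat) (i : 'I_m.+1) : {poly R} :=
  \prod_(j < m.+1 | j != i)
    (((node s i)%:~R - (node s j)%:~R)^-1 *: ('X - ((node s j)%:~R)%:P)).

Definition interp_field (R : realType) (d : nat)
    (F G : 'rV[R]_d -> 'rV[R]_d) (m s : nat) (x : 'rV[R]_d) : 'rV[R]_d :=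
  \sum_(i < m.+1)
    ((lagrange_basis R s i)^`()).[0] *: iterz F G (node s i) x.

(* Since [derive1n] is total, existence of the derivatives is stated apart. *)
Definition nderivable (R : realType) (V : normedModType R) (k : nat)
    (f : R -> V) (t : R) : Prop :=
  \forall y \near nbhs t, forall j : nat, (j < k)%N ->
    derivable (derive1n j f) y 1.

(* Main.v *)
Require Import Defs.
From HB Require Import structures.
From mathcomp Require Import all_boot all_order all_algebra.
From mathcomp Require Import ring lra.
From mathcomp Require Import all_classical all_reals all_analysis.
Set Implicit Arguments.
Unset Strict Implicit.
Unset Printing Implicit Defensive.
Import Order.TTheory GRing.Theory Num.Theory.
Import numFieldNormedType.Exports.
Local Open Scope classical_set_scope.
Local Open Scope ring_scope.

(** For F_0 = id, the l-th derivative in e at e = 0 of the orbit F_e^t(x), t an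
    integer, is a polynomial in t of degree at most l: the increment
    F_e^{t+1}(x) - F_e^t(x) = phi(F_e^t(x), e) vanishes at e = 0, so its l-th
    derivative only involves derivatives of the orbit of order < l, and the
    discrete primitive of a polynomial is a polynomial of one degree more.
    Lagrange interpolation of order m is exact on degrees <= m, so the e-jet of
    X_m of order m does not depend on m, on the choice of nodes or of the
    inverse; it defines g.  For X_n, let Q(t) be the interpolating curve through
    x, F_e(x), ..., F_e^n(x).  The e-jet of order n of the defect Q' - X_n(Q) is
    polynomial in t of degree at most n and vanishes at t = 0, ..., n, so the
    defect is O(e^{n+1}) and Q(1) = F_e(x) is O(e^{n+1})-close to the time-one
    map of any field which is O(e^{n+1})-close to X_n.  Uniqueness compares
    the first coefficients at which two generators differ. *)

(** * Smooth germs *)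

(** All estimates are made on germs at (x, 0), with regularity joint in x and e; compactness of K
    then turns local constants into uniform ones. Two obstacles shape the proof. A local inverse is
    given pointwise, without any regularity, so negative iterates can be expanded in e only after it
    has been shown to be C^(n+1) in (x, e). And [flow] is a relation, so the bounds have to hold for
    every trajectory, not just for a constructed one. One remark deals with both: a C^1 map that
    vanishes for e = 0 has zero differential along x there, hence an arbitrarily small Lipschitz
    constant in x near (x, 0). With the constant 1/2, both the equation F_e(y) = x and the integral
    equation over unit time are solved by a contraction, and any trajectory can be compared with an
    approximate one. The order n + 1 of regularity serves twice: it bounds the Taylor remainders by
    e^(n+1), and it makes the last coefficient g_(n-1), a derivative of order n, still C^1 in x. *)

Section GermDifferentiability.
Context {R : realType}.
Implicit Types U V W : normedModType R.

Lemma diff_epsP U W (f df : U -> W) (q : U) :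
  linear df -> continuous df ->
  (forall e, 0 < e -> \forall h \near 0, `|f (h + q) - f q - df h| <= e * `|h|) ->
  differentiable f q /\ 'd f q = df :> (U -> W).
Proof.
move=> lin cdf H.
pose dM := GRing.isLinear.Build _ _ _ _ _ lin.
pose dL : {linear _ -> _} := HB.pack df dM.
have E : f \o shift q = cst (f q) + dL +o_ 0 id.
  apply/eqaddoP => e e0; have := H e e0.
  by apply: filterS => h; rewrite !fctE /= opprD addrA.
have dE := @diff_unique _ _ _ f dL q cdf E.
by split=> //; apply/diff_locallyP; rewrite dE.
Qed.

Lemma diff_eps U W (f : U -> W) (q : U) : differentiable f q ->
  forall e, 0 < e -> \forall h \near 0, `|f (h + q) - f q - 'd f q h| <= e * `|h|.
Proof.
move=> df e e0; have /eqaddoP/(_ e e0) := diff_locally df.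
by apply: filterS => h; rewrite !fctE /= opprD addrA.
Qed.

Lemma near_eq_diff U W (f g : U -> W) (q : U) :
  (\forall x \near q, f x = g x) -> differentiable f q ->
  differentiable g q /\ 'd g q = 'd f q :> (U -> W).
Proof.
move=> fg df; apply: diff_epsP; first exact: linearP.
  exact: diff_continuous.
move=> e e0; have fg0 : f q = g q := nbhs_singleton fg.
have : \forall h \near (0 : U), f (h + q) = g (h + q).
  by move: fg; rewrite (near_shift 0 q) /= subr0.
by apply: filterS2 (diff_eps df e0) => h /[swap]; rewrite fg0 => ->.
Qed.

End GermDifferentiability.

Section SmoothGerms.
Context {R : realType}.
Implicit Types U V W : normedModType R.

(* C^k near the point [p]; unlike [Ck] this is local, which suits expansions at
   e = 0. *)
Fixpoint smooth U W (k : nat) (f : U -> W) (p : U) : Prop :=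
  match k with
  | 0 => \forall q \near p, {for q, continuous f}
  | k'.+1 => (\forall q \near p, differentiable f q) /\
             forall v, smooth k' (fun q => 'd f q v) p
  end.

(** A differential at q depends on the map near q, so the equality is first spread to neighbourhoods
    of the points q by [near_join]. *)
Lemma smooth_near U W k (f g : U -> W) (p : U) :
  (\forall q \near p, f q = g q) -> smooth k f p -> smooth k g p.
Proof.
elim: k f g => [|k IH] f g fg /=.
  move=> cf; apply: filterS2 (near_join fg) cf => q fgq cf.
  have fgE := nbhs_singleton fgq; rewrite /prop_for /continuous_at -fgE.
  by apply: cvg_trans cf; apply: near_eq_cvg; apply: filterS fgq.
move=> [df sf]; split=> [|v].
  by apply: filterS2 (near_join fg) df => q fgq /(near_eq_diff fgq)[].
apply: IH (sf v).
by apply: filterS2 (near_join fg) df => q fgq /(near_eq_diff fgq)[_ ->].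
Qed.

Lemma smooth_continuous_near U W k (f : U -> W) (p : U) :
  smooth k f p -> \forall q \near p, {for q, continuous f}.
Proof.
case: k => [//|k] /= [df _]; apply: filterS df => q.
exact: differentiable_continuous.
Qed.

Lemma smooth_continuous U W k (f : U -> W) (p : U) :
  smooth k f p -> {for p, continuous f}.
Proof. by move=> /smooth_continuous_near /nbhs_singleton. Qed.

Lemma smoothS U W k (f : U -> W) (p : U) : smooth k.+1 f p -> smooth k f p.
Proof.
elim: k f => [|k IH] f sf; first exact: smooth_continuous_near sf.
by case: sf => df sf; split=> // v; exact/IH/sf.
Qed.

Lemma smooth_leq U W k l (f : U -> W) (p : U) :
  (k <= l)%N -> smooth l f p -> smooth k f p.
Proof.
elim: l => [|l IH]; first by rewrite leqn0 => /eqP ->.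
rewrite leq_eqVlt => /predU1P[->//|kl] /smoothS; exact: IH.
Qed.

Lemma smooth_cst U W k (a : W) (p : U) : smooth k (fun=> a) p.
Proof.
elim: k a => [|k IH] a /=; first by apply: nearW => q; exact: cvg_cst.
split=> [|v]; first by apply: nearW => q; exact: differentiable_cst.
apply: smooth_near (IH 0); apply: nearW => q.
by rewrite (@diff_cst _ _ _ a q).
Qed.

Lemma smoothD U W k (f g : U -> W) (p : U) :
  smooth k f p -> smooth k g p -> smooth k (fun q => f q + g q) p.
Proof.
elim: k f g => [|k IH] f g /=.
  by apply: filterS2 => q cf cg; exact: cvgD.
move=> [df sf] [dg sg]; split=> [|v].
  by apply: filterS2 df dg => q; exact: differentiableD.
apply: smooth_near (IH _ _ (sf v) (sg v)).
by apply: filterS2 df dg => q dfq dgq; exact/esym/(congr1 (@^~ v) (diffD dfq dgq)).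
Qed.

Lemma smooth_sum U W k (I : Type) (r : seq I) (P : pred I) (f : I -> U -> W) (p : U) :
  (forall i, P i -> smooth k (f i) p) -> smooth k (fun q => \sum_(i <- r | P i) f i q) p.
Proof.
move=> sf; elim: r => [|i r IH].
  by apply: smooth_near (smooth_cst k 0 p); apply: nearW => q; rewrite big_nil.
case: (boolP (P i)) => [Pi|/negbTE Pi].
  apply: smooth_near (smoothD (sf _ Pi) IH).
  by apply: nearW => q; rewrite big_cons Pi.
by apply: smooth_near IH; apply: nearW => q; rewrite big_cons Pi.
Qed.

Lemma diff_linear U W (L : U -> W) (q : U) : linear L -> continuous L ->
  differentiable L q /\ 'd L q = L :> (U -> W).
Proof.
move=> linL cL; apply: diff_epsP => // e e0; apply: nearW => h.
have := linL 1 h q; rewrite !scale1r => ->.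
by rewrite addrK subrr normr0 mulr_ge0 // ltW.
Qed.

Lemma smooth_linear U W k (L : U -> W) (p : U) :
  linear L -> continuous L -> smooth k L p.
Proof.
move=> linL cL; case: k => [|k] /=; first by apply: nearW => q; exact: cL.
split=> [|v]; first by apply: nearW => q; have [] := diff_linear q linL cL.
apply: smooth_near (smooth_cst k (L v) p); apply: nearW => q.
by have [_ ->] := diff_linear q linL cL.
Qed.

Lemma smooth_linear_comp U V W k (f : U -> V) (L : V -> W) (p : U) :
  linear L -> continuous L -> smooth k f p -> smooth k (fun q => L (f q)) p.
Proof.
move=> linL cL; elim: k f => [|k IH] f /=.
  by apply: filterS => q cf; apply: continuous_comp => //; exact: cL.
move=> [df sf]; split=> [|v].
  apply: filterS df => q dfq; apply: differentiable_comp => //.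
  by have [] := diff_linear (f q) linL cL.
apply: smooth_near (IH _ (sf v)); apply: filterS df => q dfq.
have [dL dLE] := diff_linear (f q) linL cL.
by rewrite -[fun q => L (f q)]/(L \o f) (diff_comp dfq dL) /= dLE.
Qed.

Lemma smoothZl U W k (a : R) (f : U -> W) (p : U) :
  smooth k f p -> smooth k (fun q => a *: f q) p.
Proof.
apply: smooth_linear_comp; last exact: scaler_continuous.
by move=> b u v; rewrite scalerDr !scalerA mulrC.
Qed.

Lemma smoothN U W k (f : U -> W) (p : U) :
  smooth k f p -> smooth k (fun q => - f q) p.
Proof.
move=> /(smoothZl (-1)); apply: smooth_near; apply: nearW => q.
by rewrite scaleN1r.
Qed.

Lemma smoothB U W k (f g : U -> W) (p : U) :
  smooth k f p -> smooth k g p -> smooth k (fun q => f q - g q) p.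
Proof. by move=> sf sg; exact: smoothD sf (smoothN sg). Qed.

Lemma diff_scale U W (a : U -> R) (f : U -> W) (q : U) :
  differentiable a q -> differentiable f q ->
  differentiable (fun x => a x *: f x) q /\
  forall v, 'd (fun x => a x *: f x) q v = a q *: 'd f q v + 'd a q v *: f q.
Proof.
move=> da df.
(* Scaling is packed as a bilinear map, which makes the product rule an instance of the chain rule
   through the pair (a, f). *)
pose s (u : R) (w : W) := u *: w.
have bil : bilinear_for (GRing.Scale.Law.clone _ _ *:%R _)
    (GRing.Scale.Law.clone _ _ *:%R _) s.
  split=> [w|u] b x y; rewrite /s.
    by rewrite scalerDl -scalerA.
  rewrite scalerDr; congr (_ + _).
  by change (u *: (b *: x) = b *: (u *: x)); rewrite !scalerA mulrC.
pose sM := bilinear_isBilinear.Build R R W W _ _ s bil.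
pose sB : {bilinear _ -> _ -> _} := HB.pack s sM.
have cs : continuous (fun z : R * W => sB z.1 z.2) by exact: scale_continuous.
have dp := differentiable_pair da df.
have ds := differentiable_bilin (a q, f q) cs.
have E : (fun x => a x *: f x) = (fun z => sB z.1 z.2) \o (fun y => (a y, f y)) by [].
rewrite E; split=> [|v]; first exact: differentiable_comp.
by rewrite (diff_comp dp ds) /= (diff_pair da df) (diff_bilin _ cs).
Qed.

Lemma smoothZ U W k (a : U -> R) (f : U -> W) (p : U) :
  smooth k a p -> smooth k f p -> smooth k (fun q => a q *: f q) p.
Proof.
elim: k a f => [|k IH] a f.
  by apply: filterS2 => q ca cf; exact: cvgZ.
move=> sa sf; have := sa; have := sf => - [df sf'] [da sa']; split=> [|v].
  by apply: filterS2 da df => q daq dfq; have [] := diff_scale daq dfq.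
have := smoothD (IH _ _ (smoothS sa) (sf' v)) (IH _ _ (sa' v) (smoothS sf)).
apply: smooth_near; apply: filterS2 da df => q daq dfq.
by have [_ ->] := diff_scale daq dfq.
Qed.

Lemma smoothM U k (a b : U -> R) (p : U) :
  smooth k a p -> smooth k b p -> smooth k (fun q => a q * b q) p.
Proof. exact: smoothZ. Qed.

Lemma smooth_prod U k (I : Type) (r : seq I) (P : pred I) (f : I -> U -> R) (p : U) :
  (forall i, P i -> smooth k (f i) p) -> smooth k (fun q => \prod_(i <- r | P i) f i q) p.
Proof.
move=> sf; elim: r => [|i r IH].
  by apply: smooth_near (smooth_cst k (1 : R) p); apply: nearW => q; rewrite big_nil.
case: (boolP (P i)) => [Pi|/negbTE Pi].
  apply: smooth_near (smoothM (sf _ Pi) IH).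
  by apply: nearW => q; rewrite big_cons Pi.
by apply: smooth_near IH; apply: nearW => q; rewrite big_cons Pi.
Qed.

Lemma smoothX U k (a : U -> R) (p : U) (n : nat) :
  smooth k a p -> smooth k (fun q => a q ^+ n) p.
Proof.
move=> sa; elim: n => [|n IH]; first exact: smooth_cst.
by apply: smooth_near (smoothM sa IH); apply: nearW => q; rewrite exprS.
Qed.

(** The derivative -a' / a^2 contains only the inverse itself at one order less, which the induction
    supplies. *)
Lemma smoothV U k (a : U -> R) (p : U) :
  a p != 0 -> smooth k a p -> smooth k (fun q => (a q)^-1) p.
Proof.
move=> ap0; elim: k => [|k IH] sa; have an0 : \forall q \near p, a q != 0.
- by move: (smooth_continuous sa) => /cvgr_neq0; apply.
- by apply: filterS2 an0 sa => q aq0; exact: cvgV.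
- by move: (smooth_continuous sa) => /cvgr_neq0; apply.
have := sa => -[da sa']; split=> [|v].
  by apply: filterS2 an0 da => q aq0 daq; exact: differentiableV.
have sV := IH (smoothS sa).
have := smoothN (smoothM (smoothM sV sV) (sa' v)).
apply: smooth_near; apply: filterS2 an0 da => q aq0 daq.
rewrite diffV //= expr2 invfM.
exact/esym/mulNr.
Qed.

Lemma smooth_pair U V W k (f : U -> V) (g : U -> W) (p : U) :
  smooth k f p -> smooth k g p -> smooth k (fun q => (f q, g q)) p.
Proof.
elim: k f g => [|k IH] f g /=.
  by apply: filterS2 => q cf cg; exact: cvg_pair.
move=> [df sf] [dg sg]; split=> [|v].
  by apply: filterS2 df dg => q; exact: differentiable_pair.
apply: smooth_near (IH _ _ (sf v) (sg v)).
by apply: filterS2 df dg => q dfq dgq; exact/esym/(congr1 (@^~ v) (diff_pair dfq dgq)).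
Qed.

(* A finite family of vectors and continuous coordinates, as finite
   dimensionality is needed for the chain rule on directional derivatives. *)
Definition framed V := exists (N : nat) (e : 'I_N -> V) (c : 'I_N -> V -> R),
  (forall i, linear (c i) /\ continuous (c i)) /\
  forall v, v = \sum_i c i v *: e i.

(** In ['d f (g q) ('d g q v)] the direction varies with q as well. Decomposed on the frame, it
    leaves derivatives of f in fixed directions, to which the induction applies. *)
Lemma smooth_comp U V W k (f : V -> W) (g : U -> V) (p : U) :
  framed V -> smooth k f (g p) -> smooth k g p -> smooth k (fun q => f (g q)) p.
Proof.
move=> [N [e [c [cL cE]]]]; elim: k f g => [|k IH] f g.
  move=> cf cg; have cgp := smooth_continuous cg.
  apply: filterS2 cg (cgp _ cf) => q cgq cfq.
  exact: continuous_comp.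
move=> sf sg; have cgp := smooth_continuous sg; have := sf; have := sg.
move=> -[dg sg'] [df sf']; split=> [|v].
  by apply: filterS2 dg (cgp _ df) => q dgq dfq; exact: differentiable_comp.
have : smooth k (fun q => \sum_i c i ('d g q v) *: 'd f (g q) (e i)) p.
  apply: smooth_sum => i _; apply: smoothZ; last exact: IH (sf' _) (smoothS sg).
  by have [? ?] := cL i; exact: smooth_linear_comp (sg' v).
apply: smooth_near; apply: filterS2 dg (cgp _ df) => q dgq dfq.
rewrite -[fun q => f (g q)]/(f \o g) (diff_comp dgq dfq) /=.
rewrite [in RHS](cE ('d g q v)) linear_sum.
by apply: eq_bigr => i _; rewrite linearZ.
Qed.

End SmoothGerms.

(** * Coordinates and frames *)

Section Coordinates.
Context {R : realType}.
Implicit Types U V W : normedModType R.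

Lemma rV_norm_coord m n (x : 'M[R]_(m, n)) i j : `|x i j| <= `|x|.
Proof.
by rewrite [leRHS]/Num.norm/= mx_normrE; exact: (le_bigmax _ _ (i, j)).
Qed.

Lemma rV_norm_le m n (x : 'M[R]_(m, n)) c :
  0 <= c -> (forall i j, `|x i j| <= c) -> `|x| <= c.
Proof.
move=> c0 xc; rewrite /Num.norm/= mx_normrE.
by apply: bigmax_le => // -[i j] _; exact: xc.
Qed.

Lemma framed_R : framed (R : normedModType R).
Proof.
exists 1%N, (fun=> 1), (fun _ v => v); split=> [_|v].
  by split=> // v; exact: cvg_id.
by rewrite big_ord1 /GRing.scale /= mulr1.
Qed.

Lemma framed_rV d : framed ('rV[R]_d : normedModType R).
Proof.
exists d, (fun i => 'e_i), (fun i (v : 'rV[R]_d) => v 0 i); split=> [i|v].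
  by split; [move=> a u v; rewrite !mxE|exact: coord_continuous].
exact: row_sum_delta.
Qed.

Lemma framed_prod U V : framed U -> framed V -> framed (U * V)%type.
Proof.
move=> [N [e [c [cL cE]]]] [N' [e' [c' [cL' cE']]]].
exists (N + N')%N, (fun i : 'I_(N + N') => match fintype.split i with
  | inl j => (e j, 0) | inr j => (0, e' j) end),
  (fun (i : 'I_(N + N')) (v : U * V) =>
     match fintype.split i with inl j => c j v.1 | inr j => c' j v.2 end).
split=> [i|v].
  case: (fintype.split i) => j.
    have [lj cj] := cL j; split=> [a u w|w]; first by rewrite /= lj.
    by apply: continuous_comp (cj _); exact: cvg_fst.
  have [lj cj] := cL' j; split=> [a u w|w]; first by rewrite /= lj.
  by apply: continuous_comp (cj _); exact: cvg_snd.
rewrite big_split_ord /=.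
under eq_bigr do rewrite (unsplitK (inl _)).
under [X in _ = _ + X]eq_bigr do rewrite (unsplitK (inr _)).
have E1 : \sum_(i < N) c i v.1 *: ((e i, 0) : U * V) = (v.1, 0).
  rewrite {2}(cE v.1); elim/big_ind2 : _ => //.
    by move=> ? x ? y -> ->; congr (_, _); rewrite addr0.
  by move=> i _; congr (_, _); rewrite scaler0.
have E2 : \sum_(i < N') c' i v.2 *: ((0, e' i) : U * V) = (0, v.2).
  rewrite {2}(cE' v.2); elim/big_ind2 : _ => //.
    by move=> ? x ? y -> ->; congr (_, _); rewrite addr0.
  by move=> i _; congr (_, _); rewrite scaler0.
by rewrite E1 E2; case: v {E1 E2} => a b; congr (_, _); rewrite ?addr0 ?add0r.
Qed.

Lemma smooth_fst U V k (p : U * V) : smooth k (fun z : U * V => z.1) p.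
Proof. by apply: smooth_linear => // z; exact: cvg_fst. Qed.

Lemma smooth_snd U V k (p : U * V) : smooth k (fun z : U * V => z.2) p.
Proof. by apply: smooth_linear => // z; exact: cvg_snd. Qed.

Lemma smooth_id U k (p : U) : smooth k (fun z : U => z) p.
Proof. by apply: smooth_linear => // z; exact: cvg_id. Qed.

Lemma smooth_coord U m n k (f : U -> 'M[R]_(m, n)) (p : U) i j :
  smooth k f p -> smooth k (fun q => f q i j) p.
Proof.
apply: (@smooth_linear_comp _ _ _ _ _ f (fun M : 'M[R]_(m, n) => M i j)).
  by move=> a u v; rewrite !mxE.
exact: coord_continuous.
Qed.

Lemma smooth_rV U d k (f : U -> 'rV[R]_d) (p : U) :
  (forall i, smooth k (fun q => f q 0 i) p) -> smooth k f p.
Proof.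
move=> sf; have : smooth k (fun q => \sum_i f q 0 i *: ('e_i : 'rV[R]_d)) p.
  by apply: smooth_sum => i _; apply: smoothZ (sf i) _; exact: smooth_cst.
by apply: smooth_near; apply: nearW => q; rewrite -row_sum_delta.
Qed.

End Coordinates.

(** * Mean value inequality and strict differentiability *)

Section MeanValue.
Context {R : realType}.
Implicit Types U V W P : normedModType R.

Lemma is_derive_coord d (u : R -> 'rV[R]_d) (t : R) (l : 'rV[R]_d) i :
  is_derive t 1 u l -> is_derive t 1 (fun s => u s 0 i) (l 0 i).
Proof.
move=> [du dE]; have /derivable_mxP /(_ 0 i) dui := du.
by split=> //; rewrite -dE (derive_mx du) mxE.
Qed.

(** The norm is the maximum of the coordinates: the scalar mean value theorem in each coordinate,
    with its own intermediate point, loses no constant. *)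
Lemma mean_value_le d (u du : R -> 'rV[R]_d) (a b C : R) : a <= b ->
  (forall t : R, a < t < b -> is_derive t 1 u (du t)) ->
  {within `[a, b], continuous u} ->
  (forall t : R, a < t < b -> `|du t| <= C) -> `|u b - u a| <= C * (b - a).
Proof.
move=> + dE cu duC; rewrite le_eqVlt => /predU1P[->|ab].
  by rewrite !subrr normr0 mulr0.
have C0 : 0 <= C.
  apply: le_trans (duC ((a + b) / 2) _) => //.
  by rewrite midf_lt // midf_lt.
apply: rV_norm_le => [|i j]; first by rewrite mulr_ge0 // subr_ge0 ltW.
rewrite [i]ord1 !mxE.
have dj j' t : t \in `]a, b[ -> is_derive t 1 (fun t => u t 0 j') (du t 0 j').
  by rewrite in_itv => /dE; exact: is_derive_coord.
have cuj : {within `[a, b], continuous (fun t => u t 0 j)}.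
  by move=> t; exact: (continuous_comp (cu t) (@coord_continuous R 1 d 0 j (u t))).
have [c cab ->] := MVT ab (dj j) cuj.
rewrite normrM [`|b - a|]gtr0_norm ?subr_gt0 //.
apply: ler_wpM2r; first by rewrite subr_ge0 ltW.
by apply: le_trans (rV_norm_coord _ _ _) _; apply: duC; rewrite in_itv in cab.
Qed.

Lemma mean_value_unit d (u du : R -> 'rV[R]_d) (C : R) :
  (forall t : R, 0 <= t <= 1 -> is_derive t 1 u (du t)) ->
  (forall t : R, 0 <= t <= 1 -> `|du t| <= C) -> `|u 1 - u 0| <= C.
Proof.
move=> dE duC; have := @mean_value_le d u du 0 1 C ler01.
rewrite subr0 mulr1; apply.
- by move=> t /andP[t0 t1]; apply: dE; rewrite !ltW.
- apply: derivable_within_continuous => t; rewrite in_itv => /dE dut.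
  exact: ex_derive.
- by move=> t /andP[t0 t1]; apply: duC; rewrite !ltW.
Qed.

Lemma ball_convex V (p x y : V) (r s : R) : 0 <= s <= 1 ->
  ball p r x -> ball p r y -> ball p r (x + s *: (y - x)).
Proof.
rewrite -!ball_normE /= => /andP[s0 s1] px py.
have -> : p - (x + s *: (y - x)) = (1 - s) *: (p - x) + s *: (p - y).
  rewrite scalerBl scale1r -addrA [- _ + _]addrC -scalerBr.
  have -> : p - y - (p - x) = - (y - x) by rewrite !opprB addrC addrA subrK.
  by rewrite scalerN opprD addrA.
apply: le_lt_trans (ler_normD _ _) _.
rewrite !normrZ (ger0_norm s0) ger0_norm ?subr_ge0 //.
have := ltW px; have := ltW py => py' px'.
have [->|sN1] := eqVneq s 1; first by rewrite subrr mul0r add0r mul1r.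
rewrite [ltRHS](_ : r = (1 - s) * r + s * r); last by rewrite -mulrDl subrK mul1r.
apply: ltr_leD; last exact: ler_wpM2l.
by rewrite ltr_pM2l // subr_gt0 lt_neqAle sN1.
Qed.

Lemma is_derive_line U W (f : U -> W) (x v : U) (s : R) :
  differentiable f (x + s *: v) ->
  is_derive s 1 (fun t : R => f (x + t *: v)) ('d f (x + s *: v) v).
Proof.
move=> df; have [dlx dlE] : differentiable (fun t : R => x + t *: v) s /\
    'd (fun t : R => x + t *: v) s = (fun t : R => t *: v) :> (R -> U).
  apply: diff_epsP.
  - by move=> a t1 t2; rewrite scalerDl scalerA.
  - exact: scalel_continuous.
  move=> e e0; apply: (@nearW _ (nbhs (0 : R))) => h.
  rewrite scalerDl [h *: v + _]addrC addrA [_ + h *: v]addrC addrK subrr.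
  by rewrite normr0 mulr_ge0 // ltW.
have dc : differentiable (f \o (fun t : R => x + t *: v)) s.
  exact: differentiable_comp.
apply: DeriveDef; first exact: diff_derivable.
rewrite deriveE // (diff_comp dlx df) /=; congr ('d f _ _).
by rewrite dlE scale1r.
Qed.

(** Subtracting the linear part at p, the derivative along the segment from q to q' is a difference
    of two differentials, small by continuity; the mean value inequality concludes. *)
Lemma smooth_strict_diff U d (f : U -> 'rV[R]_d) (p : U) (c : R) :
  framed U -> smooth 1 f p -> 0 < c ->
  exists2 r, 0 < r & forall q q', ball p r q -> ball p r q' ->
    `|f q' - f q - 'd f p (q' - q)| <= c * `|q' - q|.
Proof.
move=> [N [e [co [coL coE]]]] [df sf] c0.
have /choice[K KP] : forall i, exists k, 0 < k /\ forall v, `|co i v| <= k * `|v|.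
  move=> i; have [li ci] := coL i.
  pose lM := GRing.isLinear.Build _ _ _ _ _ li.
  pose lL : {linear _ -> _} := HB.pack (co i) lM.
  by have [k k0 H] := @linear_lipschitz R _ _ lL ci; exists k.
(* Two differentials that differ by at most [del] on the frame vectors differ by at most S * [del]
   <= c in norm; the added 1 avoids dividing by zero. *)
pose S := \sum_i K i; have S0 : 0 <= S.
  by apply: sumr_ge0 => i _; apply: ltW; case: (KP i).
pose del := c / (S + 1).
have del0 : 0 < del by rewrite divr_gt0 // ltr_wpDl.
have ndf : \forall q \near p, forall i, `| 'd f q (e i) - 'd f p (e i)| <= del.
  apply: filter_forall => i.
  have /cvgrPdist_le/(_ _ del0) := nbhs_singleton (sf (e i)).
  by apply: filterS => q; rewrite distrC.
have [r /= r0 rP] := (nbhs_ballP _ _).1 (filterI df ndf).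
exists r => // q q' bq bq'; pose v := q' - q.
have bs (s : R) : 0 <= s <= 1 -> ball p r (q + s *: v) by move=> s01; exact: ball_convex.
pose u (s : R) := f (q + s *: v) - s *: 'd f p v.
pose du (s : R) := 'd f (q + s *: v) v - 'd f p v.
have -> : f q' - f q - 'd f p (q' - q) = u 1 - u 0.
  by rewrite /u !scale1r !scale0r addr0 subr0 addrAC /v [q + _]addrC subrK.
apply: (@mean_value_unit d u du) => [s s01|s s01].
  have [dfs _] := rP _ (bs _ s01).
  have H1 := is_derive_line dfs.
  have H2 : is_derive s 1 (fun t : R => t *: 'd f p v) ('d f p v).
    have := is_diff_scalel s ('d f p v) => H.
    apply: DeriveDef; first exact/diff_derivable/ex_diff.
    by rewrite deriveE; [rewrite diff_val scale1r|exact: ex_diff].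
  exact: is_deriveB.
have [_ ndfs] := rP _ (bs _ s01); rewrite /du.
have lin (L : {linear U -> 'rV[R]_d}) w : L w = \sum_i co i w *: L (e i).
  by rewrite {1}(coE w) linear_sum; apply: eq_bigr => i _; rewrite linearZ.
rewrite (lin ('d f (q + s *: v))) (lin ('d f p)) -sumrB.
apply: le_trans (ler_norm_sum _ _ _) _.
apply: (@le_trans _ _ (\sum_i (K i * `|v|) * del)).
  apply: ler_sum => i _; rewrite -scalerBr normrZ.
  by apply: ler_pM => //; case: (KP i).
rewrite -!mulr_suml -/S /del mulrAC; apply: ler_wpM2r => //.
rewrite mulrCA ger_pMr // ler_pdivrMr ?ltr_wpDl // mul1r.
by rewrite lerDl.
Qed.

End MeanValue.

(** * Derivatives and Taylor expansion in e *)

Section OneVariable.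
Context {R : realType}.
Implicit Types U V W P : normedModType R.

Lemma near_eq_derive1n W l (f g : R -> W) (t : R) :
  (\forall e \near t, f e = g e) -> \forall e \near t, derive1n l f e = derive1n l g e.
Proof.
move=> fg; elim: l => [//|l IH].
apply: filterS (near_join IH) => e fge.
by rewrite !derive1nS !derive1E; exact: near_eq_derive.
Qed.

Lemma smooth_derive1 W k (f : R -> W) (t : R) :
  smooth k.+1 f t -> smooth k (derive1 f) t.
Proof.
move=> [df /(_ 1)]; apply: smooth_near; apply: filterS df => e dfe.
by rewrite derive1E'.
Qed.

Lemma smooth_derive1n W k j (f : R -> W) (t : R) :
  smooth (k + j) f t -> smooth k (derive1n j f) t.
Proof.
elim: j k => [|j IH] k; first by rewrite addn0.
by rewrite addnS -addSn => /IH /smooth_derive1.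
Qed.

Lemma smooth_nderivable W k (f : R -> W) (t : R) :
  smooth k f t -> nderivable k f t.
Proof.
move=> sf; have H (j : 'I_k) : \forall y \near t, derivable (derive1n j f) y 1.
  have : smooth (1 + j) f t by exact: smooth_leq sf.
  by move/smooth_derive1n => [df _]; apply: filterS df => y; exact: diff_derivable.
have nH := @filter_forall _ _
  (fun (j : 'I_k) (y : R) => derivable (derive1n j f) y 1) (nbhs t) _ H.
by apply: filterS (nH _) => y Hy j jk; exact: (Hy (Ordinal jk)).
Qed.

Lemma smooth_slice P W k (X : P * R -> W) (q : P) (e : R) :
  framed P -> smooth k X (q, e) -> smooth k (fun e' => X (q, e')) e.
Proof.
move=> fP sX; apply: (@smooth_comp _ _ _ _ k X (fun e' => (q, e'))) => //.
  exact: framed_prod fP framed_R.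
exact: (smooth_pair (smooth_cst k q e) (smooth_id k e)).
Qed.

Lemma is_derive_slice P W (X : P * R -> W) (q : P) (e : R) :
  differentiable X (q, e) ->
  is_derive e 1 (fun e' => X (q, e')) ('d X (q, e) (0, 1)).
Proof.
have E (s : R) : (q, s) = (q, 0) + s *: (0, 1) :> P * R.
  by congr (_, _); [rewrite /= scaler0 addr0|rewrite /= add0r [_ *: _]mulr1].
have -> : (fun e' => X (q, e')) = (fun e' => X ((q, 0) + e' *: (0, 1))).
  by apply/funext => e'; rewrite E.
by rewrite E; exact: is_derive_line.
Qed.

Lemma is_derive_Zl W (a : R -> R) (w : W) (t l : R) :
  is_derive t 1 a l -> is_derive t 1 (fun s => a s *: w) (l *: w).
Proof.
move=> [da dE]; have dfa : differentiable a t by exact/derivable1_diffP.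
have dfw := differentiableZl w dfa.
apply: DeriveDef; first exact: diff_derivable.
by rewrite deriveE // (diffZl w dfa) -dE deriveE.
Qed.

Definition taylor W (c : nat -> W) (k : nat) (e : R) : W :=
  \sum_(l < k) (e ^+ l / l`!%:R) *: c l.

Lemma is_derive_taylor W (c : nat -> W) k (e : R) :
  is_derive e 1 (taylor c k.+1) (taylor (fun l => c l.+1) k e).
Proof.
elim: k => [|k IH].
  have -> : taylor c 1 = cst (c 0%N).
    by apply/funext => s; rewrite /taylor big_ord1 expr0 divr1 scale1r.
  by rewrite /taylor big_ord0; exact: is_derive_cst.
have -> : taylor c k.+2 =
    taylor c k.+1 + (fun s => (s ^+ k.+1 / k.+1`!%:R) *: c k.+1).
  by apply/funext => s; rewrite /taylor big_ord_recr.
rewrite [taylor (fun l => c l.+1) k.+1 e]/taylor big_ord_recr.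
apply: is_deriveD; apply: is_derive_Zl.
have -> : (fun s : R => s ^+ k.+1 / k.+1`!%:R) =
    horner (k.+1`!%:R^-1 *: 'X^(k.+1) : {poly R}).
  by apply/funext => s; rewrite hornerZ hornerXn mulrC.
apply: is_derive_eq (is_derive_poly _ _) _.
rewrite derivZ derivXn hornerZ hornerMn hornerXn /= factS natrM invfM.
by rewrite -[e ^+ k *+ _]mulr_natr [e ^+ k * _]mulrC mulrACA mulVf ?pnatr_eq0 // mul1r mulrC.
Qed.

(** The base point [z.1] moves too, so C is locally uniform in it. The e-derivative of the remainder
    is the remainder of the e-derivative, one order lower; the mean value inequality restores the
    factor |e|. *)
Lemma taylor_remainder P d k (X : P * R -> 'rV[R]_d) (p : P) : framed P ->
  smooth k X (p, 0) ->
  exists2 C, 0 <= C & \forall z \near (p, 0 : R),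
    `|X z - taylor (fun l => derive1n l (fun e => X (z.1, e)) 0) k z.2|
      <= C * `|z.2| ^+ k.
Proof.
move=> fP; elim: k X => [|k IH] X sX.
  have cX := smooth_continuous sX.
  exists (`|X (p, 0)| + 1); first exact: addr_ge0.
  have /cvgrPdist_le/(_ _ ltr01) := cX; apply: filterS => z zX.
  rewrite /taylor big_ord0 subr0 expr0 mulr1 -[X z](subrK (X (p, 0))) addrC.
  by apply: le_trans (ler_normD _ _) _; rewrite lerD2l distrC.
have [dX /(_ (0, 1)) sX'] := sX; have [C C0 HC] := IH _ sX'; exists C => //.
have [r /= r0 rP] := (nbhs_ballP _ _).1 (filterI dX HC).
apply/nbhs_ballP; exists r => // -[q e] [/= bq be].
pose c l := derive1n l (fun e => X (q, e)) 0.
have bs s : 0 <= s <= 1 -> ball (p, 0 : R) r (q, e * s).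
  move=> /andP[s0 s1]; split=> //=; move: be; rewrite -!ball_normE /= !sub0r !normrN.
  apply: le_lt_trans; rewrite normrM (ger0_norm s0).
  by rewrite ler_piMr.
pose h e := X (q, e) - taylor c k.+1 e.
have h0 : h 0 = 0.
  rewrite /h /taylor big_ord_recl big1 /= => [|i _]; last first.
    by rewrite expr0n mul0r scale0r.
  by rewrite expr0 divr1 scale1r addr0 /c derive1n0 subrr.
have -> : X (q, e) - taylor c k.+1 e = h (e * 1) - h (e * 0).
  by rewrite mulr1 mulr0 h0 subr0.
rewrite [C * _](_ : _ = `|e| * (C * `|e| ^+ k)); last by rewrite exprS mulrCA.
have cE : (fun l => c l.+1) =
    (fun l => derive1n l (fun e => 'd X (q, e) (0, 1)) 0).
  apply/funext => l; rewrite /c derive1Sn.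
  apply: (nbhs_singleton (near_eq_derive1n l _)).
  have bqr : ball (0 : R) r `<=` [set e | differentiable X (q, e)].
    by move=> e' be'; have [] := rP (q, e') (conj bq be').
  apply/nbhs_ballP; exists r => // e' /bqr dXe.
  by rewrite derive1E; have [_ ->] := is_derive_slice dXe.
(* Rescaling the segment from 0 to e to [0, 1] treats both signs of e at once. *)
apply: (@mean_value_unit R d (fun s => h (e * s))
  (fun s => e *: ('d X (q, e * s) (0, 1) - taylor (fun l => c l.+1) k (e * s)))).
  move=> s s01; have [dXs _] := rP _ (bs s s01).
  have dh : is_derive (e * s) 1 h
      ('d X (q, e * s) (0, 1) - taylor (fun l => c l.+1) k (e * s)).
    by apply: is_deriveB (is_derive_slice dXs) (is_derive_taylor c k (e * s)).
  have hE : (fun s => h (e * s)) = (fun s => h (0 + s *: e)).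
    by apply/funext => s'; rewrite add0r mulrC.
  have xE : 0 + s *: e = e * s by rewrite add0r mulrC.
  have dfh : differentiable h (e * s) by apply/derivable1_diffP.
  have dfh' : differentiable h (0 + s *: e) by rewrite xE.
  rewrite hE; apply: is_derive_eq (is_derive_line dfh') _.
  by rewrite xE diff1E // derive1E derive_val.
move=> s s01; have [_ /=] := rP _ (bs s s01); rewrite -cE => H.
rewrite normrZ.
apply: ler_wpM2l => //; apply: le_trans H _; apply: ler_wpM2l => //.
case/andP: s01 => s0 s1.
by apply: lerXn2r; rewrite ?nnegrE // normrM (ger0_norm s0) ler_piMr.
Qed.

End OneVariable.

(** * Derivatives in e that are polynomial in time *)

Section PolynomialJets.
Context {R : realType} {T : Type} (tau : T -> R).

(** [tau] is abstract because two kinds of time occur: i - s at the i-th node of an orbit, and real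
    time along the interpolating curve. *)
Definition polyT (k : nat) (f : T -> R) :=
  exists2 p : {poly R}, (size p <= k.+1)%N & forall t, f t = p.[tau t].

Lemma polyT_leq k k' f : (k <= k')%N -> polyT k f -> polyT k' f.
Proof. by move=> kk' [p sp pE]; exists p => //; exact: leq_trans sp _. Qed.

Lemma polyT_cst k (c : R) (f : T -> R) : (forall t, f t = c) -> polyT k f.
Proof.
move=> fc; exists c%:P => [|t]; last by rewrite hornerC.
by rewrite size_polyC; case: (_ != _).
Qed.

Lemma polyTD k f g : polyT k f -> polyT k g -> polyT k (fun t => f t + g t).
Proof.
move=> [p sp pE] [q sq qE]; exists (p + q) => [|t].
  by apply: leq_trans (size_polyD _ _) _; rewrite geq_max sp sq.
by rewrite hornerD pE qE.
Qed.

Lemma polyTM k l f g :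
  polyT k f -> polyT l g -> polyT (k + l) (fun t => f t * g t).
Proof.
move=> [p sp pE] [q sq qE]; exists (p * q) => [|t].
  apply: leq_trans (size_polyMleq _ _) _.
  by have := leq_add sp sq; rewrite addSn addnS; case: (size p + size q)%N.
by rewrite hornerM pE qE.
Qed.

(* [jets l k y]: for every i <= l the i-th derivative of y t at 0 is a
   polynomial in [tau t] of degree at most k + i. *)
Fixpoint jets (l k : nat) (y : T -> R -> R) : Prop :=
  polyT k (fun t => y t 0) /\
  match l with
  | 0 => True
  | l'.+1 => jets l' k.+1 (fun t => derive1 (y t))
  end.

Lemma jets_near l k y z : (forall t, \forall e \near 0, y t e = z t e) ->
  jets l k y -> jets l k z.
Proof.
elim: l k y z => [|l IH] k y z yz [[p sp pE] jy].
  by split=> //; exists p => // t; rewrite -pE (nbhs_singleton (yz t)).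
split; first by exists p => // t; rewrite -pE (nbhs_singleton (yz t)).
apply: IH jy => t; exact: (@near_eq_derive1n _ _ 1 _ _ _ (yz t)).
Qed.

Lemma jets_leq l k k' y : (k <= k')%N -> jets l k y -> jets l k' y.
Proof.
elim: l k k' y => [|l IH] k k' y kk' [py jy].
  by split=> //; exact: polyT_leq py.
by split; [exact: polyT_leq py|exact: IH jy].
Qed.

Lemma jetsS l k y : jets l.+1 k y -> jets l k y.
Proof.
elim: l k y => [|l IH] k y [py jy]; first by split.
by split=> //; exact: IH.
Qed.

Lemma jets_derive1n l k y i : (i <= l)%N -> jets l k y ->
  polyT (k + i) (fun t => derive1n i (y t) 0).
Proof.
elim: i l k y => [|i IH] [|l] k y // il [py jy]; rewrite ?addn0 //.
rewrite addnS -addSn; have [p sp pE] := IH _ _ _ il jy.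
by exists p => // t; rewrite derive1Sn pE.
Qed.

Lemma jets_cst l k (c : R) (y : T -> R -> R) :
  (forall t e, y t e = c) -> jets l k y.
Proof.
elim: l k c y => [|l IH] k c y yc; split=> //; try exact: (polyT_cst k (fun t => yc t 0)).
apply: (IH _ 0 _) => t e; have -> : y t = cst c by apply/funext.
exact: derive1_cst.
Qed.

Lemma jetsD l k y z : (forall t, smooth l (y t) 0) -> (forall t, smooth l (z t) 0) ->
  jets l k y -> jets l k z -> jets l k (fun t e => y t e + z t e).
Proof.
elim: l k y z => [|l IH] k y z sy sz [py jy] [pz jz].
  by split=> //; exact: polyTD.
split; first exact: polyTD.
apply: jets_near (IH _ _ _ _ _ jy jz) => t; try exact: smooth_derive1.
have [dy _] := sy t; have [dz _] := sz t.
apply: filterS2 dy dz => e dye dze.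
rewrite !derive1E [RHS]deriveD //; exact: diff_derivable.
Qed.

Lemma near_derive1M (u v : R -> R) l : smooth l.+1 u 0 -> smooth l.+1 v 0 ->
  \forall e \near 0, derive1 u e * v e + u e * derive1 v e =
    derive1 (fun e => u e * v e) e.
Proof.
move=> [du _] [dv _]; apply: filterS2 du dv => e due dve.
rewrite !derive1E [RHS]deriveM ?[v e *: _]mulrC; first by rewrite addrC [_ * v e]mulrC.
all: exact: diff_derivable.
Qed.

Lemma jetsM l k k' y z : (forall t, smooth l (y t) 0) -> (forall t, smooth l (z t) 0) ->
  jets l k y -> jets l k' z -> jets l (k + k') (fun t e => y t e * z t e).
Proof.
elim: l k k' y z => [|l IH] k k' y z sy sz [py jy] [pz jz].
  by split=> //; exact: polyTM.
split; first exact: polyTM.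
have sy' t : smooth l (derive1 (y t)) 0 by exact: smooth_derive1.
have sz' t : smooth l (derive1 (z t)) 0 by exact: smooth_derive1.
have syl t : smooth l (y t) 0 := smoothS (sy t).
have szl t : smooth l (z t) 0 := smoothS (sz t).
have j1 := IH _ _ _ _ sy' szl jy (jetsS (conj pz jz)).
have j2 := IH _ _ _ _ syl sz' (jetsS (conj py jy)) jz.
rewrite addnS in j2; rewrite addSn in j1.
apply: jets_near (jetsD _ _ j1 j2) => t; try exact: smoothM.
exact: near_derive1M.
Qed.

Lemma jets_sum l k (I : Type) (r : seq I) (y : I -> T -> R -> R) :
  (forall i t, smooth l (y i t) 0) -> (forall i, jets l k (y i)) ->
  jets l k (fun t e => \sum_(i <- r) y i t e).
Proof.
move=> sy jy; elim: r => [|i r IH].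
  by apply: (@jets_cst _ _ 0) => t e; rewrite big_nil.
apply: jets_near (jetsD _ _ (jy i) IH) => t.
- by apply: (@nearW _ (nbhs (0 : R))) => e; rewrite big_cons.
- exact: sy.
- by apply: smooth_sum => j _; exact: sy.
Qed.

(** In the Leibniz formula at least one derivative falls on v, which vanishes at e = 0. As the j-th
    derivative of v has degree at most j - 1, this compensates for the extra degree of u; and the
    derivative of u of order l + 1 meets the factor v = 0, so l orders of u suffice. *)
Lemma jets_mul_vanish l k u v : (forall t, smooth l.+1 (u t) 0) ->
  (forall t, smooth l.+1 (v t) 0) -> jets l k.+1 u -> (forall t, v t 0 = 0) ->
  jets l 0 (fun t => derive1 (v t)) -> jets l.+1 k (fun t e => u t e * v t e).
Proof.
elim: l k u => [|l IH] k u su sv ju v0 jv; (split;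
  first by apply: (@polyT_cst _ 0) => t; rewrite v0 mulr0).
  apply: jets_near (fun t => near_derive1M (su t) (sv t)) _.
  apply: jetsD.
  - by move=> t; apply: smoothM (smooth_derive1 (su t)) (smoothS (sv t)).
  - by move=> t; apply: smoothM (smoothS (su t)) (smooth_derive1 (sv t)).
  - by split=> //; apply: (@polyT_cst _ 0) => t; rewrite v0 mulr0.
  - rewrite -[k.+1]addn0; apply: jetsM jv => // t; first exact: smoothS.
    exact: smooth_derive1.
apply: jets_near (fun t => near_derive1M (su t) (sv t)) _.
apply: jetsD.
- by move=> t; apply: smoothM (smooth_derive1 (su t)) (smoothS (sv t)).
- by move=> t; apply: smoothM (smoothS (su t)) (smooth_derive1 (sv t)).
- case: ju => _ ju; apply: IH => //.
  + by move=> t; exact: smooth_derive1.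
  + by move=> t; exact: smoothS.
  + exact: jetsS.
- rewrite -[k.+1]addn0; apply: jetsM jv => // t; first exact: smoothS.
  exact: smooth_derive1.
Qed.

End PolynomialJets.

(** On the line t |-> (z + t v, 0) the map is identically zero near t = 0, and so is its derivative
    there. *)
Lemma diff_vanish (R : realType) (P W : normedModType R) (phi : P * R -> W) k (x : P) :
  (\forall z \near x, phi (z, 0) = 0) -> smooth k.+1 phi (x, 0) ->
  forall v, \forall z \near x, 'd phi (z, 0) (v, 0) = 0.
Proof.
move=> phi0 [dphi _] v.
have cx : {for x, continuous (fun z : P => (z, 0 : R))}.
  exact: smooth_continuous (smooth_pair (smooth_id 0 x) (smooth_cst 0 _ x)).
apply: filterS2 (near_join phi0) (cx _ dphi) => z phiz dphiz.
have zE t : (z, 0) + t *: (v, 0) = (z + t *: v, 0) :> P * R.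
  by congr (_, _); rewrite /= scaler0 addr0.
have dphiz' : differentiable phi ((z, 0) + 0 *: (v, 0)).
  by rewrite zE scale0r addr0.
have dl := is_derive_line dphiz'.
have cl : {for (0 : R), continuous (fun t : R => z + t *: v)}.
  exact: smooth_continuous (smoothD (smooth_cst 0 z (0 : R))
    (smoothZ (smooth_id 0 (0 : R)) (smooth_cst 0 v 0))).
have l0 : \forall t \near (0 : R), phi ((z, 0) + t *: (v, 0)) = 0.
  have phiz0 : nbhs (z + 0 *: v) [set z' | phi (z', 0) = 0] by rewrite scale0r addr0.
  have := cl _ phiz0; rewrite nbhs_simpl /= => H.
  by apply: (@filterS _ (nbhs (0 : R)) _ _ _ _ H) => t /=; rewrite zE.
have := near_eq_derive (1 : R) l0.
rewrite derive_val zE scale0r addr0 => ->.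
exact: derive_cst.
Qed.

(** * Polynomial jets under composition with smooth maps *)

Section JetsComposition.
Context {R : realType} {T : Type} (tau : T -> R) {d : nat}.
Implicit Types (Y : R -> 'rV[R]_d) (psi phi : 'rV[R]_d * R -> R).

Lemma derive1_comp_pair Y psi (e : R) :
  differentiable Y e -> differentiable psi (Y e, e) ->
  derive1 (fun e => psi (Y e, e)) e =
    \sum_a derive1 (fun e => Y e 0 a) e * 'd psi (Y e, e) ('e_a, 0)
    + 'd psi (Y e, e) (0, 1).
Proof.
move=> dY dpsi; have did : differentiable (fun e : R => e) e by [].
have dp := differentiable_pair dY did.
have dc : differentiable (psi \o (fun e => (Y e, e))) e.
  exact: differentiable_comp.
rewrite -[fun e => psi _]/(psi \o (fun e => (Y e, e))) derive1E' //.
rewrite (diff_comp dp dpsi) /= (diff_pair dY did) diff_val.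
have -> : ('d Y e 1, 1) = ('d Y e 1, 0) + (0, 1) :> 'rV[R]_d * R.
  by congr (_, _); rewrite ?addr0 ?add0r.
rewrite linearD; congr (_ + _).
have -> : ('d Y e 1, 0) =
    \sum_a derive1 (fun e => Y e 0 a) e *: (('e_a, 0) : 'rV[R]_d * R).
  have -> : 'd Y e 1 = \sum_a derive1 (fun e => Y e 0 a) e *: 'e_a.
    rewrite {1}[X in X = _]row_sum_delta; apply: eq_bigr => a _; congr (_ *: _).
    by rewrite -deriveE // (derive_mx (diff_derivable dY)) mxE derive1E.
  elim/big_ind2 : _ => //.
    by move=> ? x ? y <- <-; congr (_, _); rewrite addr0.
  by move=> i _; congr (_, _); rewrite scaler0.
by rewrite linear_sum; apply: eq_bigr => a _; rewrite linearZ.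
Qed.

Lemma smooth_comp_pair (W : normedModType R) k Y (psi : 'rV[R]_d * R -> W) (e : R) :
  smooth k Y e -> smooth k psi (Y e, e) -> smooth k (fun e => psi (Y e, e)) e.
Proof.
move=> sY spsi; apply: (@smooth_comp _ _ _ _ k psi (fun e => (Y e, e))) => //.
  exact: framed_prod (framed_rV d) framed_R.
exact: smooth_pair sY (smooth_id k e).
Qed.

Lemma near_derive1_comp_pair k Y psi (e : R) :
  smooth k.+1 Y e -> smooth k.+1 psi (Y e, e) ->
  \forall e' \near e, derive1 (fun e => psi (Y e, e)) e' =
    \sum_a derive1 (fun e => Y e 0 a) e' * 'd psi (Y e', e') ('e_a, 0)
    + 'd psi (Y e', e') (0, 1).
Proof.
move=> sY spsi; have [dY _] := sY; have [dpsi _] := spsi.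
have cY : {for e, continuous (fun e => (Y e, e))}.
  exact: smooth_continuous (smooth_pair sY (smooth_id k.+1 e)).
apply: filterS2 dY (cY _ dpsi) => e' dYe dpsie.
exact: derive1_comp_pair.
Qed.

Variables (x : 'rV[R]_d).

(** Induction on l for all [psi] at once: the chain rule yields partial derivatives of [psi],
    composed with Y again, times derivatives of Y. This takes the place of an explicit formula for
    higher derivatives of a composite. *)
Lemma jets_comp l (Y : T -> R -> 'rV[R]_d) psi :
  (forall t, smooth l (Y t) 0) -> (forall t, Y t 0 = x) -> smooth l psi (x, 0) ->
  (forall a, jets tau l 0 (fun t e => Y t e 0 a)) ->
  jets tau l 0 (fun t e => psi (Y t e, e)).
Proof.
elim: l psi => [|l IH] psi sY Y0 spsi jY; (split;
  first by apply: (@polyT_cst _ _ _ _ (psi (x, 0))) => t; rewrite Y0) => //.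
have spsiY t : smooth l.+1 psi (Y t 0, 0) by rewrite Y0.
have H t := near_derive1_comp_pair (sY t) (spsiY t).
apply: (jets_near (fun t => filterS (fun e => @esym _ _ _) (H t))).
have sYl t : smooth l (Y t) 0 := smoothS (sY t).
have jYl a := jetsS (jY a).
have [_ spsi'] := spsi.
have scomp v t : smooth l (fun e => 'd psi (Y t e, e) v) 0.
  by apply: (@smooth_comp_pair _ l (Y t) (fun z => 'd psi z v)) => //;
    rewrite Y0; exact: spsi'.
have jcomp v := IH (fun z => 'd psi z v) sYl Y0 (spsi' v) jYl.
have sdY a t : smooth l (derive1 (fun e => Y t e 0 a)) 0.
  by apply: smooth_derive1; exact: smooth_coord.
apply: jetsD.
- by move=> t; apply: smooth_sum => a _; exact: smoothM.
- by move=> t; exact: scomp.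
- apply: jets_sum => [a t|a]; first exact: smoothM.
  apply: (@jetsM R T tau l 1 0) => //.
  by case: (jY a).
- exact: jets_leq (jcomp _).
Qed.

(* The first derivative of [phi (Y t e, e)] at order l only involves the
   derivatives of [Y t] of order < l, since [phi] vanishes for e = 0. *)
Lemma jets_comp_vanish l (Y : T -> R -> 'rV[R]_d) phi :
  (forall t, smooth l.+1 (Y t) 0) -> (forall t, Y t 0 = x) ->
  smooth l.+1 phi (x, 0) -> (\forall z \near x, phi (z, 0) = 0) ->
  (forall a, jets tau l 0 (fun t e => Y t e 0 a)) ->
  jets tau l 0 (fun t => derive1 (fun e => phi (Y t e, e))).
Proof.
elim: l phi => [|l IH] phi sY Y0 sphi phi0 jY.
  have sphiY t : smooth 1 phi (Y t 0, 0) by rewrite Y0.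
  have H t := near_derive1_comp_pair (sY t) (sphiY t).
  split=> //; apply: (@polyT_cst _ _ _ _ ('d phi (x, 0) (0, 1))) => t.
  rewrite (nbhs_singleton (H t)) Y0 big1 ?add0r // => a _.
  by rewrite (nbhs_singleton (diff_vanish phi0 sphi 'e_a)) mulr0.
have sphiY t : smooth l.+2 phi (Y t 0, 0) by rewrite Y0.
have H t := near_derive1_comp_pair (sY t) (sphiY t).
apply: (jets_near (fun t => filterS (fun e => @esym _ _ _) (H t))).
have sYl t : smooth l.+1 (Y t) 0 := smoothS (sY t).
have [_ sphi'] := sphi.
have scomp v t : smooth l.+1 (fun e => 'd phi (Y t e, e) v) 0.
  by apply: (@smooth_comp_pair _ l.+1 (Y t) (fun z => 'd phi z v)) => //;
    rewrite Y0; exact: sphi'.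
have sdY a t : smooth l.+1 (derive1 (fun e => Y t e 0 a)) 0.
  by apply: smooth_derive1; exact: smooth_coord.
apply: jetsD.
- by move=> t; apply: smooth_sum => a _; exact: smoothM.
- by move=> t; exact: scomp.
- apply: jets_sum => [a t|a]; first exact: smoothM.
  apply: jets_mul_vanish => //.
  + by case: (jY a).
  + by move=> t; rewrite Y0 (nbhs_singleton (diff_vanish phi0 sphi 'e_a)).
  + apply: (IH (fun z => 'd phi z ('e_a, 0))) => //.
      exact: diff_vanish phi0 sphi _.
    by move=> b; exact: jetsS.
- exact: (jets_comp (psi := fun z => 'd phi z (0, 1))).
Qed.

End JetsComposition.

(** * Discrete primitives and jets of orbits *)

Section DiscreteIntegration.
Context {R : realType} (s : R).
Let tau (i : nat) : R := i%:R - s.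

Lemma poly_antidifference m (p : {poly R}) : (size p <= m)%N ->
  exists2 q : {poly R}, (size q <= m.+1)%N &
    forall t, q.[t + 1] - q.[t] = p.[t].
Proof.
elim: m p => [|m IH] p sp.
  exists 0 => [|t]; first by rewrite size_poly0.
  by move: sp; rewrite leqn0 size_poly_eq0 => /eqP ->; rewrite !horner0 subrr.
(* The difference of c t^(m+1) has leading coefficient c (m + 1), so this c cancels the top
   coefficient of p and lowers the degree. *)
pose c := p`_m / m.+1%:R.
pose dq : {poly R} := \sum_(i < m.+1) (c *+ 'C(m.+1, i)) *: 'X^i.
have dqE t : c * (t + 1) ^+ m.+1 - c * t ^+ m.+1 = dq.[t].
  rewrite exprD1n big_ord_recr /= binn mulrDr addrK mulr_sumr horner_sum.
  by apply: eq_bigr => i _; rewrite hornerZ hornerXn mulrnAr mulrnAl.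
have [|q sq qE] := IH (p - dq).
  apply/leq_sizeP => j mj; rewrite coefB /dq coef_sum.
  have [jm|jm] := eqVneq j m.
    rewrite jm (bigD1 ord_max) //= big1 => [|i im]; last first.
      rewrite coefZ coefXn; case: eqP => [mi|_]; last by rewrite mulr0.
      by case/eqP: im; apply/val_inj.
    rewrite addr0 coefZ coefXn eqxx mulr1 binSn -[c *+ _]mulr_natr /c divfK ?subrr //.
  have mj' : (m < j)%N by rewrite ltn_neqAle eq_sym jm.
  rewrite big1 => [|i _]; last first.
    rewrite coefZ coefXn; case: eqP => [ji|_]; last by rewrite mulr0.
    by move: (ltn_ord i); rewrite -ji ltnS leqNgt mj'.
  by rewrite subr0 nth_default // (leq_trans sp).
exists (c *: 'X^(m.+1) + q) => [|t].
  apply: leq_trans (size_polyD _ _) _; rewrite geq_max.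
  apply/andP; split; last exact: leq_trans sq _.
  by apply: leq_trans (size_scale_leq _ _) _; rewrite size_polyXn.
rewrite !hornerD !hornerZ !hornerXn opprD addrACA dqE qE hornerD hornerN.
by rewrite addrC subrK.
Qed.

Lemma polyT_sum k (f : nat -> R) :
  polyT tau k (fun i => f i.+1 - f i) -> polyT tau k.+1 f.
Proof.
move=> [p sp pE]; have [q sq qE] := poly_antidifference sp.
exists (q + (f 0%N - q.[tau 0])%:P) => [|i].
  apply: leq_trans (size_polyD _ _) _; rewrite geq_max sq /=.
  by rewrite (leq_trans (size_polyC_leq1 _)).
rewrite hornerD hornerC; elim: i => [|i IH]; first by rewrite addrC subrK.
rewrite -[f i.+1](subrK (f i)) pE IH -qE /tau -natr1 [_ + 1 - s]addrAC.
by rewrite addrA subrK.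
Qed.

Lemma jets_telescope l k (w : nat -> R -> R) : (forall i, smooth l (w i) 0) ->
  jets tau l k (fun i e => w i.+1 e - w i e) -> jets tau l k.+1 w.
Proof.
elim: l k w => [|l IH] k w sw [pw jw]; first by split=> //; exact: polyT_sum.
split; first exact: polyT_sum.
apply: IH => [i|]; first exact: smooth_derive1.
apply: jets_near jw => i; have [dw _] := sw i; have [dw' _] := sw i.+1.
apply: filterS2 dw dw' => e dwe dwe'.
rewrite !derive1E deriveB //; exact: diff_derivable.
Qed.

Lemma jets_orbit d N (Fu : 'rV[R]_d * R -> 'rV[R]_d) (x : 'rV[R]_d)
    (y : nat -> R -> 'rV[R]_d) :
  smooth N Fu (x, 0) -> (\forall z \near x, Fu (z, 0) = z) ->
  (forall i, smooth N (y i) 0) -> (forall i, y i 0 = x) ->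
  (forall i, \forall e \near 0, y i.+1 e = Fu (y i e, e)) ->
  forall l, (l <= N)%N -> forall a, jets tau l 0 (fun i e => y i e 0 a).
Proof.
move=> sF F0 sy y0 yS; elim=> [|l IH] lN a.
  by split=> //; apply: (@polyT_cst _ _ _ _ (x 0 a)) => i; rewrite y0.
have syl i : smooth l.+1 (y i) 0 by exact: smooth_leq (sy i).
have sphi : smooth l.+1 (fun z => Fu z 0 a - z.1 0 a) (x, 0).
  apply: smoothB; apply: smooth_coord; last exact: smooth_fst.
  exact: smooth_leq sF.
have phi0 : \forall z \near x, Fu (z, 0) 0 a - (z, 0 : R).1 0 a = 0.
  by apply: filterS F0 => z ->; rewrite subrr.
have jd := jets_comp_vanish syl y0 sphi phi0 (IH (ltnW lN)).
split; first by apply: (@polyT_cst _ _ _ _ (x 0 a)) => i; rewrite y0.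
(* The derivative of the increment has jets of weight 0; summation over i raises the weight to 1,
   exactly what [jets] allows for a first derivative. *)
apply: jets_telescope => [i|].
  by apply: smooth_derive1; exact: smooth_coord.
apply: jets_near jd => i /=.
have [dy _] := smooth_coord 0 a (syl i).
have [dy' _] := smooth_coord 0 a (syl i.+1).
apply: filterS3 (near_join (yS i)) dy dy' => e yE dye dye'.
have E : \forall e' \near e, Fu (y i e', e') 0 a - y i e' 0 a =
    y i.+1 e' 0 a - y i e' 0 a.
  by apply: filterS yE => e' ->.
rewrite !derive1E (near_eq_derive (1 : R) E) deriveB //; exact: diff_derivable.
Qed.

End DiscreteIntegration.

(** * Lagrange interpolation *)

Section Lagrange.
Context {R : realType}.
Implicit Types (p : {poly R}).

Lemma node_natE s i : (node s i)%:~R = i%:R - s%:R :> R.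
Proof. by rewrite /node intrB. Qed.

Lemma lagrange_basis_node m s (i j : 'I_m.+1) :
  (lagrange_basis R s i).[j%:R - s%:R] = (j == i)%:R.
Proof.
rewrite /lagrange_basis horner_prod; have [->|ji] := eqVneq j i.
  apply: big1 => k ki; rewrite hornerZ hornerXsubC -!node_natE.
  rewrite mulVf // subr_eq0 !node_natE (inj_eq (addIr _)) eqr_nat.
  by rewrite eq_sym.
rewrite (bigD1 j) //= hornerZ hornerXsubC !node_natE.
by rewrite subrr mulr0 mul0r.
Qed.

Lemma size_lagrange_basis m s (i : 'I_m.+1) :
  (size (lagrange_basis R s i) <= m.+1)%N.
Proof.
rewrite /lagrange_basis.
have H (r : seq 'I_m.+1) (P : pred 'I_m.+1) (c : 'I_m.+1 -> R) (a : 'I_m.+1 -> R) :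
    (size (\prod_(j <- r | P j) (c j *: ('X - (a j)%:P)))%R <= (count P r).+1)%N.
  elim: r => [|j r IH]; first by rewrite big_nil size_poly1.
  rewrite big_cons /=; case: (P j) => //=.
  apply: leq_trans (size_polyMleq _ _) _.
  have sX : (size (c j *: ('X - (a j)%:P)) <= 2)%N.
    by apply: leq_trans (size_scale_leq _ _) _; rewrite size_XsubC.
  by have := leq_add sX IH; rewrite add1n addnS; case: (_ + _)%N.
apply: leq_trans (H _ _ _ _) _; rewrite ltnS.
rewrite -sum1_count.
have -> : (\sum_(j <- index_enum 'I_m.+1 | j != i) 1)%N = #|predC1 i|.
  by rewrite -sum1_card; apply: eq_bigl.
by rewrite cardC1 card_ord.
Qed.

Lemma poly_eq0_nat p m s : (size p <= m)%N ->
  (forall j, (j < m)%N -> p.[j%:R - s] = 0) -> p = 0.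
Proof.
move=> sp p0; apply: (@roots_geq_poly_eq0 _ p [seq i%:R - s | i <- iota 0 m]).
- apply/allP => t /mapP[i]; rewrite mem_iota add0n => im ->.
  by apply/rootP; exact: p0.
- have inj : injective (fun i : nat => i%:R - s : R).
    by move=> i j /addIr/eqP; rewrite eqr_nat => /eqP.
  by rewrite (map_inj_uniq inj) iota_uniq.
- by rewrite size_map size_iota.
Qed.

Lemma lagrange_exact m s p : (size p <= m.+1)%N ->
  p = \sum_(i < m.+1) p.[i%:R - s%:R] *: lagrange_basis R s i.
Proof.
move=> sp; apply/eqP; rewrite -subr_eq0; apply/eqP.
apply: (@poly_eq0_nat _ m.+1 s%:R).
  apply: leq_trans (size_polyD _ _) _; rewrite geq_max sp size_polyN.
  elim/big_ind : _ => //; first by rewrite size_poly0.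
    by move=> a b sa sb; apply: leq_trans (size_polyD _ _) _; rewrite geq_max; apply/andP; split.
  move=> i _; apply: leq_trans (size_scale_leq _ _) _.
  exact: size_lagrange_basis.
move=> j jm; rewrite hornerD hornerN horner_sum (bigD1 (Ordinal jm)) //=.
rewrite hornerZ (lagrange_basis_node s (Ordinal jm) (Ordinal jm)) eqxx mulr1.
rewrite big1 ?addr0 ?subrr // => i ij.
by rewrite hornerZ (lagrange_basis_node s i (Ordinal jm)) eq_sym (negbTE ij) mulr0.
Qed.

Lemma lagrange_horner m s p t : (size p <= m.+1)%N ->
  \sum_(i < m.+1) (lagrange_basis R s i).[t] * p.[i%:R - s%:R] = p.[t].
Proof.
move=> sp; rewrite [in RHS](lagrange_exact s sp) horner_sum.
by apply: eq_bigr => i _; rewrite hornerZ mulrC.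
Qed.

Lemma lagrange_deriv m s p t : (size p <= m.+1)%N ->
  \sum_(i < m.+1) (lagrange_basis R s i)^`().[t] * p.[i%:R - s%:R] = p^`().[t].
Proof.
move=> sp; rewrite [in RHS](lagrange_exact s sp) raddf_sum horner_sum.
by apply: eq_bigr => i _; rewrite /= derivZ hornerZ mulrC.
Qed.

Lemma near_derive1n_coord d l (f : R -> 'rV[R]_d) (t : R) a : smooth l f t ->
  \forall e \near t, derive1n l f e 0 a = derive1n l (fun e => f e 0 a) e.
Proof.
elim: l f => [|l IH] f sf; first by apply: (@nearW _ (nbhs t)).
have [df _] := sf.
have E : \forall e \near t, derive1 f e 0 a = derive1 (fun e => f e 0 a) e.
  apply: filterS df => e dfe.
  by rewrite !derive1E (derive_mx (diff_derivable dfe)) mxE.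
apply: filterS2 (IH _ (smooth_derive1 sf)) (near_eq_derive1n l E) => e.
by rewrite !derive1Sn => -> ->.
Qed.

Lemma near_derive1n_lincomb l m (c : 'I_m -> R) (f : 'I_m -> R -> R) (t : R) :
  (forall i, smooth l (f i) t) ->
  \forall e \near t, derive1n l (fun e => \sum_i c i * f i e) e =
    \sum_i c i * derive1n l (f i) e.
Proof.
elim: l f => [|l IH] f sf; first by apply: (@nearW _ (nbhs t)).
have dfi := @filter_forall _ _ (fun i (e : R) => differentiable (f i) e)
  (nbhs t) _ (fun i => (sf i).1).
have E : \forall e \near t, derive1 (fun e => \sum_i c i * f i e) e =
    \sum_i c i * derive1 (f i) e.
  apply: filterS (dfi _) => e dfe.
  have -> : (fun e => \sum_i c i * f i e) = \sum_i (fun e => c i *: f i e).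
    by apply/funext => e'; rewrite fct_sumE.
  rewrite derive1E derive_sum => [|i]; last first.
    by apply: derivableZ; exact: diff_derivable.
  apply: eq_bigr => i _; rewrite derive1E deriveZ //; exact: diff_derivable.
apply: filterS2 (near_eq_derive1n l E) (IH _ (fun i => smooth_derive1 (sf i))).
move=> e; rewrite derive1Sn => -> ->.
by apply: eq_bigr => i _; rewrite derive1Sn.
Qed.

End Lagrange.

(** * Local inverses *)

Section GeometricLimit.
Context {R : realType}.

Lemma geometric_dist (V : normedModType R) (z : nat -> V) M :
  (forall k, `|z k.+1 - z k| <= M / 2 ^+ k) ->
  forall k j, `|z (k + j)%N - z k| <= 2 * M / 2 ^+ k.
Proof.
move=> zM k j; have M0 : 0 <= M.
  by have := zM 0%N; rewrite expr0 divr1; apply: le_trans.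
suff : `|z (k + j)%N - z k| <= 2 * M / 2 ^+ k - 2 * M / 2 ^+ (k + j).
  move/le_trans; apply; rewrite gerBl divr_ge0 ?mulr_ge0 // exprn_ge0 //.
elim: j => [|j IH]; first by rewrite addn0 !subrr normr0.
rewrite addnS -(subrK (z (k + j)%N) (z _)) -addrA.
apply: le_trans (ler_normD _ _) _.
apply: le_trans (lerD (zM _) IH) _.
rewrite exprS invfM; set b := (2 ^+ (k + j))^-1; set A := _ / 2 ^+ k.
by lra.
Qed.

Lemma geometric_limit d (z : nat -> 'rV[R]_d) M :
  (forall k, `|z k.+1 - z k| <= M / 2 ^+ k) ->
  exists l, forall k, `|l - z k| <= 2 * M / 2 ^+ k.
Proof.
move=> zM; have M0 : 0 <= M.
  by have := zM 0%N; rewrite expr0 divr1; apply: le_trans.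
have zd := geometric_dist zM.
have small e : 0 < e -> \forall k \near \oo, 2 * M / 2 ^+ k < e.
  move=> e0; have := @cvg_geometric R (2 * M) 2^-1.
  rewrite ger0_norm // invf_lt1 // ltr1n => /(_ isT).
  move=> /cvgrPdist_lt/(_ _ e0); apply: filterS => k.
  rewrite sub0r normrN ger0_norm /geometric /= exprVn //.
  by rewrite divr_ge0 ?mulr_ge0 // exprn_ge0.
have zc : cvgn z.
  apply/cauchy_cvgP/cauchy_ballP => e e0; near_simpl.
  have e20 : 0 < e / 2 by rewrite divr_gt0.
  have [N _ HN] := small _ e20.
  exists ([set k | (N <= k)%N], [set k | (N <= k)%N]) => /=.
    by split; exists N.
  move=> [a b] [/= Na Nb]; rewrite -ball_normE /=.
  have za := zd N (a - N)%N; have zb := zd N (b - N)%N.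
  rewrite !subnKC // in za zb.
  rewrite -(subrK (z N) (z a)) -addrA [e]splitr.
  apply: le_lt_trans (ler_normD _ _) _.
  have := HN N (leqnn N) => /= h.
  by apply: ltrD; [exact: le_lt_trans za h|rewrite distrC; exact: le_lt_trans zb h].
exists (limn z) => k; apply/ler_addgt0Pr => e e0.
have [N _ HN] := (cvgrPdist_lt _ _).1 zc e e0.
have := HN (k + N)%N (leq_addl _ _) => /= h.
have -> : limn z - z k = (limn z - z (k + N)%N) + (z (k + N)%N - z k).
  by rewrite addrA subrK.
rewrite [leRHS]addrC; apply: le_trans (ler_normD _ _) _.
by apply: lerD; [exact: ltW|exact: zd].
Qed.

End GeometricLimit.

(** * Small Lipschitz constants near e = 0 *)

Section PerturbationOfZero.
Context {R : realType} {d d' : nat}.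
Implicit Types (phi : 'rV[R]_d * R -> 'rV[R]_d').

(** The differential at (x, 0) vanishes on (v, 0) because [phi] is zero for e = 0. By strict
    differentiability only the error c is left in the x-direction, while the e-direction costs C = c
    + the norm of the e-derivative. *)
Lemma perturbation_lipschitz phi (x : 'rV[R]_d) c :
  smooth 1 phi (x, 0) -> (\forall z \near x, phi (z, 0) = 0) -> 0 < c ->
  exists r C, [/\ 0 < r, 0 <= C,
    forall q q', ball (x, 0 : R) r q -> ball (x, 0 : R) r q' ->
      `|phi q' - phi q| <= c * `|q'.1 - q.1| + C * `|q'.2 - q.2| &
    forall q, ball (x, 0 : R) r q -> `|phi q| <= C * `|q.2| ].
Proof.
move=> sphi phi0 c0.
have fr := framed_prod (framed_rV (R := R) d) framed_R.
have [r r0 rP] := smooth_strict_diff fr sphi c0.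
have [r' /= r'0 rP'] := (nbhs_ballP _ _).1 phi0.
have L v t : 'd phi (x, 0) (v, t) = t *: 'd phi (x, 0) (0, 1).
  have -> : (v, t) = (v, 0) + t *: (0, 1) :> 'rV[R]_d * R.
    by congr (_, _) => /=; rewrite ?scaler0 ?addr0 ?add0r // [_ *: _]mulr1.
  rewrite linearD linearZ (nbhs_singleton (diff_vanish phi0 sphi v)).
  by rewrite add0r.
pose C := c + `| 'd phi (x, 0) (0, 1)|.
have C0 : 0 <= C by rewrite addr_ge0 // ltW.
have Lip q q' : ball (x, 0 : R) (Num.min r r') q ->
    ball (x, 0 : R) (Num.min r r') q' ->
    `|phi q' - phi q| <= c * `|q'.1 - q.1| + C * `|q'.2 - q.2|.
  move=> bq bq'; have br p : ball (x, 0 : R) (Num.min r r') p ->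
      ball (x, 0 : R) r p by apply: le_ball; rewrite ge_min lexx.
  have H := rP _ _ (br _ bq) (br _ bq').
  rewrite -(subrK ('d phi (x, 0) (q' - q)) (phi q' - phi q)).
  apply: le_trans (ler_normD _ _) _.
  have -> : q' - q = (q'.1 - q.1, q'.2 - q.2) by [].
  rewrite [X in _ + `|X|]L normrZ.
  have mx : `|(q'.1 - q.1, q'.2 - q.2)| <= `|q'.1 - q.1| + `|q'.2 - q.2|.
    by rewrite prod_normE /= ge_max lerDl lerDr !normr_ge0.
  apply: le_trans (lerD (le_trans H _) (lexx _)) _.
    by apply: ler_wpM2l mx; exact: ltW.
  by rewrite /C mulrDr mulrDl -addrA [`| 'd _ _ _| * _]mulrC.
exists (Num.min r r'), C; split=> // [|q bq].
  by rewrite lt_min r0 r'0.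
have [bq1 bq2] := bq; have := Lip (q.1, 0) q.
rewrite /= subrr normr0 mulr0 add0r subr0 rP' ?subr0.
  apply=> //; split=> //=; apply: ballxx.
  by rewrite lt_min r0 r'0.
by move: bq1 => /=; apply: le_ball; rewrite ge_min lexx orbT.
Qed.

End PerturbationOfZero.

Section LocalInverse.
Context {R : realType} {d : nat}.

Lemma le_halving (a M : R) : (forall k : nat, a <= M / 2 ^+ k) -> a <= 0.
Proof.
move=> aM; apply/ler_addgt0Pr => e e0; rewrite add0r.
have := @cvg_geometric R M 2^-1.
rewrite ger0_norm // invf_lt1 // ltr1n => /(_ isT).
move=> /cvgrPdist_lt/(_ _ e0)[N _ /(_ N (leqnn N))] /=.
rewrite sub0r normrN /geometric /= exprVn => h; apply: ltW.
by apply: le_lt_trans h; apply: le_trans (ler_norm _).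
Qed.

Variables (Fu : 'rV[R]_d * R -> 'rV[R]_d) (x0 : 'rV[R]_d).
Hypothesis F0 : \forall z \near x0, Fu (z, 0) = z.

Lemma defect_lipschitz : smooth 1 Fu (x0, 0) ->
  exists r C, [/\ 0 < r, 0 <= C,
    forall q q', ball (x0, 0 : R) r q -> ball (x0, 0 : R) r q' ->
      `|(Fu q' - q'.1) - (Fu q - q.1)| <= 2^-1 * `|q'.1 - q.1| + C * `|q'.2 - q.2| &
    forall q, ball (x0, 0 : R) r q -> `|Fu q - q.1| <= C * `|q.2| ].
Proof.
move=> sF; pose phi q := Fu q - q.1.
have sphi : smooth 1 phi (x0, 0) by exact: smoothB sF (smooth_fst 1 _).
have phi0 : \forall z \near x0, phi (z, 0) = 0.
  by apply: filterS F0 => z; rewrite /phi => ->; rewrite subrr.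
have c0 : (0 : R) < 2^-1 by rewrite invr_gt0.
have [r [C [r0 C0 H1 H2]]] := perturbation_lipschitz sphi phi0 c0.
by exists r, C; split.
Qed.

(** The solution is the fixed point of y |-> x - (F_e(y) - y), a contraction with constant 1/2. The
    bound C |e| on the first step gives the distance 2 C |e| to the limit. *)
Lemma local_inverse_exists_near : smooth 1 Fu (x0, 0) ->
  exists2 C, 0 <= C & \forall p \near (x0, 0 : R),
    exists2 y, Fu (y, p.2) = p.1 & `|y - p.1| <= C * `|p.2|.
Proof.
move=> sF; have [r [C [r0 C0 Lip Bd]]] := defect_lipschitz sF.
exists (2 * C); first by rewrite mulr_ge0.
(* Points within 2 C |e| of x must lie in the ball of radius r: r / 2 is left for x itself and r / 2
   for the displacement. *)
pose s := r / (2 * (2 * C + 1)).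
have s0 : 0 < s by rewrite divr_gt0 // mulr_gt0 // ltr_wpDl // mulr_ge0.
have sr : (2 * C + 1) * s = r / 2.
  by rewrite /s; field; rewrite gt_eqF // ltr_wpDl // mulr_ge0.
apply/nbhs_ballP; exists s => // -[x e] []; rewrite -!ball_normE /= => bx.
rewrite sub0r normrN => be.
have Ce : (2 * C + 1) * `|e| < r / 2.
  by rewrite -sr ltr_pM2l // ltr_wpDl // mulr_ge0.
have sr2 : s <= r / 2.
  have Cs : 0 <= C * s by rewrite mulr_ge0 // ltW.
  by lra.
have e0 := normr_ge0 e.
have Ce0 : 0 <= C * `|e| by rewrite mulr_ge0.
have inb y : `|y - x| <= 2 * C * `|e| -> ball (x0, 0 : R) r (y, e).
  move=> yx; rewrite -ball_normE /= prod_normE /= sub0r normrN gt_max.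
  apply/andP; split; last by lra.
  rewrite -(subrK x x0) -addrA; apply: le_lt_trans (ler_normD _ _) _.
  rewrite [`|x - y|]distrC; lra.
have subB (c b a : 'rV[R]_d) : (c - b) - (c - a) = a - b.
  by rewrite opprB addrC addrA subrK.
pose z k := iter k (fun y => x - (Fu (y, e) - y)) x.
have zx k : `|z k - x| <= C * `|e|.
  elim: k => [|k IH]; first by rewrite subrr normr0.
  rewrite /z iterS -/(z k) [x - _]addrC addrK normrN.
  by apply: (Bd (z k, e)); apply: inb; lra.
have zx2 k : `|z k - x| <= 2 * C * `|e| by have := zx k; lra.
have zz k : `|z k.+1 - z k| <= C * `|e| / 2 ^+ k.
  elim: k => [|k IH]; first by rewrite expr0 divr1; exact: zx.
  have -> : z k.+2 - z k.+1 = (Fu (z k, e) - z k) - (Fu (z k.+1, e) - z k.+1).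
    exact: (subB x).
  have := Lip (z k.+1, e) (z k, e) (inb _ (zx2 _)) (inb _ (zx2 _)).
  rewrite /= subrr normr0 mulr0 addr0 [`|z k - z k.+1|]distrC => H.
  apply: le_trans H _; rewrite exprS invfM mulrCA.
  by apply: ler_wpM2l IH; rewrite invr_ge0.
have [l lz] := geometric_limit zz.
have lx : `|l - x| <= 2 * C * `|e|.
  by have := lz 0%N; rewrite expr0 divr1 mulrA.
exists l => //.
suff /eqP : `|l - (x - (Fu (l, e) - l))| = 0.
  by rewrite normr_eq0 subr_eq0 eq_sym subr_eq addrC subrK => /eqP.
apply/eqP; rewrite -normr_le0; apply: (@le_halving _ (2 * (C * `|e|))) => k.
have -> : l - (x - (Fu (l, e) - l)) =
    (l - z k.+1) + (z k.+1 - (x - (Fu (l, e) - l))) by rewrite addrA subrK.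
rewrite normr_id; apply: le_trans (ler_normD _ _) _.
have H1 := lz k.+1; have H2 := lz k.
have := Lip (z k, e) (l, e) (inb _ (zx2 _)) (inb _ lx).
rewrite /= subrr normr0 mulr0 addr0.
have -> : z k.+1 - (x - (Fu (l, e) - l)) = (Fu (l, e) - l) - (Fu (z k, e) - z k).
  exact: (subB x).
move: H1; rewrite exprS invfM.
set b := (2 ^+ k)^-1 in H2 *; set A := C * `|e| in H2 *; lra.
Qed.

End LocalInverse.

(** * Compactness, and a local inverse valid on all compact sets *)

Section CompactUniformity.
Context {R : realType} {d : nat}.

Lemma compact_uniform_near (V : normedModType R) (K : set V) (I : Type)
    (F : set_system I) (P : V -> I -> Prop) : Filter F -> compact K ->
  (forall x, K x -> \forall z \near x & i \near F, P z i) ->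
  \forall i \near F, forall x, K x -> P x i.
Proof.
move=> FF /compact_near_coveringP cK HP.
exact: (cK I F (fun i x => P x i)).
Qed.

Lemma open_compact_nbhd (D : set 'rV[R]_d) (x : 'rV[R]_d) : open D -> D x ->
  exists K, [/\ compact K, K `<=` D & nbhs x K].
Proof.
move=> oD Dx; have /nbhs_closedballP[r rD] := open_nbhs_nbhs (conj oD Dx).
exists (closed_ball x r%:num); split=> //.
  apply: bounded_closed_compact; last exact: closed_ball_closed.
  exists (`|x| + r%:num); split=> [|M /ltW xM y /=]; first exact: num_real.
  rewrite closed_ballE // /closed_ball_ /= => yr.
  rewrite -(subrK x y); apply: le_trans (ler_normD _ _) _.
  by apply: le_trans xM; rewrite addrC lerD2l distrC.
apply/nbhs_closedballP; exists (r%:num / 2)%:pos; apply: le_closed_ball => /=.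
by rewrite ler_pdivrMr // ler_peMr // ler1n.
Qed.

Lemma exists_local_inverse (D : set 'rV[R]_d) (F : R -> 'rV[R]_d -> 'rV[R]_d) :
  open D -> (forall x, D x -> smooth 1 (fun p : 'rV[R]_d * R => F p.2 p.1) (x, 0)) ->
  (forall x, D x -> F 0 x = x) -> exists G, local_inverse D F G.
Proof.
move=> oD sF F0.
(* The bound on |y - x|^2 selects, for small e, the solution close to x without
   fixing a compact set beforehand; solutions found locally are at distance
   O(|e|). *)
pose good e x := [set y | [/\ D y, F e y = x & `|y - x| ^+ 2 <= `|e|]].
exists (fun e x => xget x (good e x)) => K cK KD rho rho0.
apply: (@compact_uniform_near _ K _ (nbhs (0 : R)) (fun x e => let y := xget x (good e x) in
  [/\ D y, F e y = x & `|y - x| < rho])) => // x /KD Dx.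
have nD : \forall z \near x, D z := open_nbhs_nbhs (conj oD Dx).
have nF0 : \forall z \near x, F 0 z = z by apply: filterS nD.
have [C C0 HC] := local_inverse_exists_near nF0 (sF _ Dx).
have [r /= r0 rD] := (nbhs_ballP _ _).1 nD.
have cC : {for (x, 0 : R), continuous (fun p : 'rV[R]_d * R => p.1)}.
  exact: smooth_continuous (smooth_fst 0 _).
have ce (c : R) : 0 < c -> \forall p \near (x, 0 : R), `|p.2| < c.
  move=> c0; have : {for (x, 0 : R), continuous (fun p : 'rV[R]_d * R => p.2)}.
    exact: smooth_continuous (smooth_snd 0 _).
  move=> /cvgrPdist_lt/(_ _ c0); apply: filterS => p.
  by rewrite /= sub0r normrN.
have C1 : 0 < C + 1 by rewrite ltr_wpDl.
have r2 : 0 < r / 2 by rewrite divr_gt0.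
have bx : \forall p \near (x, 0 : R), ball x (r / 2) p.1.
  by apply: cC; exact: nbhsx_ballx.
(* Three bounds on |e|: the first keeps y in the ball contained in D, the second gives C^2 |e| <= 1
   and makes y [good], the third turns the condition in [good] into a distance less than [rho]. *)
have n1 := ce (r / 2 / (C + 1)) (divr_gt0 r2 C1).
have n2 := ce ((C + 1) ^- 2) _; have n3 := ce (rho ^+ 2) _.
apply: filterS3 (filterI HC bx) n1 (filterI (n2 _) (n3 _)).
- move=> [z e] /= [[y Fy yz] bz] e1 [e2 e3].
  have e0 := normr_ge0 e.
  have Dy : D y.
    apply: rD; rewrite -ball_normE /= -(subrK z x) -addrA.
    apply: le_lt_trans (ler_normD _ _) _; rewrite [`|z - y|]distrC.
    rewrite -ball_normE /= in bz; rewrite [r]splitr; apply: ltrD => //.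
    apply: le_lt_trans yz _; rewrite ltr_pdivlMr // in e1.
    by apply: le_lt_trans e1; rewrite mulrC ler_wpM2l // lerDl.
  have gy : good e z y.
    split=> //; apply: (@le_trans _ _ ((C * `|e|) ^+ 2)).
      by apply: lerXn2r; rewrite ?nnegrE ?mulr_ge0.
    rewrite exprMn expr2 [`|e| ^+ 2]expr2 mulrA ler_piMl //.
    apply: (@le_trans _ _ ((C + 1) ^+ 2 * (C + 1) ^- 2)); last first.
      by rewrite divff // expf_neq0 // gt_eqF.
    apply: ler_pM; rewrite ?mulr_ge0 ?expr2 //; last exact: ltW.
    by apply: ler_pM => //; rewrite lerDl.
  have [Dg Fg gz] := xgetPex z (ex_intro _ y gy); split=> //.
  have := le_lt_trans gz e3; rewrite ltr_pXn2r ?nnegrE //; exact: ltW.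
- by rewrite invr_gt0 exprn_gt0.
- by rewrite exprn_gt0.
Qed.

End CompactUniformity.

(** * Smoothness of matrix inverses *)

Section SmoothMatrices.
Context {R : realType} {U : normedModType R}.

Lemma smooth_mulmx d k (w : U -> 'rV[R]_d) (B : U -> 'M[R]_d) (p : U) :
  smooth k w p -> (forall i j, smooth k (fun q => B q i j) p) ->
  smooth k (fun q => w q *m B q) p.
Proof.
move=> sw sB; apply: smooth_rV => j.
apply: (@smooth_near _ _ _ k (fun q => \sum_i w q 0 i * B q i j)).
  by apply: nearW => q; rewrite mxE.
by apply: smooth_sum => i _; apply: smoothM => //; exact: smooth_coord.
Qed.

Lemma smooth_det d k (A : U -> 'M[R]_d) (p : U) :
  (forall i j, smooth k (fun q => A q i j) p) -> smooth k (fun q => \det (A q)) p.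
Proof.
move=> sA; apply: smooth_sum => s _; apply: smoothM; first exact: smooth_cst.
by apply: smooth_prod => i _.
Qed.

(** Cramer's formula: the entries are cofactors over a determinant that stays nonzero near p. *)
Lemma smooth_invmx d k (A : U -> 'M[R]_d) (p : U) : A p \in unitmx ->
  (forall i j, smooth k (fun q => A q i j) p) ->
  forall i j, smooth k (fun q => invmx (A q) i j) p.
Proof.
move=> uA sA i j; have sdet := smooth_det sA.
have det0 : \det (A p) != 0 by rewrite -unitfE -unitmxE.
have ndet : \forall q \near p, \det (A q) != 0.
  by move: (smooth_continuous sdet) => /cvgr_neq0; apply.
apply: (@smooth_near _ _ _ k (fun q => (\det (A q))^-1 * \adj (A q) i j)).
  by apply: filterS ndet => q dq; rewrite /invmx unitmxE unitfE dq !mxE.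
apply: smoothM; first exact: smoothV.
apply: (@smooth_near _ _ _ k (fun q => cofactor (A q) j i)).
  by apply: nearW => q; rewrite mxE.
apply: smoothM; first exact: smooth_cst.
apply: smooth_det => a b.
apply: (@smooth_near _ _ _ k (fun q => A q (lift j a) (lift i b))) => //.
by apply: nearW => q; rewrite !mxE.
Qed.

End SmoothMatrices.

(** * Regularity of the local inverse *)

Section SmoothInverse.
Context {R : realType} {d N : nat}.
Variables (Fu Gu : 'rV[R]_d * R -> 'rV[R]_d) (x0 : 'rV[R]_d).
Hypothesis sF : smooth N.+1 Fu (x0, 0).
Hypothesis F0 : \forall z \near x0, Fu (z, 0) = z.
Hypothesis FG : \forall p \near (x0, 0 : R), Fu (Gu p, p.2) = p.1.
Hypothesis Gx : forall rho, 0 < rho -> \forall p \near (x0, 0 : R), `|Gu p - x0| < rho.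

Let Gam (p : 'rV[R]_d * R) := (Gu p, p.2).
Let M (q : 'rV[R]_d * R) : 'M[R]_d := \matrix_(i, j) 'd Fu q ('e_i, 0) 0 j.

Let sF1 : smooth 1 Fu (x0, 0). Proof. exact: smooth_leq sF. Qed.

Let Gx0 : Gu (x0, 0) = x0.
Proof.
apply/eqP; rewrite -subr_eq0 -normr_le0; apply/ler_addgt0Pr => e e0.
by rewrite add0r ltW // (nbhs_singleton (Gx e0)).
Qed.

Let Gam_near (P : 'rV[R]_d * R -> Prop) :
  (\forall q \near (x0, 0 : R), P q) -> \forall p \near (x0, 0 : R), P (Gam p).
Proof.
move=> /nbhs_ballP[r /= r0 rP].
have n2 : \forall p \near (x0, 0 : R), ball (0 : R) r p.2.
  by apply: (smooth_continuous (smooth_snd 0 (x0, 0 : R))); exact: nbhsx_ballx.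
apply: filterS2 (Gx r0) n2 => p Gp p2; apply: rP; split=> //=.
by rewrite -ball_normE /= distrC.
Qed.

(** Continuity of [Gu] is assumed only at (x0, 0). Writing [Gu] p as p.1 minus the defect F - id at
    [Gam] p, whose constant in x is 1/2, the increment of [Gu] is bounded by half of itself plus
    multiples of the increment of p, and the half is absorbed. *)
Let Gu_lipschitz : exists2 L, 0 <= L & exists2 r, 0 < r &
  forall p p', ball (x0, 0 : R) r p -> ball (x0, 0 : R) r p' ->
    `|Gu p' - Gu p| <= L * `|p' - p|.
Proof.
have [r [C [r0 C0 Lip _]]] := defect_lipschitz F0 sF1.
have nb : \forall p \near (x0, 0 : R), ball (x0, 0 : R) r (Gam p).
  by apply: Gam_near; exact: nbhsx_ballx.
have [s /= s0 sP] := (nbhs_ballP _ _).1 (filterI FG nb).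
exists (2 * (1 + C)); first by rewrite mulr_ge0 // addr_ge0.
exists s => // p p' bp bp'; have [Fp bGp] := sP _ bp; have [Fp' bGp'] := sP _ bp'.
have := Lip _ _ bGp bGp'; rewrite /Gam /= Fp Fp' => H.
have pp1 : `|p'.1 - p.1| <= `|p' - p| by rewrite [leRHS]prod_normE le_max lexx.
have pp2 : `|p'.2 - p.2| <= `|p' - p| by rewrite [leRHS]prod_normE le_max lexx orbT.
have T : `|Gu p' - Gu p| <= `|p'.1 - p.1| + `|(p'.1 - Gu p') - (p.1 - Gu p)|.
  have -> : Gu p' - Gu p = (p'.1 - p.1) - ((p'.1 - Gu p') - (p.1 - Gu p)).
    by apply/rowP => i; rewrite !mxE; ring.
  by apply: le_trans (ler_normB _ _) _.
have pp2C : C * `|p'.2 - p.2| <= C * `|p' - p| by exact: ler_wpM2l.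
lra.
Qed.

Let Mmul q v : 'd Fu q (v, 0) = v *m M q.
Proof.
apply/rowP => j; rewrite mxE.
have -> : (v, 0) = \sum_i v 0 i *: (('e_i, 0) : 'rV[R]_d * R).
  rewrite [in LHS](row_sum_delta v).
  elim/big_ind2 : _ => //.
    by move=> ? a ? b <- <-; congr (_, _); rewrite /= addr0.
  by move=> i _; congr (_, _); rewrite /= scaler0.
rewrite linear_sum summxE; apply: eq_bigr => i _.
by rewrite linearZ !mxE.
Qed.

Let smooth_M q k : (k <= N)%N -> smooth N.+1 Fu q ->
  forall i j, smooth k (fun q => M q i j) q.
Proof.
move=> kN [_ sF'] i j.
apply: (@smooth_near _ _ _ k (fun q => 'd Fu q ('e_i, 0) 0 j)).
  by apply: (@nearW _ (nbhs q)) => z; rewrite mxE.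
by apply: smooth_coord; apply: smooth_leq (sF' _).
Qed.

Let M1 : M (x0, 0) = 1%:M.
Proof.
apply/row_matrixP => i; rewrite row1 rowE -Mmul.
have sphi : smooth 1 (fun q => Fu q - q.1) (x0, 0).
  exact: smoothB sF1 (smooth_fst 1 _).
have phi0 : \forall z \near x0, Fu (z, 0) - (z, 0 : R).1 = 0.
  by apply: filterS F0 => z ->; rewrite subrr.
have H := nbhs_singleton (diff_vanish phi0 sphi 'e_i).
have [dF _] := sF1; have dFx := nbhs_singleton dF.
have [dfst fstE] := @diff_linear R _ _ (fun z : 'rV[R]_d * R => z.1) (x0, 0)
  (fun _ _ _ => erefl) (fun _ => cvg_fst).
have E1 := etrans (esym (congr1 (@^~ ('e_i, 0)) (diffB dFx dfst))) H.
exact: etrans (subr0_eq E1) (congr1 (@^~ ('e_i, 0)) fstE).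
Qed.

Let Munit : \forall q \near (x0, 0 : R), M q \in unitmx.
Proof.
have sdet : smooth 0 (fun q => \det (M q)) (x0, 0) by apply: smooth_det; exact: smooth_M.
have det0 : \det (M (x0, 0)) != 0 by rewrite M1 det1 oner_neq0.
have := smooth_continuous sdet => /cvgr_neq0 /(_ det0).
by apply: filterS => q dq; rewrite unitmxE unitfE.
Qed.

(** The only candidate for the differential of [Gu], found by differentiating Fu (Gu p, p.2) = p.1;
    [M] is the Jacobian in x, acting on row vectors from the right. *)
Let A (p h : 'rV[R]_d * R) :=
  (h.1 - 'd Fu (Gam p) (0, h.2)) *m invmx (M (Gam p)).

Let A_linear p : linear (A p).
Proof.
move=> a u v; rewrite /A.
have -> : ((0, (a *: u + v).2) : 'rV[R]_d * R) = a *: (0, u.2) + (0, v.2).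
  by congr (_, _) => /=; rewrite scaler0 addr0.
rewrite (linearP ('d Fu (Gam p))) scalemxAl -mulmxDl; congr (_ *m _).
by rewrite scalerBr /= opprD addrACA.
Qed.

Let A_smooth p k q : differentiable Fu (Gam p) -> smooth k (A p) q.
Proof.
move=> dF; apply: smooth_mulmx => [|i j]; last exact: smooth_cst.
apply: smoothB; first exact: smooth_fst.
apply: smooth_linear_comp; [exact: linearP|exact: diff_continuous|].
by apply: smooth_pair; [exact: smooth_cst|exact: smooth_snd].
Qed.

Let Gu_diff : \forall p \near (x0, 0 : R),
  differentiable Gu p /\ 'd Gu p = A p :> (_ -> _).
Proof.
have [L L0 [r r0 Lip]] := Gu_lipschitz.
have nb : \forall p \near (x0, 0 : R), ball (x0, 0 : R) r p by exact: nbhsx_ballx.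
have [dF _] := sF1.
apply: filterS3 (near_join FG) (near_join nb) (filterI (Gam_near dF) (Gam_near Munit)).
move=> p FGp nbp [dFp uMp]; apply: diff_epsP; first exact: A_linear.
  by move=> h; exact: smooth_continuous (A_smooth 0 h dFp).
move=> e e0; pose B := invmx (M (Gam p)).
have [K K0 KP] : exists2 K, 0 < K & forall v : 'rV[R]_d, `|v *m B| <= K * `|v|.
  apply: (@linear_lipschitz R _ _ (mulmxr B)) => v /=.
  apply: (@smooth_continuous R _ _ 0 (fun v : 'rV[R]_d => v *m B)).
  by apply: smooth_mulmx => [|i j]; [exact: smooth_id|exact: smooth_cst].
have L1 : 0 < L + 1 by rewrite ltr_wpDl.
(* L + 1 bounds the increments of [Gam] and K the inverse Jacobian, so a first-order error [del] of
   Fu becomes an error e of [Gu]. *)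
pose del := e / (K * (L + 1)).
have del0 : 0 < del by rewrite divr_gt0 // mulr_gt0.
have np (P : 'rV[R]_d * R -> Prop) : (\forall q \near p, P q) ->
    \forall h \near (0 : 'rV[R]_d * R), P (h + p).
  by rewrite (near_shift 0 p) /= subr0.
have bp := nbhs_singleton nbp.
have Gp h : ball (x0, 0 : R) r (h + p) -> `|Gam (h + p) - Gam p| <= (L + 1) * `|h|.
  move=> bh; rewrite [leLHS]prod_normE /= ge_max addrK; apply/andP; split.
    apply: le_trans (Lip _ _ bp bh) _; rewrite addrK.
    by rewrite ler_wpM2r // lerDl.
  apply: (@le_trans _ _ `|h|); first by rewrite [leRHS]prod_normE le_max lexx orbT.
  by rewrite ler_peMl // lerDr.
have [s /= s0 sP] := (nbhs_ballP _ _).1 (diff_eps dFp del0).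
have nsmall : \forall h \near (0 : 'rV[R]_d * R), `|h| < s / (L + 1).
  have s1 : 0 < s / (L + 1) by rewrite divr_gt0.
  have := nbhsx_ballx (0 : 'rV[R]_d * R) _ s1; apply: filterS => h.
  by rewrite -ball_normE /= sub0r normrN.
apply: filterS3 (np _ nbp) (np _ FGp) nsmall => h bh Fh hs.
set k := Gu (h + p) - Gu p.
pose rho := Fu (Gam (h + p)) - Fu (Gam p) - 'd Fu (Gam p) (k, h.2).
have GhE : Gam (h + p) - Gam p = (k, h.2).
  by congr (_, _); rewrite /= addrK.
have rhoE : `|rho| <= del * ((L + 1) * `|h|).
  have := Gp _ bh; rewrite GhE => kh.
  have bk : ball (0 : 'rV[R]_d * R) s (k, h.2).
    rewrite -ball_normE /= sub0r normrN; apply: le_lt_trans kh _.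
    by rewrite mulrC -ltr_pdivlMr.
  have := sP _ bk; rewrite -GhE subrK GhE -/rho => /le_trans; apply.
  by apply: ler_wpM2l kh; exact: ltW.
have FGp0 := nbhs_singleton FGp.
have kE : k *m M (Gam p) = (h.1 - 'd Fu (Gam p) (0, h.2)) - rho.
  have dE : 'd Fu (Gam p) (k, h.2) = k *m M (Gam p) + 'd Fu (Gam p) (0, h.2).
    rewrite -Mmul -linearD; congr ('d Fu _ _).
    by congr (_, _); rewrite /= ?addr0 ?add0r.
  rewrite /rho dE /Gam Fh FGp0 /=.
  by apply/rowP => i; rewrite !mxE; ring.
have -> : Gu (h + p) - Gu p - A p h = - (rho *m B).
  rewrite -/k -[k](mulmxK uMp) kE /A mulmxBl [X in X - _]addrC addrK //.
rewrite normrN; apply: le_trans (KP _) _.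
apply: le_trans (ler_wpM2l (ltW K0) rhoE) _.
rewrite [leLHS](_ : _ = e * `|h|) // /del; field.
by rewrite !gt_eqF.
Qed.

(** Bootstrapping: the differential of [Gu] is built from first derivatives of Fu at [Gam] p, so it
    is as smooth as [Gu] is already known to be, and [Gu] gains an order at each step. *)
Lemma smooth_inverse : smooth N.+1 Gu (x0, 0).
Proof.
suff : forall k, (k <= N.+1)%N -> smooth k Gu (x0, 0) by apply.
elim=> [_|k IH kN].
  apply: filterS Gu_diff => p [dG _]; exact: differentiable_continuous.
have sG := IH (ltnW kN).
split=> [|v]; first by apply: filterS Gu_diff => p [].
apply: (@smooth_near _ _ _ k (fun p => A p v)).
  by apply: filterS Gu_diff => p [_ ->].
have fr := framed_prod (framed_rV (R := R) d) framed_R.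
have sGam : smooth k Gam (x0, 0) by exact: smooth_pair sG (smooth_snd k _).
have GamE : Gam (x0, 0) = (x0, 0) by rewrite /Gam Gx0.
apply: smooth_mulmx => [|i j].
  apply: smoothB; first exact: smooth_cst.
  apply: (@smooth_comp R _ _ _ k (fun q => 'd Fu q (0, v.2)) Gam) => //.
  by rewrite GamE; case: sF => _ sF'; apply: smooth_leq (sF' _).
apply: (@smooth_invmx R _ d k (fun p => M (Gam p))) => [|a b].
  by rewrite GamE; exact: nbhs_singleton Munit.
apply: (@smooth_comp R _ _ _ k (fun q => M q a b) Gam) => //.
by rewrite GamE; exact: smooth_M.
Qed.

End SmoothInverse.

(** * Flows of small vector fields *)

Section Primitive.
Context {R : realType}.

Lemma continuous_primitive (c : R -> R) : continuous c ->
  exists P : R -> R, P 0 = 0 /\ forall t : R, -1 < t -> is_derive t 1 P (c t).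
Proof.
(* Integrating from -1 makes 0 an interior point, so that the derivative there is two-sided. *)
move=> cc; pose I (t : R) := (\int[lebesgue_measure]_(s in `[(-1 : R), t]) (c s))%R.
exists (fun t => I t - I 0); split=> [|t t1]; first by rewrite subrr.
have tt : t < t + 1 by rewrite ltrDl.
have ci : lebesgue_measure.-integrable `[-1, t + 1] (EFin \o c).
  apply: continuous_compact_integrable; first exact: segment_compact.
  exact: continuous_subspaceT.
have [dI IE] := @continuous_FTC1_closed R c (-1) t (t + 1) tt ci t1 (cc t).
have H : is_derive t 1 I (c t).
  by apply: DeriveDef; [exact: dI|rewrite -derive1E; exact: IE].
rewrite -[c t]subr0.
have -> : (fun t => I t - I 0) = I - cst (I 0) by [].
exact: is_deriveB.
Qed.

Lemma continuous_primitive_rV d (c : R -> 'rV[R]_d) : continuous c ->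
  exists P : R -> 'rV[R]_d,
    P 0 = 0 /\ forall t : R, -1 < t -> is_derive t 1 P (c t).
Proof.
move=> cc; have cj j : continuous (fun t => c t 0 j).
  by move=> t; exact: (continuous_comp (cc t) (@coord_continuous R 1 d 0 j (c t))).
have /choice[P PP] : forall j, exists P : R -> R, P 0 = 0 /\
    forall t : R, -1 < t -> is_derive t 1 P (c t 0 j).
  by move=> j; exact: continuous_primitive.
exists (fun t => \row_j P j t); split=> [|t t1].
  by apply/rowP => j; rewrite !mxE; case: (PP j).
have dP : derivable (fun t => \row_j P j t) t 1.
  apply/derivable_mxP => i j.
  have -> : (fun x => (\row_j0 P j0 x) i j) = P j by apply/funext => s; rewrite mxE.
  by case: (PP j) => _ /(_ _ t1) [].
split=> //; rewrite (derive_mx dP); apply/rowP => j; rewrite mxE.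
have -> : (fun x => (\row_j0 P j0 x) 0 j) = P j by apply/funext => s; rewrite mxE.
by case: (PP j) => _ /(_ _ t1) [].
Qed.

End Primitive.

(** * Trajectories over unit time: comparison, confinement, existence *)

Section Picard.
Context {R : realType} {d : nat}.

(* Over unit time a Lipschitz constant 1/2 makes the comparison a contraction in
   the sup norm, which replaces the Gronwall inequality. *)
Lemma compare_trajectories (u q du dq : R -> 'rV[R]_d) (M del : R) :
  u 0 = q 0 ->
  {within `[0, 1], continuous u} -> {within `[0, 1], continuous q} ->
  (forall t : R, 0 < t < 1 -> is_derive t 1 u (du t)) ->
  (forall t : R, 0 < t < 1 -> is_derive t 1 q (dq t)) ->
  (forall t : R, 0 < t < 1 -> `|du t - dq t| <= 2^-1 * `|u t - q t| + del) ->
  (forall t : R, 0 <= t <= 1 -> `|u t - q t| <= M) ->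
  forall t : R, 0 <= t <= 1 -> `|u t - q t| <= 2 * del.
Proof.
move=> uq0 cu cq dU dQ duq uqM.
have step M' : (forall t : R, 0 <= t <= 1 -> `|u t - q t| <= M') ->
    forall t : R, 0 <= t <= 1 -> `|u t - q t| <= 2^-1 * M' + del.
  move=> HM t /andP[t0 t1].
  have tsub (s : R) : 0 < s < t -> 0 < s < 1.
    by move=> /andP[-> st] /=; exact: lt_le_trans t1.
  have K0 : 0 <= 2^-1 * M' + del.
    have h : (0 : R) < (2^-1 : R) < 1 by apply/andP; split; lra.
    apply: le_trans (le_trans (normr_ge0 _) (duq _ h)) _.
    by rewrite lerD2r ler_wpM2l // HM // !ltW //; case/andP: h.
  have := @mean_value_le R d (u - q) (fun s => du s - dq s) 0 t (2^-1 * M' + del) t0.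
  have -> : (u - q) t - (u - q) 0 = u t - q t.
    by rewrite !fctE uq0 subrr subr0.
  rewrite subr0 => H; apply: le_trans (H _ _ _) _.
  - by move=> s /tsub s01; apply: is_deriveB; [exact: dU|exact: dQ].
  - have sub : `[0, t]%classic `<=` `[0, 1]%classic.
      by move=> s /=; rewrite !in_itv /= => /andP[-> st]; exact: le_trans t1.
    apply: continuous_subspaceW sub _.
    by move=> s; exact: (cvgB (cu s) (cq s)).
  - move=> s /tsub /andP[s0 s1]; apply: le_trans (duq _ _) _; first by rewrite s0.
    by rewrite lerD2r ler_wpM2l // HM // !ltW.
  - by rewrite ler_piMr.
(* 2 * [del] is the fixed point of M |-> M / 2 + [del], and the excess over it halves at every
   application of [step]. *)
have it k : forall t : R, 0 <= t <= 1 ->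
    `|u t - q t| <= (M - 2 * del) / 2 ^+ k + 2 * del.
  elim: k => [|k IH] t t01.
    by rewrite expr0 divr1 subrK; exact: uqM.
  apply: le_trans (step _ IH _ t01) _.
  by rewrite exprS invfM; set b := (2 ^+ k)^-1; lra.
move=> t t01; rewrite -subr_le0; apply: (@le_halving _ _ (M - 2 * del)) => k.
by rewrite lerBlDr; exact: it.
Qed.



(** The bound on Y holds only inside the ball, whence the first exit time. Up to and including that
    time the mean value inequality applies, and the strict inequality on r leaves room to stay
    inside a little longer, a contradiction. *)
Lemma trajectory_stays (Y : 'rV[R]_d -> 'rV[R]_d) (u : R -> 'rV[R]_d)
    (x0 : 'rV[R]_d) (r B : R) :
  0 <= B -> (forall y, ball x0 r y -> `|Y y| <= B) -> `|u 0 - x0| + B < r ->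
  {within `[0, 1], continuous u} ->
  (forall t : R, 0 < t < 1 -> is_derive t 1 u (Y (u t))) ->
  forall t : R, 0 <= t <= 1 -> ball x0 r (u t) /\ `|u t - u 0| <= B.
Proof.
move=> B0 YB uB cu du.
have mvi (t : R) : 0 <= t <= 1 -> (forall s : R, 0 <= s < t -> ball x0 r (u s)) ->
    `|u t - u 0| <= B /\ ball x0 r (u t).
  move=> /andP[t0 t1] bs.
  have H : `|u t - u 0| <= B.
    have := @mean_value_le R d u (fun s => Y (u s)) 0 t B t0.
    rewrite subr0 => H; apply: le_trans (H _ _ _) _.
    - by move=> s /andP[s0 st]; apply: du; rewrite s0 (lt_le_trans st).
    - apply: continuous_subspaceW cu => s /=.
      by rewrite !in_itv /= => /andP[-> st]; exact: le_trans t1.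
    - by move=> s /andP[s0 st]; apply/YB/bs; rewrite ltW.
    - by rewrite ler_piMr.
  split=> //; rewrite -ball_normE /= distrC -(subrK (u 0) (u t)) -addrA.
  apply: le_lt_trans (ler_normD _ _) _; apply: le_lt_trans uB.
  by rewrite [leRHS]addrC lerD2r.
suff bs : forall t : R, 0 <= t <= 1 -> ball x0 r (u t).
  move=> t t01; split; first exact: bs.
  have [] // := mvi t t01 _ => s /andP[s0 st]; apply: bs.
  by rewrite s0 /= ltW // (lt_le_trans st) //; case/andP: t01.
apply: contrapT => /existsNP[t1 /not_implyP[t101 nb1]].
pose S := [set t : R | 0 <= t <= 1 /\ ~ ball x0 r (u t)].
have hS : has_inf S.
  by split; [exists t1|exists 0 => t [/andP[]]].
pose tau := inf S.
have tau0 : 0 <= tau by apply: lb_le_inf; [case: hS|move=> t [/andP[]]].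
have tau1 : tau <= 1.
  by apply: (@le_trans _ _ t1); [apply: ge_inf; [case: hS|]|case/andP: t101].
have bt s : 0 <= s < tau -> ball x0 r (u s).
  move=> /andP[s0 st]; apply: contrapT => nb.
  have : S s by split=> //; rewrite s0 ltW // (lt_le_trans st).
  by move=> /(ge_inf hS.2); rewrite leNgt st.
have tau01 : 0 <= tau <= 1 by rewrite tau0.
have [_ btau] := mvi tau tau01 bt.
have e0 : 0 < r - `|u tau - x0|.
  by rewrite subr_gt0; move: btau; rewrite -ball_normE /= distrC.
have /subspace_continuousP/(_ tau) := cu; rewrite /= in_itv /= tau01 => /(_ isT).
move=> /cvgrPdist_lt/(_ _ e0)/nbhs_ballP[dl /= dl0 Hdl].
have [s [s01 nbs] sdl] := inf_adherent dl0 hS.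
have taus : tau <= s by apply: ge_inf; [case: hS|].
apply: nbs; rewrite -ball_normE /= distrC.
have := Hdl s _ _; rewrite /= in_itv /= => H.
have {}H : `|u tau - u s| < r - `|u tau - x0|.
  apply: H => //; rewrite -ball_normE /= distrC ger0_norm ?subr_ge0 //.
  by rewrite ltrBlDl.
rewrite -(subrK (u tau) (u s)) -addrA; apply: le_lt_trans (ler_normD _ _) _.
by rewrite [`|u s - _|]distrC -ltrBrDr.
Qed.

(** The integral operator acts on the B-Lipschitz curves that start at x: they stay in the ball
    where Y is controlled. The constant 1/2 makes it a contraction on all of [0, 1], with no
    subdivision of time. *)
Lemma picard (Y : 'rV[R]_d -> 'rV[R]_d) (x0 x : 'rV[R]_d) (r B : R) :
  0 <= B -> (forall y, ball x0 r y -> `|Y y| <= B) ->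
  (forall y y', ball x0 r y -> ball x0 r y' -> `|Y y' - Y y| <= 2^-1 * `|y' - y|) ->
  `|x - x0| + B < r ->
  exists v : R -> 'rV[R]_d, v 0 = x /\ forall t : R, 0 <= t <= 1 ->
    ball x0 r (v t) /\ is_derive t 1 v (Y (v t)).
Proof.
move=> B0 YB Ylip xB.
pose adm (u : R -> 'rV[R]_d) := u 0 = x /\ forall t t' : R,
  0 <= t <= 1 -> 0 <= t' <= 1 -> `|u t' - u t| <= B * `|t' - t|.
have adm_ball u t : adm u -> 0 <= t <= 1 -> ball x0 r (u t).
  move=> [u0 uL] /[dup] t01 /andP[t0 t1].
  rewrite -ball_normE /= distrC -(subrK x (u t)) -addrA.
  apply: le_lt_trans (ler_normD _ _) _; apply: le_lt_trans xB.
  rewrite [leRHS]addrC lerD2r -u0; apply: le_trans (uL 0 t _ t01) _.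
    by rewrite lexx ler01.
  by rewrite subr0 ger0_norm // ler_piMr.
(* Precomposition with [clamp] gives an integrand continuous on the whole line, as
   [continuous_primitive_rV] requires. *)
pose clamp (t : R) : R := Num.max 0 (Num.min t 1).
have clamp01 t : 0 <= clamp t <= 1.
  by rewrite /clamp le_max lexx /= ge_max ler01 /= ge_min lexx orbT.
have clampE t : 0 <= t <= 1 -> clamp t = t.
  by move=> /andP[t0 t1]; rewrite /clamp min_l // max_r.
have clampL t t' : `|clamp t' - clamp t| <= `|t' - t|.
  have := ler_norm (t' - t); have := ler_norm (t - t').
  rewrite [`|t - t'|]distrC; have := normr_ge0 (t' - t).
  move: `|t' - t| => a ? ? ?; rewrite ler_norml /clamp /Order.max /Order.min.
  case: (ltP t 1) => ?; case: (ltP t' 1) => ?; (do 2? [case: ifPn; rewrite -?leNgt => ?]);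
    apply/andP; split; lra.
have stepE u : exists v, adm u -> adm v /\
    forall t : R, 0 <= t <= 1 -> is_derive t 1 v (Y (u t)).
  have [admu|nadm] := pselect (adm u); last by exists u.
  pose c t := Y (u (clamp t)).
  have cL t t' : `|c t' - c t| <= B * `|t' - t|.
    apply: le_trans (Ylip _ _ (adm_ball _ _ admu (clamp01 _))
      (adm_ball _ _ admu (clamp01 _))) _.
    apply: (@le_trans _ _ (1 * `|u (clamp t') - u (clamp t)|)).
      by rewrite ler_wpM2r // invf_le1 // ler1n.
    rewrite mul1r; apply: le_trans (admu.2 _ _ (clamp01 _) (clamp01 _)) _.
    exact: ler_wpM2l.
  have cc : continuous c.
    move=> t; apply/cvgrPdist_lt => e e0.
    have B1 : 0 < B + 1 by rewrite ltr_wpDl.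
    have eB : 0 < e / (B + 1) by rewrite divr_gt0.
    have := nbhsx_ballx t _ eB; apply: filterS => s.
    rewrite -ball_normE /= => ts.
    apply: le_lt_trans (cL _ _) _; rewrite ltr_pdivlMr // in ts.
    by apply: le_lt_trans ts; rewrite mulrC ler_wpM2l // lerDl.
  have [P [P0 dP]] := continuous_primitive_rV cc.
  have dv (t : R) : 0 <= t <= 1 -> is_derive t 1 (fun t => x + P t) (Y (u t)).
    move=> /[dup] t01 /andP[t0 t1].
    have -> : (fun t => x + P t) = cst x + P by [].
    rewrite -[Y (u t)]add0r -{2}(clampE t t01).
    apply: is_deriveD; apply: dP; apply: lt_le_trans t0.
    by rewrite ltrN10.
  exists (fun t => x + P t) => _; split=> //; split; first by rewrite P0 addr0.
  have L t t' : 0 <= t <= 1 -> 0 <= t' <= 1 -> t <= t' ->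
      `|x + P t' - (x + P t)| <= B * (t' - t).
    move=> t01 t'01 tt'.
    apply: (@mean_value_le R d (fun t => x + P t) (fun t => Y (u t))) => //.
    - move=> s /andP[ts st']; apply: dv; case/andP: t01 => t0 _; case/andP: t'01 => _ t'1.
      by rewrite (le_trans t0 (ltW ts)) (le_trans (ltW st')).
    - apply: derivable_within_continuous => s; rewrite in_itv /= => /andP[ts st'].
      case/andP: t01 => t0 _; case/andP: t'01 => _ t'1.
      apply: ex_derive; apply: dv.
      by rewrite (le_trans t0 ts) (le_trans st').
    - move=> s /andP[ts st']; apply/YB/adm_ball => //.
      case/andP: t01 => t0 _; case/andP: t'01 => _ t'1.
      by rewrite (le_trans t0 (ltW ts)) (le_trans (ltW st')).
  move=> t t' t01 t'01; case: (leP t t') => tt'.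
    by rewrite [`|t' - t|]ger0_norm ?subr_ge0 //; exact: L.
  have tt'0 : 0 <= t - t' by rewrite subr_ge0 ltW.
  rewrite distrC [`|t' - t|]distrC (ger0_norm tt'0).
  by apply: L => //; exact: ltW.
have /choice[st stP] := stepE.
have contr u u' M : adm u -> adm u' ->
    (forall t : R, 0 <= t <= 1 -> `|u' t - u t| <= M) ->
    forall t : R, 0 <= t <= 1 -> `|st u' t - st u t| <= 2^-1 * M.
  move=> au au' uM t /[dup] t01 /andP[t0 t1].
  have [[v0 _] dv] := stP _ au; have [[v'0 _] dv'] := stP _ au'.
  have M0 : 0 <= M by apply: le_trans (uM 0 _); rewrite ?normr_ge0 // lexx ler01.
  have sub (s : R) : 0 <= s <= t -> 0 <= s <= 1.
    by move=> /andP[-> st']; exact: le_trans t1.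
  have dw (s : R) : 0 <= s <= t -> is_derive s 1 (st u' - st u) (Y (u' s) - Y (u s)).
    by move=> /sub s01; apply: is_deriveB; [exact: dv'|exact: dv].
  have := @mean_value_le R d (st u' - st u) (fun s => Y (u' s) - Y (u s)) 0 t (2^-1 * M) t0.
  have -> : (st u' - st u) t - (st u' - st u) 0 = st u' t - st u t.
    by rewrite !fctE v0 v'0 subrr subr0.
  rewrite subr0 => H; apply: le_trans (H _ _ _) _.
  - by move=> s /andP[s0 s1]; apply: dw; rewrite !ltW.
  - by apply: derivable_within_continuous => s; rewrite in_itv /= => /dw.
  - move=> s /andP[s0 s1]; have s01 : 0 <= s <= 1 by apply: sub; rewrite !ltW.
    apply: le_trans (Ylip _ _ (adm_ball _ _ au s01) (adm_ball _ _ au' s01)) _.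
    by apply: ler_wpM2l (uM _ s01).
  - by rewrite ler_piMr // mulr_ge0.
pose z k := iter k st (fun=> x).
have zadm k : adm (z k).
  elim: k => [|k IH]; last by case: (stP _ IH).
  by split=> // t t' _ _; rewrite subrr normr0 mulr_ge0.
have zz k (t : R) : 0 <= t <= 1 -> `|z k.+1 t - z k t| <= B / 2 ^+ k.
  elim: k t => [|k IH] t t01.
    rewrite expr0 divr1; have [z0 zL] := zadm 1%N; have t0 : (0 : R) <= (0 : R) <= 1.
      by rewrite lexx ler01.
    have := zL 0 t t0 t01; rewrite z0 => /le_trans; apply.
    by case/andP: t01 => t0' t1; rewrite subr0 ger0_norm // ler_piMr.
  have := contr _ _ _ (zadm k) (zadm k.+1) IH t t01.
  by rewrite exprS invfM mulrCA.
have /choice[u uP] : forall t : R, exists l, 0 <= t <= 1 ->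
    forall k, `|l - z k t| <= 2 * B / 2 ^+ k.
  move=> t; have [t01|] := boolP (0 <= t <= 1); last by exists 0.
  by have [l lP] := geometric_limit (fun k => zz k t t01); exists l.
have admu : adm u.
  split.
    have t0 : (0 : R) <= (0 : R) <= 1 by rewrite lexx ler01.
    apply/eqP; rewrite -subr_eq0 -normr_le0; apply: (@le_halving _ _ (2 * B)) => k.
    by have := uP 0 t0 k; rewrite (zadm k).1 ?normr_id.
  move=> t t' t01 t'01; rewrite -subr_le0.
  apply: (@le_halving _ _ (4 * B)) => k; rewrite lerBlDr.
  have H1 := uP _ t01 k; have H2 := uP _ t'01 k.
  have H3 := (zadm k).2 _ _ t01 t'01.
  have -> : u t' - u t = (u t' - z k t') + (z k t' - z k t) + (z k t - u t).
    by rewrite !subrKA.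
  apply: le_trans (ler_normD _ _) _.
  have := ler_normD (u t' - z k t') (z k t' - z k t).
  rewrite [`|z k t - u t|]distrC; set b := (2 ^+ k)^-1 in H1 H2 *.
  lra.
have [admv dv] := stP _ admu.
have vu (t : R) : 0 <= t <= 1 -> st u t = u t.
  move=> t01; apply/eqP; rewrite -subr_eq0 -normr_le0.
  apply: (@le_halving _ _ (2 * B)) => k; rewrite ?normr_id.
  have H1 := uP _ t01 k.+1.
  have H2 := contr _ _ _ (zadm k) admu (fun t t01 => uP t t01 k) t t01.
  have -> : st u t - u t = (st u t - z k.+1 t) + (z k.+1 t - u t).
    by rewrite addrA subrK.
  apply: le_trans (ler_normD _ _) _; rewrite [`|z _ t - u t|]distrC.
  rewrite -[st (z k)]/(z k.+1) in H2.
  move: H1; rewrite exprS invfM; set b := (2 ^+ k)^-1 in H2 *; lra.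
(* The limit u is unspecified outside [0, 1], so it need not have two-sided derivatives at 0 and 1;
   [st u] has them and equals u on [0, 1]. *)
exists (st u); split=> [|t t01]; first exact: admv.1.
by split; [exact: adm_ball|rewrite vu //; exact: dv].
Qed.

End Picard.

(** * Time-one maps near a point *)

Section LocalFlow.
Context {R : realType} {d : nat}.

(** The constant is treated as a second parameter tending to +oo, so that the covering form of
    compactness yields a common constant along with a common neighbourhood. *)
Lemma compact_uniform_bound (V : normedModType R) (K : set V) (I : Type)
    (F : set_system I) (P : V -> I -> R -> Prop) : Filter F ->
  compact K -> (forall x i C C', C <= C' -> P x i C -> P x i C') ->
  (forall x, K x -> exists C, \forall z \near x & i \near F, P z i C) ->
  exists C, \forall i \near F, forall x, K x -> P x i C.
Proof.
move=> FF /compact_near_coveringP cK mono HP.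
have := cK (I * R)%type (filter_prod F (pinfty_nbhs R))
  (fun iC x => P x iC.1 iC.2) _.
case=> [x Kx|[A B] /= [nA [M [_ MB]]] AB].
  have [C [[A B] /= [nA nB] AB]] := HP x Kx.
  have nC : \forall c \near pinfty_nbhs R, C <= c by exact: nbhs_pinfty_ge (num_real _).
  exists (A, [set iC | B iC.1 /\ C <= iC.2]) => /=.
    by split=> //; exists (B, [set c | C <= c]) => //=.
  by move=> [y [i c]] /= [Ay [Bi Cc]]; apply: (mono _ _ C) => //; exact: (AB (y, i)).
exists (M + 1); apply: filterS nA => i Ai x Kx.
by apply: (AB (i, M + 1)) => //; split=> //=; apply: MB; rewrite ltrDl.
Qed.

Lemma near_small (x0 : 'rV[R]_d) (C r : R) : 0 <= C -> 0 < r ->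
  \forall p \near (x0, 0 : R), `|p.1 - x0| + C * `|p.2| < r.
Proof.
move=> C0 r0.
have c : {for (x0, 0 : R), continuous
    (fun p : 'rV[R]_d * R => `|p.1 - x0| + C * `|p.2|)}.
  apply: cvgD.
    by apply: cvg_norm; apply: cvgB; [exact: cvg_fst|exact: cvg_cst].
  apply: cvgM; first exact: cvg_cst.
  by apply: cvg_norm; exact: cvg_snd.
have := c; rewrite /prop_for /continuous_at /= subrr !normr0 mulr0 addr0.
by move=> /cvgr_lt/(_ _ r0).
Qed.

Lemma flow_in_ball (D : set 'rV[R]_d) (X : 'rV[R]_d -> 'rV[R]_d) x y (x0 : 'rV[R]_d)
    (r B : R) :
  0 <= B -> (forall z, ball x0 r z -> `|X z| <= B) -> `|x - x0| + B < r ->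
  flow D X 1 x y -> exists u : R -> 'rV[R]_d,
  [/\ u 0 = x, u 1 = y, {within `[0, 1], continuous u},
      forall t : R, 0 < t < 1 -> is_derive t 1 u (X (u t)) &
      forall t : R, 0 <= t <= 1 -> ball x0 r (u t) /\ `|u t - x| <= B].
Proof.
move=> B0 XB xB [u [u0 u1 cu _ du]]; exists u; split=> // t t01.
have uB : `|u 0 - x0| + B < r by rewrite u0.
by have := trajectory_stays B0 XB uB cu du t01; rewrite u0.
Qed.

(** Q is an approximate trajectory from p.1 to Fu p with defect C |e|^N. Existence comes from
    [picard]; any true trajectory is confined by [flow_in_ball] to the ball where Y has constant
    1/2, so it stays within 2 C |e|^N of Q. *)
Lemma near_flow_approx (D : set 'rV[R]_d) (Fu Y : 'rV[R]_d * R -> 'rV[R]_d)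
    (Q dQ : R -> 'rV[R]_d * R -> 'rV[R]_d) (x0 : 'rV[R]_d) (N : nat) (C : R) :
  open D -> D x0 -> smooth 1 Y (x0, 0) -> (\forall z \near x0, Y (z, 0) = 0) ->
  (forall r, 0 < r -> \forall p \near (x0, 0 : R),
    forall t : R, 0 <= t <= 1 -> ball x0 r (Q t p)) ->
  (\forall p \near (x0, 0 : R), [/\ Q 0 p = p.1, Q 1 p = Fu p &
    forall t : R, 0 <= t <= 1 -> is_derive t 1 (Q^~ p) (dQ t p) /\
      `|dQ t p - Y (Q t p, p.2)| <= C * `|p.2| ^+ N]) ->
  exists C', \forall p \near (x0, 0 : R),
    (exists y, flow D (fun z => Y (z, p.2)) 1 p.1 y) /\
    (forall y, flow D (fun z => Y (z, p.2)) 1 p.1 y ->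
      `|Fu p - y| <= C' * `|p.2| ^+ N).
Proof.
move=> oD Dx0 sY Y0 Qball HQ; exists (2 * C).
have c0 : (0 : R) < 2^-1 by rewrite invr_gt0.
have [r1 [K [r10 K0 Ylip YB]]] := perturbation_lipschitz sY Y0 c0.
have [r2 /= r20 r2D] := (nbhs_ballP _ _).1 (open_nbhs_nbhs (conj oD Dx0)).
pose r := Num.min r1 r2.
have r0 : 0 < r by rewrite lt_min r10 r20.
have bD z : ball x0 r z -> D z.
  by move=> bz; apply: r2D; move: bz; apply: le_ball; rewrite ge_min lexx orbT.
have br1 z : ball x0 r z -> ball x0 r1 z by apply: le_ball; rewrite ge_min lexx.
have K1 : 0 <= K + 1 by rewrite addr_ge0.
apply: filterS3 (near_small x0 K1 r0) (Qball _ r0) HQ => p pr Qb [Q0 Q1 HQp].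
have p1 := normr_ge0 (p.1 - x0); have p2 := normr_ge0 p.2.
have Kp : 0 <= K * `|p.2| by rewrite mulr_ge0.
have b2 : ball (0 : R) r1 p.2.
  rewrite -ball_normE /= sub0r normrN; apply: (@lt_le_trans _ _ r); first by lra.
  by rewrite ge_min lexx.
have bp z : ball x0 r z -> ball (x0, 0 : R) r1 (z, p.2).
  by move=> bz; split=> //=; exact: br1.
have XB z : ball x0 r z -> `|Y (z, p.2)| <= K * `|p.2|.
  by move=> bz; exact: (YB (z, p.2) (bp _ bz)).
have Xlip z z' : ball x0 r z -> ball x0 r z' ->
    `|Y (z', p.2) - Y (z, p.2)| <= 2^-1 * `|z' - z|.
  move=> bz bz'; have := Ylip _ _ (bp _ bz) (bp _ bz').
  by rewrite /= subrr normr0 mulr0 addr0.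
have xB : `|p.1 - x0| + K * `|p.2| < r by lra.
split.
  have [v [v0 dv]] := picard Kp XB Xlip xB.
  exists (v 1), v; split=> //.
  - apply: derivable_within_continuous => t; rewrite in_itv /= => t01.
    by apply: ex_derive; case: (dv _ t01).
  - by move=> t t01; apply: bD; case: (dv _ t01).
  - by move=> t /andP[t0 t1]; case: (dv t); rewrite ?ltW.
move=> y /(flow_in_ball Kp XB xB)[u [u0 <- cu du ub]].
rewrite -Q1 distrC -mulrA.
apply: (@compare_trajectories R d u (Q^~ p) (fun t => Y (u t, p.2)) (dQ^~ p) (2 * r)) => //.
- by rewrite u0 Q0.
- apply: derivable_within_continuous => t; rewrite in_itv /= => t01.
  by apply: ex_derive; case: (HQp _ t01).
- move=> t /andP[t0 t1]; have t01 : 0 <= t <= 1 by rewrite !ltW.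
  by case: (HQp _ t01).
- move=> t /andP[t0 t1]; have t01 : 0 <= t <= 1 by rewrite !ltW.
  have [_ H] := HQp _ t01; have L := Xlip _ _ (Qb _ t01) (ub _ t01).1.
  have -> : Y (u t, p.2) - dQ t p =
      (Y (u t, p.2) - Y (Q t p, p.2)) + (Y (Q t p, p.2) - dQ t p).
    by rewrite subrKA.
  apply: le_trans (ler_normD _ _) _; apply: lerD; first by [].
  by rewrite distrC.
- move=> t t01; have [bu _] := ub _ t01; have bq := Qb _ t01.
  rewrite -!ball_normE /= in bu bq.
  have -> : u t - Q t p = (u t - x0) + (x0 - Q t p) by rewrite subrKA.
  apply: le_trans (ler_normD _ _) _; rewrite [`|u t - x0|]distrC; lra.
- by rewrite lexx ler01.
Qed.

End LocalFlow.

(** * Comparison of leading terms *)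

Section Uniqueness.
Context {R : realType} {d : nat}.

Lemma flow_congr (D : set 'rV[R]_d) (X X' : 'rV[R]_d -> 'rV[R]_d) T x y :
  (forall z, D z -> X z = X' z) -> flow D X T x y -> flow D X' T x y.
Proof.
move=> XX' [u [u0 uT cu Du du]]; exists u; split=> // t /[dup] tT /andP[t0 t1].
by rewrite -XX'; [exact: du|apply: Du; rewrite !ltW].
Qed.

(* Both trajectories stay O(|e|)-close to [x0], so their difference at time 1 is
   e^(k+1) (Ta - Tb)(x0, 0) + o(e^(k+1)). *)
Lemma leading_term_unique (D : set 'rV[R]_d) (Y Ta Tb : 'rV[R]_d * R -> 'rV[R]_d)
    (x0 : 'rV[R]_d) (k : nat) (C : R) :
  smooth 1 Y (x0, 0) -> (\forall z \near x0, Y (z, 0) = 0) ->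
  {for (x0, 0 : R), continuous Ta} -> {for (x0, 0 : R), continuous Tb} ->
  0 <= C ->
  (\forall e \near (0 : R), exists y y',
    [/\ flow D (fun z => Y (z, e) + e ^+ k.+1 *: Ta (z, e)) 1 x0 y,
        flow D (fun z => Y (z, e) + e ^+ k.+1 *: Tb (z, e)) 1 x0 y' &
        `|y - y'| <= C * `|e| ^+ k.+2]) ->
  Ta (x0, 0) = Tb (x0, 0).
Proof.
move=> sY Y0 cTa cTb C0 Hflow.
set a := Ta (x0, 0); set b := Tb (x0, 0).
apply/eqP; rewrite -subr_eq0 -normr_le0; apply/ler_addgt0Pr => eta eta0.
rewrite add0r; pose A := `|a| + `|b| + 2.
have A0 : 0 < A by rewrite ltr_wpDl // addr_ge0.
(* Distribution of [eta], in units of e^(k+1): eta / 4 for Y through its Lipschitz constant c, eta /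
   4 for the variation of Ta and Tb (s for each), and eta / 2 for the assumed distance of the end
   points. *)
pose c := Num.min 2^-1 (eta / (8 * A)).
have c0 : 0 < c.
  by rewrite lt_min invr_gt0 ltr0n /= divr_gt0 // mulr_gt0.
have c2 : c <= 2^-1 by rewrite ge_min lexx.
have cA : c * (2 * A) <= eta / 4.
  apply: (@le_trans _ _ (eta / (8 * A) * (2 * A))).
    by rewrite ler_wpM2r ?mulr_ge0 ?ge_min ?lexx ?orbT // ltW.
  rewrite [leLHS](_ : _ = eta / 4) //; field; exact: lt0r_neq0.
pose s := Num.min 1 (eta / 8).
have s0 : 0 < s by rewrite lt_min ltr01 /= divr_gt0.
have [r1 [K [r10 K0 Ylip YB]]] := perturbation_lipschitz sY Y0 c0.
have [r2 /= r20 HT] := (nbhs_ballP _ _).1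
  (filterI ((cvgrPdist_le _ _).1 cTa _ s0) ((cvgrPdist_le _ _).1 cTb _ s0)).
pose r := Num.min r1 r2.
have r0 : 0 < r by rewrite lt_min r10 r20.
have [r3 /= r30 HF] := (nbhs_ballP _ _).1 Hflow.
pose L := K + A + 1.
have L0 : 0 < L by rewrite ltr_wpDl // addr_ge0 // ltW.
(* A single small e is enough, as the claim does not involve e. It confines both trajectories to the
   ball, lies where the flows exist, and satisfies C e <= eta / 2. *)
pose e := Num.min (Num.min (r / (2 * L)) (r3 / 2)) (Num.min 1 (eta / (2 * (C + 1)))).
have C1 : 0 < C + 1 by rewrite ltr_wpDl.
have e0 : 0 < e.
  by rewrite !lt_min ltr01 !divr_gt0 // mulr_gt0.
have eL : L * e < r.
  apply: (@le_lt_trans _ _ (L * (r / (2 * L)))).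
    by apply: ler_wpM2l; [exact: ltW|rewrite !ge_min lexx].
  rewrite [ltLHS](_ : _ = r / 2); first by rewrite ltr_pdivrMr // ltr_pMr // ltr1n.
  by field; exact: lt0r_neq0.
have e3 : e < r3.
  apply: (@le_lt_trans _ _ (r3 / 2)); first by rewrite !ge_min lexx !orbT.
  by rewrite ltr_pdivrMr // ltr_pMr // ltr1n.
have e1 : e <= 1 by rewrite !ge_min lexx !orbT.
have eC : C * e <= eta / 2.
  apply: (@le_trans _ _ ((C + 1) * (eta / (2 * (C + 1))))).
    apply: ler_pM => //; first exact: ltW.
      by rewrite lerDl.
    by rewrite !ge_min lexx !orbT.
  rewrite [leLHS](_ : _ = eta / 2) //; field; exact: lt0r_neq0.
have ek0 : 0 < e ^+ k.+1 by rewrite exprn_gt0.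
have ek1 : e ^+ k.+1 <= e.
  rewrite exprS; apply: ler_piMr; first exact: ltW.
  by apply: exprn_ile1 => //; exact: ltW.
have er : e < r.
  apply: le_lt_trans eL; rewrite ler_peMl ?(ltW e0) // /L lerDr addr_ge0 //.
  exact: ltW.
have [|y [y' [fa fb yy']]] := HF e.
  by rewrite -ball_normE /= sub0r normrN gtr0_norm.
have bp z : ball x0 r z -> ball (x0, 0 : R) r1 (z, e) /\ ball (x0, 0 : R) r2 (z, e).
  move=> bz; split; split=> /=.
  - by move: bz; apply: le_ball; rewrite ge_min lexx.
  - rewrite -ball_normE /= sub0r normrN gtr0_norm //.
    by apply: lt_le_trans er _; rewrite ge_min lexx.
  - by move: bz; apply: le_ball; rewrite ge_min lexx orbT.
  - rewrite -ball_normE /= sub0r normrN gtr0_norm //.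
    by apply: lt_le_trans er _; rewrite ge_min lexx orbT.
have Tas z : ball x0 r z -> `|Ta (z, e) - a| <= s.
  by move=> /bp[_ /HT[+ _]]; rewrite distrC.
have Tbs z : ball x0 r z -> `|Tb (z, e) - b| <= s.
  by move=> /bp[_ /HT[_ +]]; rewrite distrC.
have s1 : s <= 1 by rewrite ge_min lexx.
have s8 : s <= eta / 8 by rewrite ge_min lexx orbT.
have TaA z : ball x0 r z -> `|Ta (z, e)| <= `|a| + 1.
  move=> bz; rewrite -(subrK a (Ta (z, e))) addrC.
  by apply: le_trans (ler_normD _ _) _; rewrite lerD2l (le_trans (Tas _ bz)).
have TbA z : ball x0 r z -> `|Tb (z, e)| <= `|b| + 1.
  move=> bz; rewrite -(subrK b (Tb (z, e))) addrC.
  by apply: le_trans (ler_normD _ _) _; rewrite lerD2l (le_trans (Tbs _ bz)).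
have XB (T : 'rV[R]_d * R -> 'rV[R]_d) : (forall z, ball x0 r z -> `|T (z, e)| <= A) ->
    forall z, ball x0 r z -> `|Y (z, e) + e ^+ k.+1 *: T (z, e)| <= (K + A) * e.
  move=> TA z bz; apply: le_trans (ler_normD _ _) _; rewrite mulrDl; apply: lerD.
    by have [+ _] := bp _ bz => /YB /=; rewrite gtr0_norm.
  rewrite normrZ gtr0_norm // [A * e]mulrC; apply: ler_pM => //; first exact: ltW.
  exact: TA.
have KAe : 0 <= (K + A) * e by rewrite mulr_ge0 ?addr_ge0 // ltW.
have xr : `|x0 - x0| + (K + A) * e < r.
  rewrite subrr normr0 add0r; apply: le_lt_trans eL.
  by rewrite ler_wpM2r ?(ltW e0) // /L lerDl.
have na := normr_ge0 a; have nb := normr_ge0 b.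
have TaA' z : ball x0 r z -> `|Ta (z, e)| <= A by move=> /TaA; rewrite /A; lra.
have TbA' z : ball x0 r z -> `|Tb (z, e)| <= A by move=> /TbA; rewrite /A; lra.
have [u [u0 u1 cu du ub]] := flow_in_ball KAe (XB _ TaA') xr fa.
have [v [v0 v1 cv dv vb]] := flow_in_ball KAe (XB _ TbA') xr fb.
have Ydiff (t : R) : 0 <= t <= 1 ->
    `|Y (u t, e) - Y (v t, e)| <= c * `|u t - v t|.
  move=> t01; have [bu _] := bp _ (ub _ t01).1; have [bv _] := bp _ (vb _ t01).1.
  by have := Ylip _ _ bv bu; rewrite /= subrr normr0 mulr0 addr0.
pose du' t := Y (u t, e) + e ^+ k.+1 *: Ta (u t, e).
pose dv' t := Y (v t, e) + e ^+ k.+1 *: Tb (v t, e).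
have dE t : du' t - dv' t =
    (Y (u t, e) - Y (v t, e)) + e ^+ k.+1 *: (Ta (u t, e) - Tb (v t, e)).
  by rewrite /du' /dv' opprD addrACA scalerBr.
(* A crude bound of the right order; multiplied by the small constant c it makes the contribution of
   Y negligible. *)
have uv : forall t : R, 0 <= t <= 1 -> `|u t - v t| <= 2 * (e ^+ k.+1 * A).
  apply: (@compare_trajectories R d u v du' dv' (2 * r)) => //.
  - by rewrite u0 v0.
  - move=> t /andP[t0 t1]; have t01 : 0 <= t <= 1 by rewrite !ltW.
    rewrite dE; apply: le_trans (ler_normD _ _) _; apply: lerD.
      by apply: le_trans (Ydiff _ t01) _; apply: ler_wpM2r.
    rewrite normrZ gtr0_norm // ler_wpM2l ?(ltW ek0) //.
    apply: le_trans (ler_normB _ _) _.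
    by have := TaA _ (ub _ t01).1; have := TbA _ (vb _ t01).1; rewrite /A; lra.
  - move=> t t01; have [bu _] := ub _ t01; have [bv _] := vb _ t01.
    rewrite -!ball_normE /= in bu bv.
    have -> : u t - v t = (u t - x0) + (x0 - v t) by rewrite subrKA.
    apply: le_trans (ler_normD _ _) _; rewrite [`|u t - x0|]distrC; lra.
pose w (t : R) := (u t - v t) - t *: (e ^+ k.+1 *: (a - b)).
have w1 : `|w 1 - w 0| <= eta / 2 * e ^+ k.+1 * (1 - 0).
  apply: (@mean_value_le R d w (fun t => (du' t - dv' t) - e ^+ k.+1 *: (a - b))) => //.
  - move=> t t01; apply: is_deriveB; first by apply: is_deriveB; [exact: du|exact: dv].
    rewrite -[X in is_derive _ _ _ X]scale1r.
    by apply: (@is_derive_Zl R _ (fun t => t)); exact: is_derive_id.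
  - have cl : {within `[0, 1], continuous (fun t : R => t *: (e ^+ k.+1 *: (a - b)))}.
      by apply: continuous_subspaceT; exact: scalel_continuous.
    by move=> t; exact: (cvgB (cvgB (cu t) (cv t)) (cl t)).
  move=> t /andP[t0 t1]; have t01 : 0 <= t <= 1 by rewrite !ltW.
  rewrite dE -addrA -scalerBr; apply: le_trans (ler_normD _ _) _.
  rewrite [X in _ <= X * _](_ : _ = eta / 4 + eta / 4); last by field.
  rewrite mulrDl; apply: lerD.
    apply: le_trans (Ydiff _ t01) _; apply: le_trans (ler_wpM2l (ltW c0) (uv _ t01)) _.
    rewrite [leLHS](_ : _ = c * (2 * A) * e ^+ k.+1); last by ring.
    by rewrite ler_wpM2r // ltW.
  rewrite normrZ gtr0_norm // mulrC ler_wpM2r ?(ltW ek0) //.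
  have -> : Ta (u t, e) - Tb (v t, e) - (a - b) = (Ta (u t, e) - a) - (Tb (v t, e) - b).
    by apply/rowP => i; rewrite !mxE; ring.
  apply: le_trans (ler_normB _ _) _.
  by have := Tas _ (ub _ t01).1; have := Tbs _ (vb _ t01).1; lra.
rewrite -(ler_pM2r ek0).
have -> : `|a - b| * e ^+ k.+1 = `|e ^+ k.+1 *: (a - b)|.
  by rewrite normrZ gtr0_norm // mulrC.
have -> : e ^+ k.+1 *: (a - b) = (u 1 - v 1) - (w 1 - w 0).
  rewrite /w u0 v0 subrr scale0r subr0 subr0 scale1r.
  by rewrite subKr.
apply: le_trans (ler_normB _ _) _; rewrite u1 v1.
move: yy'; rewrite (gtr0_norm e0) [e ^+ k.+2]exprS mulrA => yy'.
move: w1; rewrite subr0 mulr1 => w1.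
have := ler_wpM2r (ltW ek0) eC; lra.
Qed.

End Uniqueness.

(** * Orbits and interpolating vector fields *)

Section CkGerms.
Context {R : realType}.

Lemma within_continuous_interior (U W : topologicalType) (A : set U) (f : U -> W) (p : U) :
  {within A, continuous f} -> interior A p -> {for p, continuous f}.
Proof.
move=> /subspace_continuousP cf Ap.
have := cf p (interior_subset Ap); rewrite within_interior //.
Qed.

Lemma near_interior (U : topologicalType) (A : set U) (p : U) :
  interior A p -> \forall q \near p, interior A q.
Proof. by move=> Ap; apply: open_nbhs_nbhs; split=> //; exact: open_interior. Qed.

Lemma Ck_smooth (U W : normedModType R) k (A : set U) (f : U -> W) (p : U) :
  Ck k A f -> interior A p -> smooth k f p.
Proof.
elim: k f p => [|k IH] f p [cf Hf] /[dup] Ap /near_interior nAp.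
  by apply: filterS nAp => q; exact: within_continuous_interior.
have [df Hv] := Hf; split=> [|v]; first by apply: filterS nAp => q; exact: df.
have [h [Ch hE]] := Hv v; apply: smooth_near (IH _ _ Ch Ap).
by apply: filterS nAp => q /hE.
Qed.

Lemma smooth_Ck1 (U W : normedModType R) (D : set U) (f : U -> W) : open D ->
  (forall x, D x -> smooth 1 f x) -> Ck 1 D f.
Proof.
move=> oD sf; split.
  apply: continuous_in_subspaceT => x /[!inE] Dx.
  exact: smooth_continuous (sf _ Dx).
split=> [p /interior_subset /sf [df _]|v]; first exact: nbhs_singleton df.
exists (fun x => 'd f x v); split=> //; split=> //.
apply: continuous_in_subspaceT => x /[!inE] Dx.
by have [_ /(_ v)] := sf _ Dx; exact: nbhs_singleton.
Qed.

End CkGerms.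

(** * Orbits as germs in (x, e) *)

Section Orbits.
Context {R : realType} {d n : nat}.
Variables (D : set 'rV[R]_d) (F : R -> 'rV[R]_d -> 'rV[R]_d).
Hypothesis openD : open D.
Let Fu (p : 'rV[R]_d * R) := F p.2 p.1.
Hypothesis sF : forall x, D x -> smooth n.+1 Fu (x, 0).
Hypothesis F0 : forall x, D x -> F 0 x = x.

Let frame : framed ('rV[R]_d * R)%type := framed_prod (framed_rV d) framed_R.

Lemma near_fixed x : D x -> \forall z \near x, Fu (z, 0) = z.
Proof.
move=> Dx; have : \forall z \near x, D z := open_nbhs_nbhs (conj openD Dx).
by apply: filterS => z /F0.
Qed.

Lemma local_inverse_germ G x : local_inverse D F G -> D x ->
  [/\ smooth n.+1 (fun p : 'rV[R]_d * R => G p.2 p.1) (x, 0), G 0 x = x &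
      \forall p \near (x, 0 : R), F p.2 (G p.2 p.1) = p.1].
Proof.
move=> GP Dx; have [K [cK KD Kx]] := open_compact_nbhd openD Dx.
have nK : \forall p \near (x, 0 : R), K p.1.
  exact: (smooth_continuous (smooth_fst 0 (x, 0 : R))).
have nP rho : 0 < rho -> \forall p \near (x, 0 : R),
    [/\ D (G p.2 p.1), F p.2 (G p.2 p.1) = p.1 & `|G p.2 p.1 - p.1| < rho].
  move=> rho0; have nE := GP _ cK KD _ rho0.
  have nE2 : \forall p \near (x, 0 : R), forall z, K z ->
      [/\ D (G p.2 z), F p.2 (G p.2 z) = z & `|G p.2 z - z| < rho].
    by have := smooth_continuous (smooth_snd 0 (x, 0 : R)) => /(_ _ nE).
  by apply: filterS2 nK nE2 => p Kp; apply.
have FG : \forall p \near (x, 0 : R), F p.2 (G p.2 p.1) = p.1.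
  by apply: filterS (nP _ ltr01) => p [].
split=> //.
  apply: (smooth_inverse (sF Dx) (near_fixed Dx)) => // rho rho0.
  have r2 : 0 < rho / 2 by rewrite divr_gt0.
  apply: filterS2 (nP _ r2) (near_small x (lexx 0) r2) => p [_ _ Gp].
  rewrite mul0r addr0 => px; rewrite -(subrKA p.1).
  by rewrite [rho]splitr; apply: le_lt_trans (ler_normD _ _) _; exact: ltrD.
apply/eqP; rewrite -subr_eq0 -normr_le0; apply/ler_addgt0Pr => e e0.
by have [_ _ /ltW] := nbhs_singleton (nP _ e0); rewrite add0r.
Qed.

(** Counting from the earliest iterate, at time -s, lets the discrete summation run forward from i =
    0 through negative and positive times alike. *)
Definition zorbit G s i (p : 'rV[R]_d * R) : 'rV[R]_d :=
  iterz (F p.2) (G p.2) (node s i) p.1.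

Lemma iter_germ (f : R -> 'rV[R]_d -> 'rV[R]_d) j x :
  smooth n.+1 (fun p : 'rV[R]_d * R => f p.2 p.1) (x, 0) -> f 0 x = x ->
  smooth n.+1 (fun p : 'rV[R]_d * R => iter j (f p.2) p.1) (x, 0) /\
  iter j (f 0) x = x.
Proof.
move=> sf fx; elim: j => [|j [IH IHx]]; first by split; [exact: smooth_fst|].
split; last by rewrite iterS IHx.
have sf' : smooth n.+1 (fun p : 'rV[R]_d * R => f p.2 p.1) (iter j (f 0) x, 0).
  by rewrite IHx; exact: sf.
exact: (@smooth_comp _ _ _ _ n.+1 (fun p : 'rV[R]_d * R => f p.2 p.1)
  (fun p => (iter j (f p.2) p.1, p.2)) (x, 0) frame sf'
  (smooth_pair IH (smooth_snd _ _))).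
Qed.

Lemma orbit_germ G s i x : local_inverse D F G -> D x ->
  smooth n.+1 (zorbit G s i) (x, 0) /\ zorbit G s i (x, 0) = x.
Proof.
move=> GP Dx; have [sG Gx _] := local_inverse_germ GP Dx.
rewrite /zorbit; case: (node s i) => j.
  exact: (@iter_germ F j x (sF Dx) (F0 Dx)).
exact: (@iter_germ G j.+1 x sG Gx).
Qed.

Lemma orbit_shift G s j x e : zorbit G s (s + j) (x, e) = iter j (F e) x.
Proof.
by rewrite /zorbit (_ : node s (s + j) = j%:Z) // /node PoszD addrAC subrr add0r.
Qed.

(** At negative times the recursion reads F (G y) = y, known only near (x, 0); hence it holds for e
    small depending on i. *)
Lemma orbitS G s i x : local_inverse D F G -> D x ->
  \forall e \near (0 : R), zorbit G s i.+1 (x, e) = Fu (zorbit G s i (x, e), e).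
Proof.
move=> GP Dx; have [sG Gx FG] := local_inverse_germ GP Dx.
have [si|si] := leqP s i.
  apply: (@nearW _ (nbhs (0 : R))) => e.
  by rewrite -(subnKC si) -addnS !orbit_shift.
have nodeE k : (k < s)%N -> node s k = Negz (s - k).-1.
  move=> ks; rewrite NegzE prednK ?subn_gt0 // /node.
  by rewrite -subzn ?(ltnW ks) // opprB.
pose k := (s - i).-1.
have kE : (s - i = k.+1)%N by rewrite /k prednK // subn_gt0.
have orbE e : zorbit G s i (x, e) = iter k.+1 (G e) x.
  by rewrite /zorbit nodeE // kE.
have orbSE e : zorbit G s i.+1 (x, e) = iter k (G e) x.
  have [si'|si'] := ltnP i.+1 s.
    rewrite /zorbit nodeE //= subnS kE /=.
    have : (0 < k)%N by rewrite -ltnS -kE ltn_subRL addn1.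
    by case: k {kE orbE} => //.
  have k0 : k = 0%N.
    by apply/eqP; rewrite -leqn0 -ltnS -kE leq_subLR addn1.
  have sE : s = i.+1 by apply/eqP; rewrite eqn_leq si'.
  by rewrite k0 /zorbit /node sE subrr.
have [sit itx] := iter_germ k sG Gx.
have sc : smooth n.+1 (fun e => (iter k (G e) x, e)) 0.
  apply: (@smooth_comp _ _ _ _ n.+1
    (fun p : 'rV[R]_d * R => (iter k (G p.2) p.1, p.2)) (fun e => (x, e)) 0 frame).
    by apply: smooth_pair sit _; exact: smooth_snd.
  by apply: smooth_pair; [exact: smooth_cst|exact: smooth_id].
have := smooth_continuous sc; rewrite /prop_for /continuous_at /= itx => cc.
have := cc _ FG; rewrite nbhs_simpl /= => H.
apply: (@filterS _ (nbhs (0 : R)) _ _ _ _ H) => e /= He.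
by rewrite orbE orbSE iterS /Fu /= He.
Qed.

(** The polynomials depend neither on G nor on s: at times j >= 0 the orbit involves F alone, and k
    + 1 such values determine a polynomial of degree at most k. *)
Lemma orbit_poly x : D x -> exists p : nat -> 'I_d -> {poly R},
  (forall k a, (k <= n)%N -> (size (p k a) <= k.+1)%N) /\
  forall G, local_inverse D F G -> forall s i k a, (k <= n)%N ->
    derive1n k (fun e => zorbit G s i (x, e) 0 a) 0 = (p k a).[i%:R - s%:R].
Proof.
move=> Dx.
have H G s k a : local_inverse D F G -> (k <= n)%N ->
    exists2 p : {poly R}, (size p <= k.+1)%N & forall i,
      derive1n k (fun e => zorbit G s i (x, e) 0 a) 0 = p.[i%:R - s%:R].
  move=> GP kn; have so i := orbit_germ s i GP Dx.
  have sl i : smooth n.+1 (fun e => zorbit G s i (x, e)) 0.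
    by apply: smooth_slice; [exact: framed_rV|case: (so i)].
  have jo := jets_orbit s%:R (sF Dx) (near_fixed Dx) sl
    (fun i => (so i).2) (fun i => orbitS s i GP Dx) (leqW kn) a.
  exact: jets_derive1n (leqnn k) jo.
have [G0 G0P] : exists G, local_inverse D F G.
  by apply: exists_local_inverse => // z Dz; apply: smooth_leq (sF Dz).
have /choice[p pP] : forall ka : nat * 'I_d, exists p : {poly R},
    (ka.1 <= n)%N -> (size p <= ka.1.+1)%N /\ forall i,
      derive1n ka.1 (fun e => zorbit G0 0 i (x, e) 0 ka.2) 0 = p.[i%:R - 0%:R].
  move=> [k a] /=; have [kn|_] := leqP k n; last by exists 0.
  by have [p sp pE] := H G0 0%N k a G0P kn; exists p.
exists (fun k a => p (k, a)); split=> [k a kn|G GP s i k a kn].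
  by have [] := pP (k, a) kn.
have [q sq qE] := H G s k a GP kn; have [sp pE] := pP (k, a) kn; rewrite qE.
suff -> : q = p (k, a) by [].
apply/eqP; rewrite -subr_eq0; apply/eqP; apply: (@poly_eq0_nat _ _ k.+1 0).
  by apply: leq_trans (size_polyD _ _) _; rewrite geq_max sq size_polyN.
move=> j _; rewrite hornerD hornerN -pE /=.
have <- : (s + j)%:R - s%:R = j%:R - 0 :> R by rewrite natrD addrAC subrr add0r subr0.
rewrite -qE; apply/eqP; rewrite subr_eq0; apply/eqP; congr (derive1n _ _ _).
by apply/funext => e; rewrite orbit_shift -[j in zorbit G0 0 j]add0n orbit_shift.
Qed.

End Orbits.

(** * Auxiliary facts on jets *)

Section JetTools.
Context {R : realType}.

Lemma jets_of_derive1n (T : Type) (tau : T -> R) l k (y : T -> R -> R) :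
  (forall i, (i <= l)%N -> polyT tau (k + i) (fun t => derive1n i (y t) 0)) ->
  jets tau l k y.
Proof.
elim: l k y => [|l IH] k y H; split=> //.
- by have := H 0%N isT; rewrite addn0.
- by have := H 0%N isT; rewrite addn0.
apply: IH => i il; have [p sp pE] := H i.+1 il.
by exists p => [|t]; rewrite ?addSnnS // -pE derive1Sn.
Qed.

Lemma smooth_slice_jet (P W : normedModType R) k l (X : P * R -> W) (q : P) :
  framed P -> smooth (k + l) X (q, 0) ->
  smooth k (fun z => derive1n l (fun e => X (z, e)) 0) q.
Proof.
move=> fP; elim: l X => [|l IH] X sX.
  rewrite addn0 in sX.
  apply: (@smooth_comp _ _ _ _ k X (fun z => (z, 0)) q (framed_prod fP framed_R) sX).
  exact: smooth_pair (smooth_id k q) (smooth_cst k 0 q).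
rewrite addnS in sX; have [dX sX'] := sX.
apply: smooth_near (IH _ (sX' (0, 1))).
have cq : {for q, continuous (fun z : P => (z, 0 : R))}.
  exact: smooth_continuous (smooth_pair (smooth_id 0 q) (smooth_cst 0 (0 : R) q)).
have := cq _ (near_join dX); rewrite nbhs_simpl /= => H.
apply: (@filterS _ (nbhs q) _ _ _ _ H) => z nz.
transitivity (derive1n l (derive1 (fun e => X (z, e))) 0); last first.
  by rewrite -derive1Sn.
apply: (nbhs_singleton (near_eq_derive1n l _)).
have ce : {for (0 : R), continuous (fun e : R => (z, e))}.
  exact: smooth_continuous (smooth_pair (smooth_cst 0 z (0 : R)) (smooth_id 0 (0 : R))).
have := ce _ nz; rewrite nbhs_simpl /= => H'.
apply: (@filterS _ (nbhs (0 : R)) _ _ _ _ H') => e /= dXe.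
by rewrite derive1E; have [_ ->] := is_derive_slice dXe.
Qed.

Lemma smooth_horner (U : normedModType R) k (p : {poly R}) (a : U -> R) (q : U) :
  smooth k a q -> smooth k (fun z => p.[a z]) q.
Proof.
move=> sa; apply: (@smooth_near _ _ _ k (fun z => \sum_(i < size p) p`_i * a z ^+ i)).
  by apply: (@nearW _ (nbhs q)) => z; rewrite horner_coef.
by apply: smooth_sum => i _; apply: smoothM (smooth_cst _ _ _) (smoothX _ sa).
Qed.

Lemma is_derive_horner_comb (W : normedModType R) m (p : 'I_m -> {poly R}) (w : 'I_m -> W) (t : R) :
  is_derive t 1 (fun t => \sum_i (p i).[t] *: w i) (\sum_i (p i)^`().[t] *: w i).
Proof.
have -> : (fun t => \sum_i (p i).[t] *: w i) = \sum_i (fun t => (p i).[t] *: w i).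
  by apply/funext => s; rewrite fct_sumE.
by apply: is_derive_sum => i; exact: is_derive_Zl.
Qed.

End JetTools.

(** * Jets of interpolating fields and the generator *)

Section InterpolatingFields.
Context {R : realType} {d n : nat}.
Variables (D : set 'rV[R]_d) (F : R -> 'rV[R]_d -> 'rV[R]_d).
Hypothesis openD : open D.
Let Fu (p : 'rV[R]_d * R) := F p.2 p.1.
Hypothesis sF : forall x, D x -> smooth n.+1 Fu (x, 0).
Hypothesis F0 : forall x, D x -> F 0 x = x.

Let frame : framed ('rV[R]_d * R)%type := framed_prod (framed_rV d) framed_R.

Lemma smooth_orbit_comb G s m (c : 'I_m -> R) x : local_inverse D F G -> D x ->
  smooth n.+1 (fun p => \sum_i c i *: zorbit F G s i p) (x, 0).
Proof.
move=> GP Dx; apply: smooth_sum => i _; apply: smoothZl.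
by have [] := orbit_germ openD sF F0 s i GP Dx.
Qed.

(** The choice of orbit points f is free, so as to cover both the field at x and the field at
    F^j(x), whose orbit is that of x shifted by j. *)
Lemma orbit_comb_jet x : D x -> exists p : nat -> 'I_d -> {poly R},
  (forall l a, (l <= n)%N -> (size (p l a) <= l.+1)%N) /\
  forall G s m (f : 'I_m -> nat) (c : 'I_m -> R) l a, local_inverse D F G -> (l <= n)%N ->
    derive1n l (fun e => \sum_i c i *: zorbit F G s (f i) (x, e)) 0 0 a =
      \sum_i c i * (p l a).[(f i)%:R - s%:R] /\
    derive1n l (fun e => (\sum_i c i *: zorbit F G s (f i) (x, e)) 0 a) 0 =
      \sum_i c i * (p l a).[(f i)%:R - s%:R].
Proof.
move=> Dx; have [p [sp pE]] := orbit_poly openD sF F0 Dx; exists p; split=> //.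
move=> G s m f c l a GP ln.
have so (i : 'I_m) : smooth n.+1 (fun e => zorbit F G s (f i) (x, e)) 0.
  apply: smooth_slice; first exact: framed_rV.
  by have [] := orbit_germ openD sF F0 s (f i) GP Dx.
have sl (i : 'I_m) : smooth l (fun e => zorbit F G s (f i) (x, e) 0 a) 0.
  exact: (smooth_coord 0 a (smooth_leq (leqW ln) (so i))).
have sc : smooth l (fun e => \sum_i c i *: zorbit F G s (f i) (x, e)) 0.
  apply: smooth_sum => i _.
  exact: (smoothZl (c i) (smooth_leq (leqW ln) (so i))).
have E : derive1n l (fun e => (\sum_i c i *: zorbit F G s (f i) (x, e)) 0 a) 0 =
    \sum_i c i * (p l a).[(f i)%:R - s%:R].
  have -> : (fun e => (\sum_i c i *: zorbit F G s (f i) (x, e)) 0 a) =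
      (fun e => \sum_i c i * zorbit F G s (f i) (x, e) 0 a).
    by apply/funext => e; rewrite summxE; apply: eq_bigr => i _; rewrite mxE.
  rewrite (nbhs_singleton (near_derive1n_lincomb c sl)).
  by apply: eq_bigr => i _; rewrite pE.
by rewrite (nbhs_singleton (near_derive1n_coord a sc)).
Qed.

Definition field_germ G m s (p : 'rV[R]_d * R) : 'rV[R]_d :=
  interp_field (F p.2) (G p.2) m s p.1.

Lemma smooth_field G m s x : local_inverse D F G -> D x ->
  smooth n.+1 (field_germ G m s) (x, 0).
Proof. exact: smooth_orbit_comb. Qed.

Lemma field_jet x : D x -> exists p : nat -> 'I_d -> {poly R},
  (forall l a, (l <= n)%N -> (size (p l a) <= l.+1)%N) /\
  forall G m s l, local_inverse D F G -> (l <= m)%N -> (m <= n)%N ->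
    derive1n l (fun e => field_germ G m s (x, e)) 0 = \row_a (p l a)^`().[0].
Proof.
move=> Dx; have [p [sp pE]] := orbit_comb_jet Dx; exists p; split=> //.
move=> G m s l GP lm mn; have ln := leq_trans lm mn.
apply/rowP => a; rewrite mxE -(@lagrange_deriv R m s); last first.
  by apply: leq_trans (sp _ _ ln) _.
have [<- _] := pE G s m.+1 (@nat_of_ord _) (fun i => (lagrange_basis R s i)^`().[0]) l a GP ln.
by [].
Qed.

Lemma field_vanish G m s x : local_inverse D F G -> (m <= n)%N -> D x ->
  field_germ G m s (x, 0) = 0.
Proof.
move=> GP mn Dx; have [p [sp pE]] := field_jet Dx.
have := pE G m s 0%N GP (leq0n _) mn; rewrite derive1n0 => ->.
apply/rowP => a; rewrite !mxE.
have /size1_polyC -> := sp 0%N a (leq0n _).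
by rewrite derivC horner0.
Qed.

Section Generator.
Variables (G0 : R -> 'rV[R]_d -> 'rV[R]_d).
Hypothesis G0P : local_inverse D F G0.

(** The order is k + 1 because the generator of F_e is e g_e, with one factor e in front. *)
Definition generator k x :=
  (k.+1`!%:R)^-1 *: derive1n k.+1 (fun e => field_germ G0 n 0 (x, e)) 0.

Lemma smooth_generator k x : (k < n)%N -> D x -> smooth 1 (generator k) x.
Proof.
move=> kn Dx; apply: smoothZl; apply: smooth_slice_jet; first exact: framed_rV.
by apply: smooth_leq (smooth_field n 0 G0P Dx); rewrite add1n !ltnS.
Qed.

Lemma field_jet_generator G m s k x : local_inverse D F G ->
  (1 <= k <= m)%N -> (m <= n)%N -> D x ->
  (k`!%:R)^-1 *: derive1n k (fun e => field_germ G m s (x, e)) 0 =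
    generator k.-1 x.
Proof.
move=> GP /andP[k1 km] mn Dx; have [p [sp pE]] := field_jet Dx.
by rewrite /generator prednK // !pE // (leq_trans km).
Qed.

Lemma near_field_generator G m s x : local_inverse D F G -> (m <= n)%N -> D x ->
  exists2 C, 0 <= C & \forall z \near (x, 0 : R),
    `|field_germ G m s z - z.2 *: poly_field m generator z.2 z.1|
      <= C * `|z.2| ^+ m.+1.
Proof.
move=> GP mn Dx.
have sX : smooth m.+1 (field_germ G m s) (x, 0).
  by apply: smooth_leq (smooth_field m s GP Dx).
have [C C0 HC] := taylor_remainder (framed_rV d) sX; exists C => //.
have nD : \forall z \near (x, 0 : R), D z.1.
  have oD : \forall y \near x, D y := open_nbhs_nbhs (conj openD Dx).
  by have := smooth_continuous (smooth_fst 0 (x, 0 : R)) => /(_ _ oD).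
apply: filterS2 HC nD => z + Dz.
suff -> : taylor (fun l => derive1n l (fun e => field_germ G m s (z.1, e)) 0) m.+1 z.2
  = z.2 *: poly_field m generator z.2 z.1 by [].
rewrite /taylor big_ord_recl derive1n0 field_vanish // scaler0 add0r.
rewrite /poly_field scaler_sumr; apply: eq_bigr => k _.
have km : (1 <= k.+1 <= m)%N by rewrite /= ltn_ord.
by rewrite scalerA -exprS -(field_jet_generator s GP km mn Dz) scalerA.
Qed.

End Generator.

End InterpolatingFields.

Lemma near_derive1nB (R : realType) l (f g : R -> R) (t : R) :
  smooth l f t -> smooth l g t ->
  \forall e \near t, derive1n l (fun e => f e - g e) e =
    derive1n l f e - derive1n l g e.
Proof.
elim: l f g => [|l IH] f g sf sg; first by apply: (@nearW _ (nbhs t)).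
have [df _] := sf; have [dg _] := sg.
have Eq : \forall e \near t, derive1 (fun e => f e - g e) e = derive1 f e - derive1 g e.
  apply: filterS2 df dg => e dfe dge.
  rewrite !derive1E deriveB //; exact: diff_derivable.
apply: filterS2 (near_eq_derive1n l Eq) (IH _ _ (smooth_derive1 sf) (smooth_derive1 sg)).
by move=> e; rewrite !derive1Sn => -> ->.
Qed.

(** * The interpolating curve and its defect *)

Section InterpolatingCurve.
Context {R : realType} {d n : nat}.
Variables (D : set 'rV[R]_d) (F : R -> 'rV[R]_d -> 'rV[R]_d).
Hypothesis openD : open D.
Let Fu (p : 'rV[R]_d * R) := F p.2 p.1.
Hypothesis sF : forall x, D x -> smooth n.+1 Fu (x, 0).
Hypothesis F0 : forall x, D x -> F 0 x = x.
Variables (G : R -> 'rV[R]_d -> 'rV[R]_d).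
Hypothesis GP : local_inverse D F G.

Let frame : framed ('rV[R]_d * R)%type := framed_prod (framed_rV d) framed_R.
Let L (i : 'I_n.+1) : {poly R} := lagrange_basis R 0 i.
Let X := field_germ F G n 0.

Definition curve (t : R) (p : 'rV[R]_d * R) : 'rV[R]_d :=
  \sum_i (L i).[t] *: zorbit F G 0 i p.

Definition curve' (t : R) (p : 'rV[R]_d * R) : 'rV[R]_d :=
  \sum_i (L i)^`().[t] *: zorbit F G 0 i p.

Lemma is_derive_curve (t : R) p : is_derive t 1 (curve^~ p) (curve' t p).
Proof. exact: is_derive_horner_comb. Qed.

Lemma curve_node (j : 'I_n.+1) p : curve j%:R p = iter j (F p.2) p.1.
Proof.
rewrite /curve (bigD1 j) //= big1 => [|i ij].
  have := @lagrange_basis_node R n 0 j j; rewrite mulr0n subr0 /L => ->.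
  by rewrite eqxx scale1r addr0 -[X in zorbit _ _ _ X]add0n; case: p => ? ?;
    rewrite orbit_shift.
have := @lagrange_basis_node R n 0 i j; rewrite mulr0n subr0 /L => ->.
by rewrite eq_sym (negbTE ij) scale0r.
Qed.

Lemma curve_fixed t x : D x -> curve t (x, 0) = x.
Proof.
move=> Dx; rewrite /curve.
transitivity (\sum_i (L i).[t] *: x).
  by apply: eq_bigr => i _; have [_ ->] := orbit_germ openD sF F0 0 i GP Dx.
rewrite -scaler_suml.
have := @lagrange_horner R n 0 1 t _; rewrite size_poly1 hornerC => /(_ isT).
rewrite (eq_bigr (fun i => (L i).[t])) => [->|i _]; first by rewrite scale1r.
by rewrite hornerC mulr1.
Qed.

(** Time is made part of the base point, so that Taylor remainders are locally uniform in t. P is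
    the identity for [curve] and the derivative for [curve']. *)
Lemma smooth_curve_joint (P : {poly R} -> {poly R}) (t : R) x : D x ->
  smooth n.+1 (fun z : (R * 'rV[R]_d) * R =>
    \sum_i (P (L i)).[z.1.1] *: zorbit F G 0 i (z.1.2, z.2)) ((t, x), 0).
Proof.
move=> Dx; apply: smooth_sum => i _; apply: smoothZ.
  apply: smooth_horner.
  apply: (@smooth_comp _ _ _ _ n.+1 (fun y : R * 'rV[R]_d => y.1)
    (fun z : (R * 'rV[R]_d) * R => z.1) ((t, x), 0)).
  - exact: framed_prod framed_R (framed_rV d).
  - exact: smooth_fst.
  - exact: smooth_fst.
have [so _] := orbit_germ openD sF F0 0 i GP Dx.
apply: (@smooth_comp _ _ _ _ n.+1 (zorbit F G 0 i)
  (fun z : (R * 'rV[R]_d) * R => (z.1.2, z.2)) ((t, x), 0) frame so).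
apply: smooth_pair; last exact: smooth_snd.
apply: (@smooth_comp _ _ _ _ n.+1 (fun y : R * 'rV[R]_d => y.2)
  (fun z : (R * 'rV[R]_d) * R => z.1) ((t, x), 0)).
- exact: framed_prod framed_R (framed_rV d).
- exact: smooth_snd.
- exact: smooth_fst.
Qed.

Let E (z : (R * 'rV[R]_d) * R) : 'rV[R]_d :=
  curve' z.1.1 (z.1.2, z.2) - X (curve z.1.1 (z.1.2, z.2), z.2).

Let smooth_E t x : D x -> smooth n.+1 E ((t, x), 0).
Proof.
move=> Dx; apply: smoothB; first exact: (smooth_curve_joint (@deriv R)).
have sX : smooth n.+1 X (curve t (x, 0), 0).
  by rewrite curve_fixed //; exact: (smooth_field openD sF F0 n 0 GP Dx).
apply: (@smooth_comp _ _ _ _ n.+1 X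
  (fun z : (R * 'rV[R]_d) * R => (curve z.1.1 (z.1.2, z.2), z.2)) ((t, x), 0) frame sX).
by apply: smooth_pair (smooth_curve_joint id t Dx) _; exact: smooth_snd.
Qed.

(* The l-th derivative of [E] in e at 0 is a polynomial in t of degree at most
   l <= n, and it vanishes at t = 0, ..., n, where [curve] is an orbit. *)
Let E_jet t x l : D x -> (l <= n)%N -> derive1n l (fun e => E ((t, x), e)) 0 = 0.
Proof.
move=> Dx ln; have [p [sp pE]] := orbit_comb_jet openD sF F0 Dx.
have slice (Z : 'rV[R]_d * R -> 'rV[R]_d) : smooth n.+1 Z (x, 0) ->
    smooth n.+1 (fun e => Z (x, e)) 0.
  by apply: smooth_slice; exact: framed_rV.
have sQ s : smooth n.+1 (fun e => curve s (x, e)) 0.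
  by apply: (slice (curve s)); exact: (smooth_orbit_comb openD sF F0 0 _ GP Dx).
have sQ' s : smooth n.+1 (fun e => curve' s (x, e)) 0.
  by apply: (slice (curve' s)); exact: (smooth_orbit_comb openD sF F0 0 _ GP Dx).
have sX : smooth n.+1 X (x, 0) by exact: (smooth_field openD sF F0 n 0 GP Dx).
have sXQ s : smooth n.+1 (fun e => X (curve s (x, e), e)) 0.
  apply: (@smooth_comp_pair R d _ n.+1 (fun e => curve s (x, e)) X 0) => //.
  by rewrite curve_fixed.
apply/rowP => a; rewrite mxE.
have QE b s i : (i <= n)%N ->
    derive1n i (fun e => curve s (x, e) 0 b) 0 = (p i b).[s].
  move=> iN; have [_ ->] := pE G 0%N n.+1 (@nat_of_ord _) (fun k => (L k).[s]) i b GP iN.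
  by apply: lagrange_horner; exact: leq_trans (sp _ _ iN) _.
have Q'E s : derive1n l (fun e => curve' s (x, e) 0 a) 0 = (p l a)^`().[s].
  have [_ ->] := pE G 0%N n.+1 (@nat_of_ord _) (fun k => (L k)^`().[s]) l a GP ln.
  by apply: lagrange_deriv; exact: leq_trans (sp _ _ ln) _.
(* Here time is real. The jets of [curve] are polynomials in s by exactness of interpolation, and
   composition with X preserves this. *)
have [q sq qE] : polyT id l
    (fun s => derive1n l (fun e => X (curve s (x, e), e) 0 a) 0).
  apply: (@jets_derive1n R R id n 0 (fun s e => X (curve s (x, e), e) 0 a) l ln).
  apply: (@jets_comp R R id d x n (fun s e => curve s (x, e)) (fun z => X z 0 a)).
  - by move=> s; exact: smoothS (sQ s).
  - by move=> s; exact: curve_fixed.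
  - exact: (smooth_coord 0 a (smoothS sX)).
  - move=> b; apply: jets_of_derive1n => i iN.
    by exists (p i b) => [|s]; [exact: sp|exact: QE].
(* At time j the curve passes through F^j(x). The field there combines the shifted orbit, with jet u
   |-> p(u + j), and exactness gives its derivative at u = 0. *)
have XQE (j : 'I_n.+1) :
    derive1n l (fun e => X (curve j%:R (x, e), e) 0 a) 0 = (p l a)^`().[j%:R].
  have [_] := pE G 0%N n.+1 (fun i => (j + i)%N) (fun k => (L k)^`().[0]) l a GP ln.
  have -> : (fun e => (\sum_i (L i)^`().[0] *: zorbit F G 0 (j + i) (x, e)) 0 a) =
      (fun e => X (curve j%:R (x, e), e) 0 a).
    apply/funext => e; rewrite curve_node /= /X /field_germ /interp_field /=.
    congr (fun_of_matrix _ _ _); apply: eq_bigr => i _; congr (_ *: _).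
    have -> : zorbit F G 0 (j + i) (x, e) = iter (j + i) (F e) x.
      by rewrite -[(j + i)%N]add0n orbit_shift.
    by rewrite addnC iterD -(@orbit_shift R d F G 0 i) add0n.
  move=> ->.
  have sX1 : size ('X + j%:R%:P : {poly R}) = 2%N by rewrite size_XaddC.
  pose P := p l a \Po ('X + j%:R%:P).
  have PE u : P.[u] = (p l a).[u + j%:R] by rewrite horner_comp hornerD hornerX hornerC.
  transitivity (\sum_(i < n.+1) (L i)^`().[0] * P.[i%:R - 0%:R]).
    by apply: eq_bigr => i _; rewrite PE natrD mulr0n !subr0 addrC.
  rewrite lagrange_deriv; last by rewrite size_comp_poly2 // (leq_trans (sp _ _ ln)).
  by rewrite /P deriv_comp derivD derivX derivC addr0 mulr1 horner_comp hornerD hornerX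
    hornerC add0r.
have rE : (p l a)^`() = q.
  apply/eqP; rewrite -subr_eq0; apply/eqP; apply: (@poly_eq0_nat _ _ n.+1 0).
    apply: leq_trans (size_polyD _ _) _; rewrite geq_max size_polyN.
    rewrite (leq_trans sq) ?ltnS // andbT.
    apply: leq_trans (size_poly _ _) _.
    by rewrite (leq_trans (leq_pred _)) // (leq_trans (sp _ _ ln)).
  move=> j jn; rewrite subr0 hornerD hornerN -(XQE (Ordinal jn)) /= -[q.[_]]qE.
  by rewrite subrr.
have slE : smooth l (fun e => E ((t, x), e)) 0.
  by apply: smooth_leq (leqW ln) (smoothB (sQ' t) (sXQ t)).
rewrite (nbhs_singleton (near_derive1n_coord a slE)).
have sa := smooth_coord 0 a (smooth_leq (leqW ln) (sQ' t)).
have sb := smooth_coord 0 a (smooth_leq (leqW ln) (sXQ t)).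
have -> : (fun e => E ((t, x), e) 0 a) =
    (fun e => curve' t (x, e) 0 a - X (curve t (x, e), e) 0 a).
  by apply/funext => e; rewrite /E !mxE.
by rewrite (nbhs_singleton (near_derive1nB sa sb)) Q'E qE rE subrr.
Qed.

Let near_assoc (P : (R * 'rV[R]_d) * R -> Prop) (t : R) (x : 'rV[R]_d) :
  (\forall z \near ((t, x), 0 : R), P z) ->
  \forall s \near t & p \near (x, 0 : R), P ((s, p.1), p.2).
Proof.
move=> [[S C] /= [[[A B] /= [nA nB] AB] nC] SC].
exists (A, [set p | B p.1 /\ C p.2]) => /=; first by split=> //; exists (B, C).
move=> [s [y e]] /= [As [By Ce]]; apply: SC; split=> //=.
exact: (AB (s, y)).
Qed.

(** For e = 0 the curve is constant; compactness of [0, 1] makes the closeness uniform in t. *)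
Lemma near_curve_ball x r : D x -> 0 < r -> \forall p \near (x, 0 : R),
  forall t : R, 0 <= t <= 1 -> ball x r (curve t p).
Proof.
move=> Dx r0; suff H : \forall p \near (x, 0 : R), forall t,
    `[0, 1]%classic t -> ball x r (curve t p).
  by apply: filterS H => p H t t01; apply: H; rewrite /= in_itv.
have K01 := @segment_compact R 0 1.
refine (@compact_uniform_near R _ _ _ (nbhs (x, 0 : R))
  (fun t p => ball x r (curve t p)) _ K01 _) => t _.
have cc := smooth_continuous (smooth_curve_joint id t Dx).
have bx : nbhs (curve t (x, 0)) (ball x r).
  by rewrite curve_fixed //; exact: nbhsx_ballx.
have := near_assoc (cc _ bx); apply: filterS => -[s p] /=.
by case: p.
Qed.

Lemma near_curve_defect x : D x -> exists C, \forall p \near (x, 0 : R),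
  forall t : R, 0 <= t <= 1 ->
    `|curve' t p - X (curve t p, p.2)| <= C * `|p.2| ^+ n.+1.
Proof.
move=> Dx; suff [C HC] : exists C, \forall p \near (x, 0 : R), forall t,
    `[0, 1]%classic t -> `|curve' t p - X (curve t p, p.2)| <= C * `|p.2| ^+ n.+1.
  by exists C; apply: filterS HC => p H t t01; apply: H; rewrite /= in_itv.
have K01 := @segment_compact R 0 1.
refine (@compact_uniform_bound R _ _ _ (nbhs (x, 0 : R))
  (fun t p C => `|curve' t p - X (curve t p, p.2)| <= C * `|p.2| ^+ n.+1)
  _ K01 _ _).
  move=> t p C C' CC' /le_trans; apply.
  have e0 : 0 <= `|p.2| ^+ n.+1 by rewrite exprn_ge0.
  exact: (ler_wpM2r e0 CC').
move=> t _; have fr := framed_prod (framed_R (R := R)) (framed_rV d).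
have [C _ HC] := taylor_remainder fr (smooth_E t Dx); exists C.
have nD : \forall z \near ((t, x), 0 : R), D z.1.2.
  have oD : \forall y \near x, D y := open_nbhs_nbhs (conj openD Dx).
  have c1 := smooth_continuous (smooth_fst 0 ((t, x), 0 : R)).
  have c2 := smooth_continuous (smooth_snd 0 ((t, x) : R * 'rV[R]_d)).
  have n2 : nbhs ((t, x) : R * 'rV[R]_d) [set y | D y.2] := c2 _ oD.
  exact: (c1 _ n2).
have nA := near_assoc (filterI HC nD).
apply: filterS (nA _).
move=> [s [y e]] /= [+ Dy].
suff -> : taylor (fun l => derive1n l (fun e => E ((s, y), e)) 0) n.+1 e = 0.
  by rewrite subr0.
by apply: big1 => l _; rewrite E_jet ?scaler0 // -ltnS.
Qed.

End InterpolatingCurve.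

(** * Approximation by flows and uniqueness *)

Section FlowApproximation.
Context {R : realType} {d n : nat}.
Variables (D : set 'rV[R]_d) (F : R -> 'rV[R]_d -> 'rV[R]_d).
Hypothesis n_ge1 : (1 <= n)%N.
Hypothesis openD : open D.
Let Fu (p : 'rV[R]_d * R) := F p.2 p.1.
Hypothesis sF : forall x, D x -> smooth n.+1 Fu (x, 0).
Hypothesis F0 : forall x, D x -> F 0 x = x.
Variables (G0 : R -> 'rV[R]_d -> 'rV[R]_d).
Hypothesis G0P : local_inverse D F G0.

Lemma near_field_diff G m s x : local_inverse D F G -> (m <= n)%N -> D x ->
  exists2 C, 0 <= C & \forall z \near (x, 0 : R),
    `|field_germ F G0 n 0 z - field_germ F G m s z| <= C * `|z.2| ^+ m.+1.
Proof.
move=> GP mn Dx.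
have sX : smooth m.+1 (field_germ F G m s) (x, 0).
  exact: smooth_leq (smooth_field openD sF F0 m s GP Dx).
have sX0 : smooth m.+1 (field_germ F G0 n 0) (x, 0).
  exact: smooth_leq (smooth_field openD sF F0 n 0 G0P Dx).
have [C C0 HC] := taylor_remainder (framed_rV d) sX.
have [C' C'0 HC'] := taylor_remainder (framed_rV d) sX0.
exists (C' + C); first exact: addr_ge0.
have nD : \forall z \near (x, 0 : R), D z.1.
  have oD : \forall y \near x, D y := open_nbhs_nbhs (conj openD Dx).
  by have := smooth_continuous (smooth_fst 0 (x, 0 : R)) => /(_ _ oD).
apply: filterS3 HC HC' nD => z Hz Hz' Dz; rewrite mulrDl.
set T := taylor _ _ _ in Hz; set T' := taylor _ _ _ in Hz'.
have TT' : T = T'.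
  apply: eq_bigr => l _; congr (_ *: _).
  have [p [_ pE]] := field_jet openD sF F0 Dz.
  have lm : (l <= m)%N by rewrite -ltnS.
  by rewrite !pE // (leq_trans lm).
rewrite -TT' in Hz'.
have -> : field_germ F G0 n 0 z - field_germ F G m s z =
    (field_germ F G0 n 0 z - T) + (T - field_germ F G m s z) by rewrite subrKA.
by apply: le_trans (ler_normD _ _) _; apply: lerD; rewrite // distrC.
Qed.

(** The curve of X_n serves as approximate trajectory for every field Y that agrees with X_n up to
    O(e^N), which covers the polynomial field (N = n + 1) and each X_m (N = m + 1). It reaches
    F_e(x) at time 1, a node since n >= 1. *)
Lemma germ_flow_approx (Y : R -> 'rV[R]_d -> 'rV[R]_d) N : (N <= n.+1)%N ->
  (forall x, D x -> smooth 1 (fun p : 'rV[R]_d * R => Y p.2 p.1) (x, 0)) ->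
  (forall x, D x -> Y 0 x = 0) ->
  (forall x, D x -> exists2 C, 0 <= C & \forall z \near (x, 0 : R),
    `|field_germ F G0 n 0 z - Y z.2 z.1| <= C * `|z.2| ^+ N) ->
  flow_approx D F Y N.
Proof.
move=> Nn sY Y0 HY K cK KD.
refine (@compact_uniform_bound R _ K _ (nbhs (0 : R))
  (fun x e C => (exists y, flow D (Y e) 1 x y) /\
    forall y, flow D (Y e) 1 x y -> `|F e x - y| <= C * `|e| ^+ N) _ cK _ _).
  move=> x e C C' CC' [Hex Hall]; split=> // y /Hall /le_trans; apply.
  have e0 : 0 <= `|e| ^+ N by rewrite exprn_ge0.
  exact: (ler_wpM2r e0 CC').
move=> x /KD Dx.
have nY0 : \forall z \near x, Y 0 z = 0.
  have oD : \forall y \near x, D y := open_nbhs_nbhs (conj openD Dx).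
  by apply: filterS oD => z /Y0.
have [C C0 HC] := HY _ Dx.
have [C1 HC1] := near_curve_defect openD sF F0 G0P Dx.
have [r /= r0 rP] := (nbhs_ballP _ _).1 HC.
have [||C' HC'] := @near_flow_approx R d D Fu (fun p => Y p.2 p.1)
  (curve F G0 (n := n)) (curve' F G0 (n := n)) x N (`|C1| + C) openD Dx (sY _ Dx) nY0.
- by move=> rho rho0; exact: (near_curve_ball openD sF F0 G0P Dx rho0).
(* The cap 1 allows |e|^(n+1) to be bounded by |e|^N. *)
- have r1 : 0 < Num.min r 1 by rewrite lt_min r0 ltr01.
  apply: filterS3 HC1 (near_curve_ball openD sF F0 G0P Dx r0)
    (near_small x ler01 r1) => p Hp Hb Hs.
  have [pr p1] : `|p.2| < r /\ `|p.2| <= 1.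
    move: Hs; rewrite lt_min mul1r => /andP[h1 h2].
    have := normr_ge0 (p.1 - x); split; lra.
  split.
  + by have := curve_node F G0 ord0 p; rewrite /= mulr0n.
  + have := curve_node F G0 (Ordinal (n_ge1 : (1 < n.+1)%N)) p.
    by rewrite /= mulr1n.
  move=> t t01; split; first exact: is_derive_curve.
  have bz : ball (x, 0 : R) r (curve F G0 (n := n) t p, p.2).
    by split; [exact: Hb|rewrite /= -ball_normE /= sub0r normrN].
  rewrite -(subrKA (field_germ F G0 n 0 (curve F G0 (n := n) t p, p.2))) mulrDl.
  apply: le_trans (ler_normD _ _) _; apply: lerD; last exact: (rP _ bz).
  apply: le_trans (Hp _ t01) _; apply: (@le_trans _ _ (`|C1| * `|p.2| ^+ n.+1)).
    by apply: ler_wpM2r; rewrite ?exprn_ge0 // ler_norm.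
  by apply: ler_wpM2l => //; apply: ler_wiXn2l.
by exists C'.
Qed.

Lemma smooth_poly_field (g : nat -> 'rV[R]_d -> 'rV[R]_d) m k x :
  (forall j, (j < m)%N -> smooth k (g j) x) ->
  smooth k (fun p : 'rV[R]_d * R => p.2 *: poly_field m g p.2 p.1) (x, 0).
Proof.
move=> sg; apply: smoothZ; first exact: smooth_snd.
apply: smooth_sum => j _; apply: smoothZ; first exact/smoothX/smooth_snd.
apply: (@smooth_comp _ _ _ _ k (g j) (fun p : 'rV[R]_d * R => p.1) (x, 0)).
- exact: framed_rV.
- exact: sg.
- exact: smooth_fst.
Qed.

(** The competitor h is merely continuous, so its trajectories may branch; [flow_approx] provides
    one and bounds them all. Once the coefficients below k agree, both fields share the C^1 part Y
    and differ only in tails of order e^(k+1), whose values at (x, 0) are the k-th coefficients. *)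
Lemma generator_unique (g h : nat -> 'rV[R]_d -> 'rV[R]_d) :
  (forall k, (k < n)%N -> forall x, D x -> smooth 1 (g k) x) ->
  (forall k, (k < n)%N -> {within D, continuous (h k)}) ->
  flow_approx D F (fun e x => e *: poly_field n g e x) n.+1 ->
  flow_approx D F (fun e x => e *: poly_field n h e x) n.+1 ->
  forall k x, (k < n)%N -> D x -> h k x = g k x.
Proof.
move=> sg ch fg fh k; elim/ltn_ind: k => k IH x kn Dx.
pose Y (p : 'rV[R]_d * R) := p.2 *: poly_field k g p.2 p.1.
pose tail (f : nat -> 'rV[R]_d -> 'rV[R]_d) (p : 'rV[R]_d * R) :=
  \sum_(j < n | (k <= j)%N) p.2 ^+ (j - k) *: f j p.1.
have split_poly f : (forall j, (j < k)%N -> forall z, D z -> f j z = g j z) ->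
    forall e z, D z -> e *: poly_field n f e z = Y (z, e) + e ^+ k.+1 *: tail f (z, e).
  move=> fgE e z Dz; rewrite /Y /poly_field /tail /=.
  rewrite (bigID (fun j : 'I_n => (j < k)%N)) /= scalerDr; congr (_ + _).
    rewrite -(big_mkord (fun j => (j < k)%N) (fun j => e ^+ j *: f j z)).
    rewrite -(big_mkord xpredT (fun j => e ^+ j *: g j z)).
    rewrite (big_nat_widen 0 k n _ _ (ltnW kn)) /=; congr (_ *: _).
    by apply: eq_bigr => j jk; rewrite fgE.
  rewrite !scaler_sumr; apply: eq_big => [j|j kj]; first by rewrite -leqNgt.
  rewrite !scalerA -exprS -exprD; congr (e ^+ _ *: _).
  by rewrite addSn subnKC // leqNgt.
have tail0 f : tail f (x, 0) = f k x.
  rewrite /tail (bigD1 (Ordinal kn)) //= subnn expr0 scale1r big1 ?addr0 //.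
  move=> j /andP[kj jk]; rewrite expr0n subn_eq0 leqNgt ltn_neqAle kj andbT.
  have -> : k != j by apply: contraNneq jk => kj'; apply/eqP/val_inj; rewrite /= kj'.
  by rewrite scale0r.
have ctail f : (forall j, (j < n)%N -> smooth 0 (f j) x) ->
    {for (x, 0 : R), continuous (tail f)}.
  move=> cf; apply: (@smooth_continuous _ _ _ 0); apply: smooth_sum => j _.
  apply: smoothZ; first exact/smoothX/smooth_snd.
  apply: (@smooth_comp _ _ _ _ 0 (f j) (fun p : 'rV[R]_d * R => p.1) (x, 0)).
  - exact: framed_rV.
  - exact: cf.
  - exact: smooth_fst.
have oD : \forall y \near x, D y := open_nbhs_nbhs (conj openD Dx).
have chx j : (j < n)%N -> smooth 0 (h j) x.
  move=> jn; rewrite /=; have := near_interior oD; apply: filterS => y.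
  exact: within_continuous_interior (ch _ jn).
have cgx j : (j < n)%N -> smooth 0 (g j) x.
  by move=> jn; apply: (smoothS (sg _ jn _ Dx)).
have K1 : compact [set x] by exact: compact_set1.
have KD : [set x] `<=` D by move=> _ ->.
have [Ch Hh] := fh _ K1 KD; have [Cg Hg] := fg _ K1 KD.
have sY : smooth 1 Y (x, 0).
  by apply: smooth_poly_field => j jk; apply: sg => //; exact: ltn_trans kn.
have Y0 : \forall z \near x, Y (z, 0) = 0.
  by apply: (@nearW _ (nbhs x)) => z; rewrite /Y scale0r.
have fgE j : (j < k)%N -> forall z, D z -> h j z = g j z.
  by move=> jk z Dz; apply: IH => //; exact: ltn_trans kn.
rewrite -(tail0 h) -(tail0 g).
apply: (@leading_term_unique R d D Y (tail h) (tail g) x k (`|Ch| + `|Cg|)) => //.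
- exact: ctail.
- exact: ctail.
have ne1 : \forall e \near (0 : R), `|e| <= 1.
  have := nbhsx_ballx (0 : R) _ ltr01; apply: filterS => e.
  by rewrite -ball_normE /= sub0r normrN => /ltW.
apply: filterS3 Hh Hg ne1 => e /(_ x erefl)[[y fy] Hy] /(_ x erefl)[[y' fy'] Hy'] e1.
exists y, y'; split.
(* The lower coefficients agree only on D, which suffices since trajectories stay in D by definition
   of [flow]. *)
- by apply: flow_congr fy => z; exact: split_poly.
- by apply: flow_congr fy' => z; exact: split_poly.
have -> : y - y' = (F e x - y') - (F e x - y).
  by apply/rowP => i; rewrite !mxE; ring.
apply: le_trans (ler_normB _ _) _; rewrite mulrDl addrC.
(* As k < n, the allowed error is of higher order than the leading term e^(k+1). *)
have ek : `|e| ^+ n.+1 <= `|e| ^+ k.+2 by apply: ler_wiXn2l.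
have en : 0 <= `|e| ^+ n.+1 by rewrite exprn_ge0.
apply: lerD.
  apply: le_trans (Hy _ fy) _; apply: (@le_trans _ _ (`|Ch| * `|e| ^+ n.+1)).
    by rewrite ler_wpM2r // ler_norm.
  by rewrite ler_wpM2l.
apply: le_trans (Hy' _ fy') _; apply: (@le_trans _ _ (`|Cg| * `|e| ^+ n.+1)).
  by rewrite ler_wpM2r // ler_norm.
by rewrite ler_wpM2l.
Qed.

End FlowApproximation.

Theorem theorem1 (R : realType) (d n : nat) (n_ge1 : (1 <= n)%N)
    (D : set 'rV[R]_d) (openD : open D) (e0 : R) (e0_gt0 : 0 < e0)
    (F : R -> 'rV[R]_d -> 'rV[R]_d)
    (F_Ck : Ck n.+1 (D `*` `[- e0, e0]%classic)
              (fun p : 'rV[R]_d * R => F p.2 p.1))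
    (F_tan : tangent_to_identity D e0 n F) :
  exists g : nat -> 'rV[R]_d -> 'rV[R]_d,
    [/\ forall k : nat, (k < n)%N -> Ck 1 D (g k),
        flow_approx D F (fun e x => e *: poly_field n g e x) n.+1,
        forall h : nat -> 'rV[R]_d -> 'rV[R]_d,
          (forall k : nat, (k < n)%N -> {within D, continuous (h k)}) ->
          flow_approx D F (fun e x => e *: poly_field n h e x) n.+1 ->
          forall (k : nat) (x : 'rV[R]_d), (k < n)%N -> D x -> h k x = g k x,
        exists G : R -> 'rV[R]_d -> 'rV[R]_d, local_inverse D F G &
        forall G : R -> 'rV[R]_d -> 'rV[R]_d, local_inverse D F G ->
        forall m s : nat, (1 <= m <= n)%N -> (s <= m)%N ->
          (forall (k : nat) (x : 'rV[R]_d), (1 <= k <= m)%N -> D x ->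
             let X := fun e : R => interp_field (F e) (G e) m s x in
             nderivable k X 0 /\
             (k`!%:R)^-1 *: derive1n k X 0 = g k.-1 x) /\
          flow_approx D F (fun e => interp_field (F e) (G e) m s) m.+1].
Proof.
(* Since e0 > 0, the point (x, 0) is interior to the domain, where [Ck] speaks of genuine
   derivatives. *)
have sF x : D x -> smooth n.+1 (fun p : 'rV[R]_d * R => F p.2 p.1) (x, 0).
  move=> Dx; apply: Ck_smooth F_Ck _; exists (D, `]- e0, e0[%classic) => /=.
    split; first exact: open_nbhs_nbhs.
    by apply: open_nbhs_nbhs; split; [exact: interval_open|rewrite /= in_itv /= oppr_lt0 e0_gt0].
  move=> [y e] /= [Dy]; rewrite !in_itv /= => /andP[e1 e2].
  by split=> //=; rewrite !ltW.
have F0 x : D x -> F 0 x = x.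
  move=> Dx; have [f [r [FE _]]] := F_tan.
  by rewrite FE // ?normr0 1?ltW // scale0r addr0.
have sF1 x : D x -> smooth 1 (fun p : 'rV[R]_d * R => F p.2 p.1) (x, 0).
  by move=> Dx; apply: smooth_leq (sF _ Dx).
have [G0 G0P] := exists_local_inverse openD sF1 F0.
have sg k : (k < n)%N -> forall x, D x -> smooth 1 (generator (n := n) F G0 k) x.
  by move=> kn x Dx; exact: (smooth_generator openD sF F0 G0P kn Dx).
have gF : flow_approx D F
    (fun e x => e *: poly_field n (generator (n := n) F G0) e x) n.+1.
  apply: (germ_flow_approx n_ge1 openD sF F0 G0P (leqnn _)) => x Dx.
  - by apply: smooth_poly_field => j jn; exact: sg.
  - by rewrite scale0r.
  - exact: (near_field_generator openD sF F0 G0P 0 G0P (leqnn n) Dx).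
exists (generator (n := n) F G0); split=> //.
- by move=> k kn; exact: (smooth_Ck1 openD (sg k kn)).
- move=> h ch hF k x kn Dx.
  exact: (generator_unique openD sg ch gF hF kn Dx).
- by exists G0.
move=> G GP m s /andP[m1 mn] sm; split.
  move=> k x /andP[k1 km] Dx /=; split.
    apply: smooth_nderivable; apply: (smooth_leq (l := n.+1)).
      exact: leqW (leq_trans km mn).
    exact: (smooth_slice (framed_rV d) (smooth_field openD sF F0 m s GP Dx)).
  apply: (field_jet_generator openD sF F0 G0P s GP _ mn Dx).
  by rewrite k1.
have mn1 : (m.+1 <= n.+1)%N by [].
apply: (germ_flow_approx n_ge1 openD sF F0 G0P mn1) => x Dx.
- exact: (@smooth_leq _ _ _ 1 n.+1) (smooth_field openD sF F0 m s GP Dx).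
- exact: (field_vanish openD sF F0 s GP mn Dx).
- exact: (near_field_diff openD sF F0 G0P s GP mn Dx).
Qed.
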